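(* For some $T\in(0,\infty]$, let $a:(0,T)\to(0,\infty)$ and $b:(0,T)\to\mathbb{R}$ be continuously differentiable functions such that $b'(t)>0$ for all $t\in(0,T)$ and $\lim_{t\downarrow 0}b(t)=-\infty$. Let $\psi:[0,T)\to\mathbb{R}$ be a continuous function, and define $$\phi(t):=\frac{a(t)}{e^{b(t)/2}},\qquad \sigma(t):=\sqrt{b'(t)\,a(t)^2},\qquad t\in(0,T).$$ Suppose that $\phi$ can be extended to be continuously differentiable on $[0,T)$ with $\phi(0)=1$, and that $\sigma$ can be extended to be continuous on $[0,T)$; denote the extensions again by $\phi$ and $\sigma$. Let $(B_t)_{t\ge 0}$ be a standard Wiener process on a probability space $(\Omega,\mathcal{A},\mathbb{P})$, let $\xi\in\mathbb{R}$ be non-random, and let $(Z_t)_{t\in[0,T)}$ be the pathwise unique strong solution of $$\mathrm{d}Z_t=\left(\frac{\phi'(t)}{\phi(t)}Z_t+\psi(t)\right)\mathrm{d}t+\sigma(t)\,\mathrm{d}B_t,\qquad t\in[0,T),\qquad Z_0=\xi.$$ Then there exists a strictly stationary centered Ornstein-Uhlenbeck process $R=(R_t)_{t\in\mathbb{R}}$ with $\operatorname{Cov}(R_s,R_t)=e^{-|t-s|/2}$, $s,t\in\mathbb{R}$, such that, almost surely, $$a(t)\,R_{b(t)}=\widetilde Z_t:=Z_t-\mathbb{E}(Z_t)\qquad\text{for all } t\in[0,T),$$ where the left-hand side for $t=0$ is understood as an almost sure limit as $t\downarrow 0$.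
   Context: A strictly stationary centered Ornstein-Uhlenbeck process $R=(R_t)_{t\in\mathbb{R}}$ with $\operatorname{Cov}(R_s,R_t)=e^{-|t-s|/2}$ is a centered Gaussian process indexed by $\mathbb{R}$, with continuous sample paths and this covariance function; equivalently, it has the law of $(e^{-t/2}W_{e^t})_{t\in\mathbb{R}}$ for a standard Wiener process $W$. The solution of the SDE is given explicitly by $Z_t=\phi(t)\left(\xi+\int_0^t\frac{\psi(u)}{\phi(u)}\,\mathrm{d}u+\int_0^t\frac{\sigma(u)}{\phi(u)}\,\mathrm{d}B_u\right)$, $t\in[0,T)$.
   Formalization: If T = ∞ and b is bounded above, R is only claimed on an extension of (Ω, A, P), since on Ω itself it may fail to exist (e.g. φ = 1, b(t) = ln(t/(1+t)), Wiener space); if T < ∞ or b is unbounded above, R is obtained on Ω itself. *)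

(* Defs.v *)
From HB Require Import structures.
From mathcomp Require Export all_boot all_order all_algebra.
From mathcomp Require Export all_classical all_reals all_analysis.
Export numFieldNormedType.Exports.

Set Implicit Arguments.
Unset Strict Implicit.
Unset Printing Implicit Defensive.

Import Order.TTheory GRing.Theory Num.Theory.

Local Open Scope classical_set_scope.
Local Open Scope ring_scope.

(** Time intervals (0, T) and [0, T); the horizon [T] may be [+oo]. Functions
    on these intervals are total functions on [R] whose values outside the
    interval are irrelevant. *)
Definition open_horizon (R : realType) (T : \bar R) : set R :=
  [set t | 0 < t /\ (t%:E < T)%E].

Definition horizon (R : realType) (T : \bar R) : set R :=
  [set t | 0 <= t /\ (t%:E < T)%E].

(** [df] is the derivative of [f] relative to [D], hence one-sided at an end
    point of [D] that belongs to [D]. *)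
Definition C1_on (R : realType) (D : set R) (f df : R -> R) : Prop :=
  (forall t, D t -> (f s - f t) / (s - t) @[s --> within D t^'] --> df t) /\
  {within D, continuous df}.

Section Processes.
Context (d : measure_display) (Omega : measurableType d) (R : realType).
Variable P : probability Omega R.

(** [set T] is an allowed choice of [A i], so the product rule for the whole
    family contains the product rule for every subfamily. *)
Definition mutually_independent (n : nat) (X : 'I_n -> Omega -> R) : Prop :=
  forall A : 'I_n -> set R, (forall i, measurable (A i)) ->
    P (\bigcap_(i in [set: 'I_n]) (X i @^-1` A i)) =
    (\prod_(i < n) P (X i @^-1` A i))%E.

(** Only the values at indices [t >= 0] matter. *)
Definition standard_wiener (B : R -> {RV P >-> R}) : Prop :=
  [/\ {ae P, forall w, B 0 w = 0},
      {ae P, forall w, {within [set t : R | 0 <= t],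
                          continuous (fun t => B t w)}},
      (forall (n : nat) (t : nat -> R),
         0 <= t 0%N -> (forall i, t i <= t i.+1) ->
         mutually_independent
           (fun (i : 'I_n) w => B (t i.+1) w - B (t i) w)) &
      (forall s t, 0 <= s -> s < t -> forall A : set R, measurable A ->
         P ((fun w => B t w - B s w) @^-1` A) =
         normal_prob 0 (Num.sqrt (t - s)) A)].

(** The normal law with mean [m] and standard deviation [s]. The case [s = 0]
    is separate because [normal_prob m 0] is not a point mass in the library. *)
Definition gaussian_law (m s : R) : set R -> \bar R :=
  if s == 0 then dirac m else normal_prob m s.

Definition gaussian_rv (Y : Omega -> R) : Prop :=
  exists m s : R, 0 <= s /\ forall A : set R, measurable A ->
    P (Y @^-1` A) = gaussian_law m s A.

Definition gaussian_process (X : R -> {RV P >-> R}) : Prop :=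
  forall (n : nat) (c t : 'I_n -> R),
    gaussian_rv (fun w => \sum_(i < n) c i * X (t i) w).

(** A centered Gaussian process is determined in law by its covariance, here a
    function of [t - s] only; strict stationarity is thus part of the
    definition and not a further axiom. *)
Definition stationary_OU (X : R -> {RV P >-> R}) : Prop :=
  [/\ gaussian_process X,
      (forall t, 'E_P[X t] = 0)%E,
      (forall s t, covariance P (X s) (X t) = (expR (- `|t - s| / 2))%:E) &
      (forall w, continuous (fun t => X t w))].

(** A list of triples [(c, (u, v))] encodes the step function
    [sum c * 1_(u, v]]; its integral against [B] is [sum c * (B v - B u)]. *)
Definition step_fun (s : seq (R * (R * R))) (x : R) : R :=
  \sum_(p <- s) p.1 * \1_(`]p.2.1, p.2.2]%classic) x.

Definition step_integral (B : R -> {RV P >-> R}) (s : seq (R * (R * R)))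
    (w : Omega) : R :=
  \sum_(p <- s) p.1 * (B p.2.2 w - B p.2.1 w).

(** [X] is the Ito integral of the deterministic function [f] over [0, t]
    (Wiener integral): the L^2(P)-limit of the integrals of step functions
    converging to [f] in L^2([0, t]). *)
Definition wiener_integral (B : R -> {RV P >-> R}) (f : R -> R) (t : R)
    (X : {RV P >-> R}) : Prop :=
  exists s : nat -> seq (R * (R * R)),
    [/\ (forall n p, p \in s n -> 0 <= p.2.1 <= p.2.2 /\ p.2.2 <= t),
        ((\int[lebesgue_measure]_(x in `[0%R, t])
            ((step_fun (s n) x - f x) ^+ 2)%:E)%E @[n --> \oo] --> 0%E) &
        ('E_P[fun w => ((step_integral B (s n) w - X w) ^+ 2)%R]
            @[n --> \oo] --> 0)%E].

Definition wiener_integral_process (B : R -> {RV P >-> R}) (T : \bar R)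
    (f : R -> R) (I : R -> {RV P >-> R}) : Prop :=
  (forall t, horizon T t -> wiener_integral B f t (I t)) /\
  {ae P, forall w, {within horizon T, continuous (fun t => I t w)}}.

(** The filtration generated by [B], augmented by the null sets. *)
Definition augmented_filtration (B : R -> {RV P >-> R}) (t : R)
    : set (set Omega) :=
  <<s [set A | exists s (C : set R),
         [/\ 0 <= s <= t, measurable C & A = B s @^-1` C]]
      `|` [set N | P.-negligible N] >>.

(** [Z] is a strong solution on [0, T) of
      dZ_t = mu(t, Z_t) dt + sigma(t) dB_t,  Z_0 = xi,
    with a non-random initial value and a non-random diffusion coefficient. *)
Definition strong_solution (B : R -> {RV P >-> R}) (T : \bar R)
    (mu : R -> R -> R) (sigma : R -> R) (xi : R) (Z : R -> {RV P >-> R})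
    : Prop :=
  [/\ (forall t, horizon T t -> forall A : set R, measurable A ->
         augmented_filtration B t (Z t @^-1` A)),
      {ae P, forall w, {within horizon T, continuous (fun t => Z t w)}},
      {ae P, forall w, Z 0 w = xi},
      {ae P, forall w, forall t, horizon T t ->
         lebesgue_measure.-integrable `[0, t]
           (fun u => (mu u (Z u w))%:E)} &
      exists2 I : R -> {RV P >-> R}, wiener_integral_process B T sigma I &
        {ae P, forall w, forall t, horizon T t ->
           Z t w = xi + Rintegral lebesgue_measure `[0, t]
                          (fun u => mu u (Z u w)) + I t w}].

(** Almost surely [Y t = a t * U (b t)] for all [t] in [0, T), with the
    right-hand side at [t = 0] read as the limit when [t] decreases to 0, for
    some stationary Ornstein-Uhlenbeck process [U] on [(Omega, P)]. *)
Definition scaled_OU (T : \bar R) (a b : R -> R) (Y : R -> Omega -> R) : Prop :=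
  exists2 U : R -> {RV P >-> R}, stationary_OU U &
    {ae P, forall w,
       (forall t, open_horizon T t -> a t * U (b t) w = Y t w) /\
       a t * U (b t) w @[t --> 0^'+] --> Y 0 w}.

End Processes.

(** [proj : Omega' -> Omega] exhibits [(Omega', P')] as an extension of
    [(Omega, P)]; a random variable [X] on [Omega] becomes [X \o proj]. *)
Definition space_extension (R : realType) (d d' : measure_display)
    (Omega : measurableType d) (P : probability Omega R)
    (Omega' : measurableType d') (P' : probability Omega' R)
    (proj : Omega' -> Omega) : Prop :=
  measurable_fun setT proj /\
  forall A, measurable A -> P' (proj @^-1` A) = P A.

(** [Y] determines [U] only at the times in the range of [b]. If [T = +oo] and
    [b] is bounded above, [U] has to be continued beyond [sup b], which is
    impossible on [Omega] itself when every event is, up to null sets, an event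
    of [B] (e.g. [a t = expR (b t / 2)] with [b t = ln (t / (1 + t))]): [B] is
    then a function of [U] before time [sup b], and no randomness is left for
    the later increments of [U]. As usual for representation theorems, the
    process may then live on an extension of the probability space. In all
    other cases it exists on [Omega] itself. *)
Definition scaled_OU_representation (d : measure_display)
    (Omega : measurableType d) (R : realType) (P : probability Omega R)
    (T : \bar R) (a b : R -> R) (Y : R -> Omega -> R) : Prop :=
  ((T < +oo)%E \/ ~ (exists M, forall t, open_horizon T t -> b t <= M) ->
     scaled_OU P T a b Y) /\
  exists (d' : measure_display) (Omega' : measurableType d')
         (P' : probability Omega' R) (proj : Omega' -> Omega),
    space_extension P P' proj /\ scaled_OU P' T a b (fun t => Y t \o proj).

(* Main.v *)
From HB Require Import structures.
Require Import Defs.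
From mathcomp Require Import ring lra measurable_realfun.

(** Why the theorem holds. By variation of constants,
   [M t = Z t / phi t - xi - \int_0^t psi / phi] is the integral of
   [h = sigma / phi] against [B] over [[0, t]], and [Z t - E (Z t) = phi t * M t].
   The definitions of [phi] and [sigma] give [h ^ 2 = b' * expR b], the derivative
   of [expR b], and [expR b] vanishes at 0 because [b] tends to [-oo]. So the
   variance of [M t] is [expR (b t)]: [M] is a Brownian motion run with the clock
   [expR b]. Reading it in its own time, [N v = M (tau v)] with
   [expR (b (tau v)) = v], gives a Brownian motion [N] on [(0, V)], where [V]
   is the supremum of [expR b]. The process [U u = expR (- u / 2) * N (expR u)]
   is a stationary Ornstein-Uhlenbeck process, and
   [a t * U (b t) = a t * expR (- b t / 2) * M t = phi t * M t].

   If [V] is finite, [N] has to be continued past [V]. It has a limit at [V]: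
   its increments have fourth moments of order two, and a chaining argument
   with the Borel-Cantelli lemma applies ([moment4_left_limit]). From there it
   continues with the increments of a Brownian motion orthogonal to the past
   ([brownian_extension]): the increments of [B] after [T] when [T] is finite
   ([wiener_extension]), and otherwise those of a copy of [B] on a second factor
   of a product space ([product_extension]).

   Everything Gaussian takes place in L2. A Wiener integral is an L2 limit of
   integrals of step functions, which are sums of independent increments. Two
   facts make it Gaussian: normal laws are stable under independent sums and
   under L2 limits. Both are read off [B] itself, whose increments realize all
   centered normal laws ([independent_gaussian_sum], [gaussian_L2_closed]).
   Inside a space of centered Gaussian variables, laws are determined by norms,
   and the norms of Wiener integrals by the isometry ([wiener_rv_norm]).

   The equation enters through Riemann sums. With [I] the stochastic integral of
   [sigma], the sums of [(I (u_(k+1)) - I (u_k)) / phi (u_k)] converge to [M t]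
   along almost every path, by the product rule and uniform continuity
   ([integrating_factor_sum_cvg]). They are Wiener integrals of functions that
   converge to [h] in L2 ([riemann_integrand_cvg]), so their limit is the
   integral of [h]: by the isometry they are Cauchy in L2, and Fatou's lemma
   identifies the limit ([wiener_rv_ae_closed]). *)

Set Implicit Arguments.
Unset Strict Implicit.
Unset Printing Implicit Defensive.

Import Order.TTheory GRing.Theory Num.Theory.

Local Open Scope classical_set_scope.
Local Open Scope ring_scope.


(** * The L2 norm *)

Section L2.
Context d (T : measurableType d) (R : realType) (mu : {measure set T -> \bar R}).
Implicit Types f g : T -> R.

Definition L2norm f : \bar R := sqrte (\int[mu]_x ((f x) ^+ 2)%:E).

Lemma integral_sqr_ge0 f : (0 <= \int[mu]_x ((f x) ^+ 2)%:E)%E.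
Proof. by apply: integral_ge0 => x _; rewrite lee_fin sqr_ge0. Qed.
Hint Resolve integral_sqr_ge0 : core.

Lemma L2norm_ge0 f : (0 <= L2norm f)%E.
Proof. exact: sqrte_ge0. Qed.

Lemma L2norm_leP f (e : R) : 0 <= e ->
  (L2norm f <= e%:E)%E = (\int[mu]_x ((f x) ^+ 2)%:E <= (e ^+ 2)%:E)%E.
Proof.
move=> e0; rewrite [LHS](_ : _ = (L2norm f <= sqrte (e ^+ 2)%:E)%E).
  by rewrite lee_sqrt// lee_fin sqr_ge0.
by rewrite /= sqrtr_sqr ger0_norm.
Qed.

Lemma L2norm_eqP f (e : R) : 0 <= e ->
  L2norm f = e%:E <-> (\int[mu]_x ((f x) ^+ 2)%:E = (e ^+ 2)%:E)%E.
Proof.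
move=> e0; split => h.
  by rewrite -(@sqr_sqrte _ (\int[mu]_x _)%E)// -/(L2norm f) h.
by rewrite /L2norm h /= sqrtr_sqr ger0_norm.
Qed.

(** Gives access to the Minkowski inequality; the definition by the integral of the
   square is the one that meets variances and isometries. *)
Lemma L2norm_Lnorm f : L2norm f = ('N[mu]_2%:E [EFin \o f])%E.
Proof.
rewrite unlock poweR12_sqrt; last by apply: integral_ge0 => x _; exact: poweR_ge0.
congr sqrte; apply: eq_integral => x _ /=.
by rewrite -[in LHS]real_normK ?num_real// -powR_mulrn.
Qed.

Lemma L2normD f g : measurable_fun setT f -> measurable_fun setT g ->
  (L2norm (f \+ g)%R <= L2norm f + L2norm g)%E.
Proof.
move=> mf mg; rewrite !L2norm_Lnorm; apply: minkowski_EFin => //.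
by rewrite ler1n.
Qed.

Lemma L2normZ f (c : R) : measurable_fun setT f ->
  L2norm (fun x => c * f x) = (`|c|%:E * L2norm f)%E.
Proof.
move=> mf; rewrite /L2norm.
under eq_integral do rewrite exprMn EFinM.
rewrite ge0_integralZl//; first last.
- by rewrite lee_fin sqr_ge0.
- by move=> x _; rewrite lee_fin sqr_ge0.
- exact/measurable_EFinP/measurable_funX.
by rewrite sqrteM ?lee_fin ?sqr_ge0// /= sqrtr_sqr.
Qed.

Lemma eq_L2norm f g : f =1 g -> L2norm f = L2norm g.
Proof. by move=> fg; congr sqrte; apply: eq_integral => x _; rewrite fg. Qed.

Lemma L2normBC f g : L2norm (f \- g)%R = L2norm (g \- f)%R.
Proof.
by congr sqrte; apply: eq_integral => x _ /=; rewrite -sqrrN opprB.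
Qed.

Lemma L2norm_le_mid f g h : measurable_fun setT f -> measurable_fun setT g ->
  measurable_fun setT h ->
  (L2norm (f \- h)%R <= L2norm (f \- g)%R + L2norm (g \- h)%R)%E.
Proof.
move=> mf mg mh.
have -> : L2norm (f \- h)%R = L2norm ((f \- g) \+ (g \- h))%R.
  by apply: eq_L2norm => x /=; ring.
by apply: L2normD; exact: measurable_funB.
Qed.

Lemma L2norm_le_sub f g : measurable_fun setT f -> measurable_fun setT g ->
  (L2norm f <= L2norm g + L2norm (f \- g)%R)%E.
Proof.
move=> mf mg.
have -> : L2norm f = L2norm (g \+ (f \- g))%R.
  by apply: eq_L2norm => x /=; ring.
by apply: L2normD => //; exact: measurable_funB.
Qed.

Lemma L2norm_fatou (f : nat -> T -> R) g (c : R) : 0 <= c ->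
  (forall n, measurable_fun setT (f n)) -> measurable_fun setT g ->
  {ae mu, forall x, f n x @[n --> \oo] --> g x} ->
  (\forall n \near \oo, (L2norm (f n) <= c%:E)%E) ->
  (L2norm g <= c%:E)%E.
Proof.
move=> c0 mf0 mg fg0 [N _ HN].
wlog {HN} fc : f mf0 fg0 / forall n, (L2norm (f n) <= c%:E)%E => [wl|].
  apply: (wl (fun n => f (n + N)%N)) => //.
    by apply: filterS fg0 => x; rewrite (cvg_shiftn N (f ^~ x)).
  by move=> n; apply: HN => /=; rewrite leq_addl.
rewrite L2norm_leP//.
have mf2 n : measurable_fun setT (fun x => (f n x ^+ 2)%:E).
  exact/measurable_EFinP/measurable_funX.
have f20 n x : [set: T] x -> (0 <= (f n x ^+ 2)%:E)%E.
  by move=> _; rewrite lee_fin sqr_ge0.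
have fg2 : {ae mu, forall x, limn_einf (fun n => (f n x ^+ 2)%:E) = (g x ^+ 2)%:E}.
  apply: filterS fg0 => x fgx.
  have : (f n x ^+ 2)%:E @[n --> \oo] --> (g x ^+ 2)%:E.
    by apply: cvg_EFin; [exact: nearW|apply: cvgM].
  by move=> /cvg_limn_einf_sup[].
have h := @fatou _ _ _ mu _ measurableT (fun n x => (f n x ^+ 2)%:E) mf2 f20.
apply: le_trans (le_trans h _).
  rewrite le_eqVlt; apply/orP; left; apply/eqP.
  apply: ge0_ae_eq_integral => //.
  - exact/measurable_EFinP/measurable_funX.
  - under eq_fun do rewrite limn_einf_lim.
    apply: (emeasurable_fun_cvg (fun n x => einfs (fun k => (f k x ^+ 2)%:E) n)).
      by move=> n; exact: measurable_fun_einfs.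
    by move=> x _; exact: is_cvg_einfs.
  - by move=> x _; rewrite lee_fin sqr_ge0.
  - move=> x _; rewrite limn_einf_lim; apply: lime_ge; first exact: is_cvg_einfs.
    by apply: nearW => n; apply: le_ereal_inf_tmp => _ [k _ <-]; rewrite lee_fin sqr_ge0.
  - by apply: filterS fg2 => x -> _.
rewrite limn_einf_lim; apply: lime_le; first exact: is_cvg_einfs.
apply: nearW => n; apply: le_trans (_ : \int[mu]_x (f n x ^+ 2)%:E <= _)%E.
  by apply: ereal_inf_lbound; exists n => /=.
by rewrite -L2norm_leP.
Qed.

End L2.


(** * Moments and scaling of the normal law *)

Section normal_moments.
Variable R : realType.
Implicit Types (s x : R) (k n : nat).
Local Notation mu := (@lebesgue_measure R).

Lemma expRN_le_inv_sqr (y : R) : 0 < y -> expR (- y) <= 4 / y ^+ 2.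
Proof.
move=> y0; rewrite expRN.
have h : (y / 2) ^+ 2 <= expR y.
  have -> : expR y = expR (y / 2) ^+ 2.
    by rewrite expr2 -expRD; congr expR; lra.
  rewrite ler_pXn2r ?nnegrE ?expR_ge0 //; last by lra.
  by have := expR_ge1Dx (y/2); lra.
have -> : 4 / y ^+ 2 = ((y / 2) ^+ 2)^-1 by field; lra.
by rewrite lef_pV2 ?posrE ?expR_gt0 // exprn_gt0 //; lra.
Qed.

Lemma normal_pdf0E s x : s != 0 ->
  normal_pdf 0 s x = normal_peak s * expR (- x ^+ 2 / (s ^+ 2 *+ 2)).
Proof. by move=> s0; rewrite normal_pdfE// /normal_fun subr0. Qed.

(** The boundary term in the integration by parts
   [x ^ k.+1 * (x * pdf x) = - s ^ 2 * x ^ k.+1 * pdf' x] that lowers the order of a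
   moment by two. *)
Definition moment_primitive s k x := - s ^+ 2 * x ^+ k.+1 * (normal_peak s * expR (- x ^+ 2 / (s ^+ 2 *+ 2))).

Lemma is_derive_moment_primitive s k x : s != 0 -> is_derive x 1 (moment_primitive s k)
  (x ^+ k.+2 * normal_pdf 0 s x - k.+1%:R * s ^+ 2 * (x ^+ k * normal_pdf 0 s x)).
Proof.
move=> s0; rewrite normal_pdf0E // /moment_primitive.
have h : is_derive x 1 (fun x : R => expR (- x ^+ 2 / (s ^+ 2 *+ 2)))
   ((- x / s ^+ 2) * expR (- x ^+ 2 / (s ^+ 2 *+ 2))).
  apply: is_derive_eq.
  rewrite /GRing.scale /=.
  by field.
have h2 : is_derive x 1 (fun x : R => - s ^+ 2 * x ^+ k.+1) (- s ^+ 2 * (k.+1%:R * x ^+ k)).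
  have hX : is_derive x 1 (fun x : R => x ^+ k.+1) (k.+1%:R * x ^+ k).
    apply: DeriveDef; first exact: exprn_derivable.
    by rewrite exp_derive /GRing.scale /= mulr1.
  exact: (is_deriveZ (- s ^+ 2) hX).
have h3 : is_derive x 1 (fun x : R => normal_peak s * expR (- x ^+ 2 / (s ^+ 2 *+ 2)))
   (normal_peak s * ((- x / s ^+ 2) * expR (- x ^+ 2 / (s ^+ 2 *+ 2)))).
  apply: is_derive_eq; rewrite /GRing.scale /=. ring.
apply: (@is_derive_eq _ _ _ _ _ _ _ _ (is_deriveM h2 h3)).
rewrite /GRing.scale /=.
rewrite !exprS; field.
exact: s0.
Qed.

Lemma moment_primitive_cvg0 s k : s != 0 -> (k <= 2)%N ->
  moment_primitive s k n%:R @[n --> \oo] --> 0.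
Proof.
move=> s0 k2.
(* [4 / y ^ 2] with [y = n ^ 2 / (2 * s ^ 2)] is [16 * s ^ 4 / n ^ 4], which beats
   the factor [s ^ 2 * n ^ k.+1] since [k.+1 <= 3] *)
pose C := 16 * s ^+ 6 * normal_peak s.
have C0 : 0 <= C by rewrite /C mulr_ge0 ?normal_peak_ge0// mulr_ge0// exprn_even_ge0.
have h n : (0 < n)%N -> `|moment_primitive s k n%:R| <= C * n%:R^-1.
  move=> n0; have n1 : 1 <= n%:R :> R by rewrite ler1n.
  rewrite /moment_primitive normrM normrM normrN normrX normrX normrM.
  rewrite (ger0_norm (normal_peak_ge0 _)) (ger0_norm (expR_ge0 _)) (ger0_norm (ler0n _ n)).
  have s2 : 0 < s ^+ 2 by rewrite exprn_even_gt0.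
  have -> : `|s| ^+ 2 = s ^+ 2 by rewrite real_normK ?num_real.
  have n3 : n%:R ^+ k.+1 <= n%:R ^+ 3 :> R by apply: ler_weXn2l.
  have y0 : 0 < n%:R ^+ 2 / (s ^+ 2 *+ 2) :> R.
    by rewrite divr_gt0 ?exprn_gt0 ?pmulrn_rgt0 //; lra.
  have := expRN_le_inv_sqr y0; rewrite -mulNr => he.
  apply: le_trans (_ : s ^+ 2 * n%:R ^+ 3 * (normal_peak s * (4 / (n%:R ^+ 2 / (s ^+ 2 *+ 2)) ^+ 2)) <= _).
    apply: ler_pM => //.
    - by rewrite mulr_ge0// ltW.
    - by rewrite mulr_ge0 ?normal_peak_ge0 ?expR_ge0.
    - by rewrite ler_wpM2l// ltW.
    - by rewrite ler_wpM2l ?normal_peak_ge0.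
  rewrite /C le_eqVlt; apply/orP; left; apply/eqP; field.
  by rewrite s0 /=; lra.
apply/cvgr0Pnorm_le => e e0.
near=> n.
apply: le_trans (h n _) _; first by near: n; exists 1%N.
near: n.
have hc1 : (C * harmonic m : R) @[m --> \oo] --> C * 0.
  by apply: cvgM; [exact: cvg_cst|exact: cvg_harmonic].
have hc : (C * n%:R^-1 : R) @[n --> \oo] --> (0 : R).
  by rewrite -(cvg_shiftS (fun n : nat => C * n%:R^-1)); rewrite mulr0 in hc1.
move/cvgr0_norm_le : hc => /(_ _ e0); apply: filterS => n.
by apply: le_trans; exact: ler_norm.
Unshelve. all: by end_near. Qed.

Lemma normal_moment_recurrence_segment s k (c : R) : s != 0 -> 0 < c ->
  (\int[mu]_(x in `[(- c)%R, c]) (x ^+ k.+2 * normal_pdf 0 s x)%:E =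
   (k.+1%:R * s ^+ 2)%:E * (\int[mu]_(x in `[(- c)%R, c]) (x ^+ k * normal_pdf 0 s x)%:E)
   + (moment_primitive s k c - moment_primitive s k (- c))%:E)%E.
Proof.
move=> s0 c0.
set D := `[_, _]%classic.
have cp j : continuous (fun x => x ^+ j * normal_pdf 0 s x).
  by move=> x; apply: cvgM; [exact: exprn_continuous|exact: continuous_normal_pdf].
have ip j : mu.-integrable D (fun x => (x ^+ j * normal_pdf 0 s x)%:E).
  apply: continuous_compact_integrable; first exact: segment_compact.
  exact: continuous_subspaceT.
have nn : - c < c by lra.
have dt x : is_derive x 1 (moment_primitive s k) _ := is_derive_moment_primitive k x s0.
have ct : continuous (moment_primitive s k).
  move=> x; apply: differentiable_continuous; apply/derivable1_diffP.
  by case: (dt x).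
have := @continuous_FTC2 R (fun x => x ^+ k.+2 * normal_pdf 0 s x - k.+1%:R * s ^+ 2 * (x ^+ k * normal_pdf 0 s x)) (moment_primitive s k) (- c) c nn.
rewrite -/D EFinB => <-; first last.
- by move=> x _; rewrite derive1E; apply: derive_val.
- split.
  + by move=> x _; case: (dt x).
  + exact/cvg_at_right_filter/ct.
  + exact/cvg_at_left_filter/ct.
- apply: continuous_subspaceT => x; apply: cvgB; first exact: cp.
  by apply: cvgM; [exact: cvg_cst|exact: cp].
under [X in (_ = _ + X)%E]eq_integral do rewrite EFinB [X in (_ - X)%E]EFinM.
have mD : measurable D by exact: measurable_itv.
rewrite integralB//; last exact: integrableZl.
rewrite integralZl// addeC subeK//.
by rewrite fin_numM//; exact: integrable_fin_num.
Qed.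

(** Let the segment grow: for even exponents the integrands are nonnegative, so
   monotone convergence applies, and the boundary terms vanish. *)
Lemma normal_even_moment_recurrence s k : s != 0 -> ~~ odd k -> (k <= 2)%N ->
  (\int[mu]_x (x ^+ k * normal_pdf 0 s x)%:E < +oo ->
  \int[mu]_x (x ^+ k.+2 * normal_pdf 0 s x)%:E =
   (k.+1%:R * s ^+ 2)%:E * (\int[mu]_x (x ^+ k * normal_pdf 0 s x)%:E))%E.
Proof.
move=> s0 ok k2 fin.
have cvgi j : ~~ odd j -> (\int[mu]_(x in `[(- n.+1%:R)%R, n.+1%:R%R]) (x ^+ j * normal_pdf 0 s x)%:E @[n --> \oo]
   --> \int[mu]_x (x ^+ j * normal_pdf 0 s x)%:E)%E.
  move=> oj.
  have -> : [set: R] = \bigcup_n `[- n.+1%:R, n.+1%:R]%classic.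
    apply/esym; rewrite -subTset => x _.
    exists (Num.truncn `|x|) => //=; rewrite in_itv/= -ler_norml.
    by rewrite ltW// truncnS_gt.
  apply: ge0_nondecreasing_set_cvg_integral.
  - move=> m n mn; apply/subsetPset => x /=; rewrite !in_itv/= -!ler_norml => /le_trans; apply.
    by rewrite ler_nat ltnS.
  - by move=> n; exact: measurable_itv.
  - move=> n; apply: measurable_funTS; apply/measurable_EFinP.
    by apply: measurable_funM => //; exact: measurable_normal_pdf.
  - by move=> n x _; rewrite lee_fin mulr_ge0 ?normal_pdf_ge0// exprn_even_ge0.
apply: (cvg_unique _ (cvgi k.+2 _)) => //=; first by rewrite negbK.
rewrite [X in X @ _](_ : _ = (fun n => ((k.+1%:R * s ^+ 2)%:E * (\int[mu]_(x in `[(- n.+1%:R)%R, n.+1%:R%R]) (x ^+ k * normal_pdf 0 s x)%:E)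
   + (moment_primitive s k n.+1%:R - moment_primitive s k (- n.+1%:R))%:E)%E)); last first.
  by apply/funext => n; rewrite normal_moment_recurrence_segment// ltr0n.
have tN n : moment_primitive s k (- n.+1%:R) = - moment_primitive s k n.+1%:R.
  by rewrite /moment_primitive sqrrN exprNn -signr_odd /= ok expr1; ring.
under eq_fun do rewrite tN opprK.
rewrite -[X in nbhs X]adde0.
apply: cvgeD => //.
- by rewrite fin_num_adde_defl.
- by apply: cvgeZl => //; exact: cvgi.
- apply: cvg_EFin; first exact: nearW.
  rewrite -[X in _ --> X](addr0 0); have := @moment_primitive_cvg0 s k s0 k2.
  by rewrite -(cvg_shiftS (fun n => moment_primitive s k n%:R)) => h; apply: cvgD.
Qed.

Lemma normal_moment2 s : s != 0 ->
  (\int[mu]_x (x ^+ 2 * normal_pdf 0 s x)%:E = (s ^+ 2)%:E)%E.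
Proof.
move=> s0.
have h0 : (\int[mu]_x (x ^+ 0 * normal_pdf 0 s x)%:E = 1)%E.
  by under eq_integral do rewrite expr0 mul1r; rewrite integral_normal_pdf.
by rewrite (@normal_even_moment_recurrence s 0)// h0 ?ltry// mul1r mule1.
Qed.

Lemma normal_moment4 s : s != 0 ->
  (\int[mu]_x (x ^+ 4 * normal_pdf 0 s x)%:E = (3 * s ^+ 4)%:E)%E.
Proof.
move=> s0; rewrite (@normal_even_moment_recurrence s 2)// normal_moment2// ?ltry//.
by rewrite -EFinM; congr EFin; ring.
Qed.

End normal_moments.

Section laws.
Variable R : realType.
Local Notation mu := (@lebesgue_measure R).

(** The open half-lines generate the Borel sets and are stable under
   intersection. *)
Lemma measure_eq_rays (m1 m2 : {measure set (measurableTypeR R) -> \bar R}) :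
  (m1 setT < +oo)%E ->
  (forall x, m1 `]x, +oo[%classic = m2 `]x, +oo[%classic) ->
  forall A, measurable A -> m1 A = m2 A.
Proof.
move=> m1T m12 A mA.
apply: (@measure_unique _ R (measurableTypeR R) (@RGenOInfty.G R) (fun n : nat => `]- n%:R, +oo[%classic) _ _ _ _ m1 m2 _ _ A mA) => //.
- exact: RGenOInfty.measurableE.
- move=> _ _ [x ->] [y ->]; exists (Num.max x y).
  by apply/seteqP; split => z /=; rewrite !in_itv/= !andbT gt_max; [move=> [-> ->]|move/andP].
- by move=> n; exists (- n%:R).
- rewrite -subTset => x _; exists (Num.truncn `|x|).+1 => //=.
  rewrite in_itv/= andbT ltrNl; apply: le_lt_trans (truncnS_gt _).
  by rewrite -normrN ler_norm.
- by move=> _ [x ->].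
- move=> k; apply: le_lt_trans m1T; apply: le_measure; rewrite ?inE//.
Qed.

(** A half-line is an increasing union of segments; segments are the sets for which
   integration by substitution is available. *)
Lemma measure_eq_itvcc (m1 m2 : {measure set (measurableTypeR R) -> \bar R}) :
  (m1 setT < +oo)%E ->
  (forall x y, x <= y -> m1 `[x, y]%classic = m2 `[x, y]%classic) ->
  forall A, measurable A -> m1 A = m2 A.
Proof.
move=> m1T m12; apply: measure_eq_rays => // x.
pose F n := `[x + n.+1%:R^-1, x + n.+1%:R]%classic.
have FU : `]x, +oo[%classic = \bigcup_n F n.
  apply/seteqP; split => z /=; rewrite in_itv/= andbT.
  - move=> xz; have zx : 0 < z - x by lra.
    exists (maxn (Num.truncn (z - x)) (Num.truncn (z - x)^-1)) => //.
    rewrite /F/= in_itv/=; apply/andP; split.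
      rewrite -lerBrDl; rewrite -[leRHS]invrK lef_pV2 ?posrE ?invr_gt0//.
      apply/ltW/(lt_le_trans (truncnS_gt _)); rewrite ler_nat ltnS; exact: leq_maxr.
    rewrite -lerBlDl; apply/ltW/(lt_le_trans (truncnS_gt _)).
    by rewrite ler_nat ltnS; exact: leq_maxl.
  - move=> [n _]; rewrite /F/= in_itv/= => /andP[+ _]; apply: lt_le_trans.
    by rewrite ltrDl invr_gt0.
have ndF : nondecreasing_seq F.
  move=> m n mn; apply/subsetPset => z; rewrite /F/= !in_itv/= => /andP[h1 h2].
  apply/andP; split.
    by apply: le_trans h1; rewrite lerD2l lef_pV2 ?posrE// ler_nat ltnS.
  by apply: le_trans h2 _; rewrite lerD2l ler_nat ltnS.
have mF n : measurable (F n) by exact: measurable_itv.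
rewrite FU.
have c1 : m1 \o F @ \oo --> m1 (\bigcup_n F n).
  by apply: nondecreasing_cvg_mu => //; rewrite -FU; exact: measurable_itv.
have c2 : m2 \o F @ \oo --> m2 (\bigcup_n F n).
  by apply: nondecreasing_cvg_mu => //; rewrite -FU; exact: measurable_itv.
apply: cvg_unique c1 _ => //.
rewrite (_ : m1 \o F = m2 \o F)//; apply/funext => n /=; rewrite m12// lerD2l.
apply: (@le_trans _ _ 1); last by rewrite ler1n.
by rewrite invf_le1// ler1n.
Qed.

Lemma normal_pdf_scale (s c x : R) : s != 0 -> c != 0 ->
  normal_pdf 0 s (x / c) * `|c|^-1 = normal_pdf 0 (`|c| * s) x.
Proof.
move=> s0 c0; rewrite !normal_pdf0E ?mulf_neq0 ?normr_eq0//.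
have -> : normal_peak (`|c| * s) = `|c|^-1 * normal_peak s.
  rewrite /normal_peak -invfM; congr (_^-1).
  rewrite exprMn -mulrA -mulrnAr sqrtrM ?sqr_ge0// sqrtr_sqr normr_id//.
rewrite mulrAC [X in X * _]mulrC; congr (_ * expR _).
rewrite expr_div_n exprMn real_normK ?num_real//; field.
by rewrite s0 c0.
Qed.

Lemma normal_prob_scale (s c : R) (A : set R) : 0 < s -> c != 0 -> measurable A ->
  normal_prob 0 s ( *%R c @^-1` A) = normal_prob 0 (`|c| * s) A.
Proof.
move=> s0 c0 mA.
have mc : measurable_fun setT ( *%R c : measurableTypeR R -> measurableTypeR R).
  exact: mulrl_measurable.
suff : forall A, measurable A -> pushforward (normal_prob 0 s) ( *%R c) A = normal_prob 0 (`|c| * s) A.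
  by apply.
apply: (@measure_eq_itvcc (pushforward (normal_prob 0 s) _) (normal_prob 0 (`|c| * s))) => //.
  rewrite [X in (X < _)%E](_ : _ = normal_prob 0 s setT)//.
  by rewrite probability_setT ltry.
move=> a b ab; rewrite /= /pushforward /normal_prob.
have dF (x : R) : is_derive x 1 (fun x => x / c) c^-1.
  by apply: is_derive_eq; rewrite /GRing.scale /=; ring.
have dE : (fun x => x / c)^`()%classic = cst c^-1.
  by apply/funext => x; rewrite derive1E; apply: derive_val.
have cF : continuous (fun x : R => x / c) by move=> x; apply: cvgM; [exact: cvg_id|exact: cvg_cst].
have dco : derivable_oo_LRcontinuous (fun x => x / c) a b.
  split; [by move=> x _; case: (dF x)|exact/cvg_at_right_filter/cF|exact/cvg_at_left_filter/cF].
have cn : continuous (normal_pdf 0 s) by apply: continuous_normal_pdf; rewrite gt_eqF.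
have [c1|c1] := ltP 0 c.
  have -> : *%R c @^-1` `[a, b]%classic = `[a / c, b / c]%classic.
    by apply/seteqP; split => x /=; rewrite !in_itv/= ler_pdivrMr// ler_pdivlMr// ![x * c]mulrC.
  rewrite (integration_by_substitution_increasing (F := fun x => x / c))//.
  - apply: eq_integral => x _; rewrite dE /= -normal_pdf_scale ?(gt_eqF s0)//.
    by rewrite gtr0_norm.
  - by move=> x y _ _ xy; rewrite ltr_pM2r// invr_gt0.
  - by rewrite dE => x _; exact: cvg_cst.
  - by rewrite dE; exact: is_cvg_cst.
  - by rewrite dE; exact: is_cvg_cst.
  - exact: continuous_subspaceT.
have {}c1 : c < 0 by rewrite lt_neqAle c0.
have -> : *%R c @^-1` `[a, b]%classic = `[b / c, a / c]%classic.
  by apply/seteqP; split => x /=; rewrite !in_itv/= ler_ndivrMr// ler_ndivlMr// ![x * c]mulrC andbC.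
rewrite (integration_by_substitution_decreasing (F := fun x => x / c))//.
- apply: eq_integral => x _; rewrite dE /= -normal_pdf_scale ?(gt_eqF s0)//.
  by rewrite ltr0_norm// invrN.
- by move=> x y _ _ xy; rewrite ltr_nM2r// invr_lt0.
- by rewrite dE => x _; exact: cvg_cst.
- by rewrite dE; exact: is_cvg_cst.
- by rewrite dE; exact: is_cvg_cst.
- exact: continuous_subspaceT.
Qed.

End laws.


(** * Centered Gaussian random variables *)

(** The density [normal_pdf] is a version of the Radon-Nikodym derivative of the law. *)
Lemma ge0_integral_normal_prob (R : realType) (m s : R) (f : measurableTypeR R -> \bar R) :
  measurable_fun setT f -> (forall x, 0 <= f x)%E ->
  (\int[normal_prob m s]_x f x =
   \int[lebesgue_measure]_x (f x * (normal_pdf m s x)%:E))%E.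
Proof.
move=> mf f0.
have dom := normal_prob_dominates m s.
rewrite -(@Radon_Nikodym_SigmaFinite.change_of_variables _ _ _ (normal_prob m s) _ dom)//.
have fi := @Radon_Nikodym_SigmaFinite.f_integrable _ _ _ (normal_prob m s) _ dom.
have mp : measurable_fun setT (fun x : measurableTypeR R => (normal_pdf m s x)%:E).
  by apply: (@measurableT_comp _ _ _ (measurableTypeR R) R _ EFin) => //; exact: measurable_normal_pdf.
apply: ae_eq_integral => //.
- by apply: emeasurable_funM => //; exact: measurable_int fi.
- by apply: emeasurable_funM.
apply: ae_eqe_mul2l.
apply: integral_ae_eq => //.
move=> E _ mE.
by rewrite -Radon_Nikodym_SigmaFinite.f_integral.
Qed.

Section centered_gaussian.
Context d (T : measurableType d) (R : realType) (P : probability T R).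
Implicit Types (s c : R) (Y : T -> R).

(** [s] is the standard deviation, so that it is also the L2 norm of [Y]. *)
Definition centered_gaussian s Y :=
  [/\ measurable_fun setT Y, 0 <= s &
    forall A : set R, measurable A -> P (Y @^-1` A) = gaussian_law 0 s A].

Lemma measurable_preimageT Y (A : set R) : measurable_fun setT Y -> measurable A ->
  measurable (Y @^-1` A).
Proof. by move=> mY mA; rewrite -[X in measurable X]setTI; exact: mY. Qed.

Lemma centered_gaussian_ae s Y Y' : measurable_fun setT Y' ->
  {ae P, forall w, Y w = Y' w} -> centered_gaussian s Y -> centered_gaussian s Y'.
Proof.
move=> mY' YY' [mY s0 h]; split => // A mA; rewrite -h//.
have [N [mN N0 hN]] := YY'.
have e : forall X X' : T -> R, measurable_fun setT X -> measurable_fun setT X' ->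
    (forall w, ~ N w -> X w = X' w) -> (P (X @^-1` A) <= P (X' @^-1` A))%E.
  move=> X X' mX mX' XX'.
  apply: (@le_trans _ _ (P (X' @^-1` A `|` N))).
    apply: le_measure; rewrite ?inE.
    - exact: measurable_preimageT.
    - by apply: measurableU => //; exact: measurable_preimageT.
    - move=> w /= Aw; have [Nw|Nw] := pselect (N w); [by right|left].
      by rewrite -XX'.
  apply: (le_trans (measureU2 _ _ _)) => //; first exact: measurable_preimageT.
  by rewrite [X in (_ + X)%E](_ : _ = 0%E) ?adde0//; exact: N0.
apply/eqP; rewrite eq_le !e// => w Nw.
- by apply: contrapT => h1; apply: Nw; exact: hN.
- by apply: contrapT => /nesym h1; apply: Nw; exact: hN.
Qed.

Lemma centered_gaussian0 Y : measurable_fun setT Y ->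
  centered_gaussian 0 Y <-> {ae P, forall w, Y w = 0}.
Proof.
move=> mY; split.
  move=> [_ _ h]; exists (Y @^-1` [set~ 0]); split => //.
    by apply: measurable_preimageT => //; exact: measurableC.
  by rewrite h ?/gaussian_law ?eqxx /= ?diracE; [rewrite memNset//=; apply|exact: measurableC].
move=> Y0; apply: (@centered_gaussian_ae 0 (fun=> 0)) => //.
  by apply: filterS Y0 => w ->.
split => // A mA; rewrite /gaussian_law eqxx diracE.
have [A0|A0] := pselect (A 0).
  by rewrite mem_set// (_ : _ @^-1` _ = setT) ?probability_setT// -subTset => x _.
by rewrite memNset// (_ : _ @^-1` _ = set0) ?measure0// -subset0 => x.
Qed.

Lemma centered_gaussianZ s c Y : centered_gaussian s Y ->
  centered_gaussian (`|c| * s) (fun w => c * Y w).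
Proof.
move=> [mY s0 h].
have mcY : measurable_fun setT (fun w => c * Y w) by exact: measurable_funM.
have [c0|c0] := eqVneq c 0.
  rewrite c0 normr0 mul0r; apply/centered_gaussian0; first by rewrite c0 in mcY.
  by apply: aeW => w; rewrite mul0r.
have [s1|s1] := eqVneq s 0.
  rewrite s1 mulr0; apply/centered_gaussian0 => //.
  have : centered_gaussian 0 Y by rewrite -s1.
  by move/centered_gaussian0 => /(_ mY); apply: filterS => w ->; rewrite mulr0.
split => //; first by rewrite mulr_ge0.
move=> A mA; have := h ( *%R c @^-1` A).
have mc : measurable_fun setT ( *%R c : R -> R) by exact: mulrl_measurable.
rewrite /preimage/= => ->; last by rewrite -[X in measurable X]setTI; exact: mc.
rewrite /gaussian_law mulf_eq0 normr_eq0 (negbTE c0) (negbTE s1)/=.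
by rewrite normal_prob_scale// lt_neqAle eq_sym s1.
Qed.

Lemma centered_gaussian_integral s Y (f : R -> R) : 0 < s -> centered_gaussian s Y ->
  measurable_fun setT f -> (forall x, 0 <= f x) ->
  (\int[P]_w (f (Y w))%:E = \int[lebesgue_measure]_x (f x * normal_pdf 0 s x)%:E)%E.
Proof.
move=> s0 [mY _ h] mf f0.
have mf' : measurable_fun setT (fun x : measurableTypeR R => (f x)%:E).
  exact/measurable_EFinP.
have := @ge0_integral_normal_prob R 0 s (EFin \o f) mf'.
move=> /(_ (fun x => _)) e; apply: etrans (e _) => [|x]; last by rewrite /= lee_fin.
rewrite -(@ge0_integral_pushforward _ _ _ (measurableTypeR R) _ Y mY P setT (EFin \o f))//; last first.
  by move=> x _; rewrite lee_fin.
apply: eq_measure_integral => A mA _; rewrite /= /pushforward h//.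
by rewrite /gaussian_law gt_eqF.
Qed.

Lemma centered_gaussian_norm s Y : centered_gaussian s Y -> L2norm P Y = s%:E.
Proof.
move=> gY; have [mY s0 _] := gY; apply/L2norm_eqP => //.
have [s1|s1] := eqVneq s 0.
  rewrite s1 in gY *; move/centered_gaussian0 : (gY) => /(_ mY) Y0.
  rewrite expr0n/= -[RHS](@integral0 _ _ _ P setT); apply: ge0_ae_eq_integral => //.
  - exact/measurable_EFinP/measurable_funX.
  - by move=> x _; rewrite lee_fin sqr_ge0.
  - by apply: filterS Y0 => x -> _; rewrite expr0n.
have {}s0 : 0 < s by rewrite lt_neqAle eq_sym s1.
rewrite (@centered_gaussian_integral s Y (fun x => x ^+ 2))//; last first.
- by move=> x; exact: sqr_ge0.
by rewrite normal_moment2.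
Qed.

Lemma centered_gaussian_moment4 s Y : centered_gaussian s Y ->
  (\int[P]_w (Y w ^+ 4)%:E = (3 * s ^+ 4)%:E)%E.
Proof.
move=> gY; have [mY s0 _] := gY.
have [s1|s1] := eqVneq s 0.
  rewrite s1 in gY *; move/centered_gaussian0 : (gY) => /(_ mY) Y0.
  rewrite expr0n/= mulr0 -[RHS](@integral0 _ _ _ P setT); apply: ge0_ae_eq_integral => //.
  - exact/measurable_EFinP/measurable_funX.
  - by move=> x _; rewrite lee_fin exprn_even_ge0.
  - by apply: filterS Y0 => x -> _; rewrite expr0n.
have {}s0 : 0 < s by rewrite lt_neqAle eq_sym s1.
rewrite (@centered_gaussian_integral s Y (fun x => x ^+ 4))//; last first.
- by move=> x; exact: exprn_even_ge0.
by rewrite normal_moment4.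
Qed.

Lemma L2norm_Lfun2 Y s : measurable_fun setT Y -> L2norm P Y = s%:E -> Y \in Lfun P 2%:E.
Proof.
move=> mY nY; rewrite inE; apply/andP; split; rewrite inE//=.
by rewrite /finite_norm -L2norm_Lnorm nY ltry.
Qed.

Lemma Lfun2_Lfun1 Y : Y \in Lfun P 2%:E -> Y \in Lfun P 1.
Proof.
apply: Lfun_subset12; exact: fin_num_measure.
Qed.

Lemma centered_gaussian_integrable s Y : centered_gaussian s Y ->
  P.-integrable setT (EFin \o Y).
Proof.
move=> gY; apply/Lfun1_integrable; apply: Lfun2_Lfun1; have [mY _ _] := gY.
exact: (L2norm_Lfun2 mY (centered_gaussian_norm gY)).
Qed.

(** [Y] and [- Y] have the same law. *)
Lemma centered_gaussian_mean s Y : centered_gaussian s Y -> ('E_P[Y] = 0)%E.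
Proof.
move=> gY; have iY := centered_gaussian_integrable gY.
have gNY := centered_gaussianZ (-1) gY; have iNY := centered_gaussian_integrable gNY.
have [mY _ h] := gY; have [mNY _ hN] := gNY.
rewrite normrN1 mul1r in hN.
have e : ('E_P[Y] = 'E_P[(fun w => -1 * Y w)%R])%E.
  rewrite unlock.
  have i1 := @integral_pushforward _ _ T (measurableTypeR R) R Y mY P setT EFin.
  have i2 := @integral_pushforward _ _ T (measurableTypeR R) R _ mNY P setT EFin.
  rewrite -[LHS]i1//; rewrite -[RHS]i2//.
  by apply: eq_measure_integral => A mA _; rewrite /= /pushforward h// hN.
have : ('E_P[(fun w => -1 * Y w)%R] = - 'E_P[Y])%E.
  by rewrite unlock; under eq_integral do rewrite mulN1r EFinN; rewrite integralN ?integrable_add_def.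
rewrite -e; have : ('E_P[Y])%E \is a fin_num by apply: expectation_fin_num; exact/Lfun1_integrable.
case: ('E_P[Y])%E => // r _ [] /eqP; rewrite -subr_eq0 opprK => h1.
by congr EFin; lra.
Qed.

End centered_gaussian.


(** * Sums and L2 limits of Gaussian random variables *)

Lemma measure_eq_rectangles (R : realType) d1 d2
   (T1 : measurableType d1) (T2 : measurableType d2)
   (m1 m2 : {measure set (T1 * T2)%type -> \bar R}) :
  (m1 setT < +oo)%E ->
  (forall A C, measurable A -> measurable C -> m1 (A `*` C) = m2 (A `*` C)) ->
  forall D, measurable D -> m1 D = m2 D.
Proof.
move=> m1T m12 D mD.
pose G : set (set (T1 * T2)) :=
  [set D | exists A C, [/\ measurable A, measurable C & D = A `*` C]].
apply: (@measure_unique _ R _ G (fun=> setT) _ _ _ _ m1 m2 _ _ D mD) => //.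
- rewrite measurable_prod_measurableType //; congr (<<s _ >>).
  apply/seteqP; split => [_ [A mA [C mC <-]]|_ [A [C [mA mC ->]]]].
    by exists A, C.
  by exists A => //; exists C.
- move=> _ _ [A [C [mA mC ->]]] [A' [C' [mA' mC' ->]]].
  exists (A `&` A'), (C `&` C'); split; [exact: measurableI|exact: measurableI|].
  by rewrite setXI.
- by move=> _; exists setT, setT; rewrite setXTT.
- by rewrite bigcup_const//; exists 0%N.
- by move=> _ [A [C [mA mC ->]]]; exact: m12.
Qed.

Section joint_laws.
Context (R : realType) d (T : measurableType d) (P : probability T R).

(** Both sides are the mass of the set of pairs with sum in [A] for two measures on the
   plane that agree on rectangles. The extra event [F] carries the variables of
   a longer independent list through an induction on its length. *)
Lemma independent_sum_law d' (T' : measurableType d') (Q : probability T' R)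
  (X Y : T -> R) (X' Y' : T' -> R) (F : set T) :
  measurable_fun setT X -> measurable_fun setT Y ->
  measurable_fun setT X' -> measurable_fun setT Y' -> measurable F ->
  (forall A : set R, measurable A -> P (X @^-1` A) = Q (X' @^-1` A)) ->
  (forall A : set R, measurable A -> P (Y @^-1` A) = Q (Y' @^-1` A)) ->
  (forall A C : set R, measurable A -> measurable C ->
    P (X @^-1` A `&` (Y @^-1` C `&` F)) = P (X @^-1` A) * (P (Y @^-1` C) * P F))%E ->
  (forall A C : set R, measurable A -> measurable C ->
    Q (X' @^-1` A `&` Y' @^-1` C) = Q (X' @^-1` A) * Q (Y' @^-1` C))%E ->
  forall A : set R, measurable A ->
    (P ((fun w => X w + Y w)%R @^-1` A `&` F) = Q ((fun w => X' w + Y' w)%R @^-1` A) * P F)%E.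
Proof.
move=> mX mY mX' mY' mF XX' YY' hP hQ A mA.
have mXY : measurable_fun setT (fun w => (X w, Y w)) by exact: measurable_fun_pair.
have mXY' : measurable_fun setT (fun w => (X' w, Y' w)) by exact: measurable_fun_pair.
pose XY w := (X w, Y w); pose XY' w := (X' w, Y' w).
have PF0 : 0 <= fine (P F) by exact: fine_ge0.
pose S : set (R * R) := (fun z => z.1 + z.2) @^-1` A.
have mS : measurable S.
  rewrite -[X in measurable X]setTI.
  have mD : measurable_fun setT (fun z : R * R => z.1 + z.2) by exact: measurable_funD.
  exact: mD.
have := @measure_eq_rectangles R _ _ _ _ (pushforward (mrestr P mF) XY)
   (mscale (NngNum PF0) (pushforward Q XY')) _ _ S mS.
rewrite /= /mscale /pushforward /mrestr /= fineK ?fin_num_measure//.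
rewrite muleC; apply.
- exact: mXY.
- exact: mXY'.
- rewrite preimage_setT setTI; apply: le_lt_trans (probability_le1 _ mF) _.
  exact: ltry.
move=> A' C mA' mC.
rewrite (_ : (_ @^-1` _) `&` F = X @^-1` A' `&` (Y @^-1` C `&` F)); last first.
  by rewrite setIA.
rewrite /pushforward hP// XX'// YY'// [X in (_ * Q X)%E](_ : _ = X' @^-1` A' `&` Y' @^-1` C)//.
by rewrite hQ// muleA muleC.
Qed.

(** Independence of a list of random variables, by recursion on the list so that the
   two variables at its head can be merged into their sum. *)
Fixpoint joint_event (l : seq (T -> R)) (As : nat -> set R) : set T :=
  if l is X :: l' then X @^-1` As 0%N `&` joint_event l' (As \o S) else setT.

Fixpoint joint_prob (l : seq (T -> R)) (As : nat -> set R) : \bar R :=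
  if l is X :: l' then (P (X @^-1` As 0%N) * joint_prob l' (As \o S))%E else 1%E.

Definition independent_seq l := forall As, (forall n, measurable (As n)) ->
  P (joint_event l As) = joint_prob l As.

Fixpoint all_gaussian (l : seq (T -> R)) : Prop :=
  if l is X :: l' then (exists s, centered_gaussian P s X) /\ all_gaussian l' else True.

Lemma measurable_joint_event l As : all_gaussian l -> (forall n, measurable (As n)) ->
  measurable (joint_event l As).
Proof.
elim: l As => [|X l IH] As /=; first by move=> _ _; exact: measurableT.
move=> [[s [mX _ _]] gl] mAs.
apply: measurableI; last by apply: IH => // n; exact: mAs.
exact: measurable_preimageT.
Qed.

Lemma independent_seq_behead X l : independent_seq (X :: l) -> independent_seq l.
Proof.
move=> h As mAs.
have := h (fun n => if n is n'.+1 then As n' else setT).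
rewrite /= preimage_setT setTI probability_setT mul1e; apply.
by case.
Qed.

End joint_laws.

Lemma measurable_gt (R : realType) d (T : measurableType d) (Y : T -> R) (x : R) :
  measurable_fun setT Y -> measurable [set w | x < Y w].
Proof.
move=> mY; rewrite (_ : [set w | x < Y w] = Y @^-1` `]x, +oo[%classic).
  by apply: measurable_preimageT => //; exact: measurable_itv.
by apply/seteqP; split => w /=; rewrite in_itv/= andbT.
Qed.

Lemma measurable_norm_ge (R : realType) d (T : measurableType d) (Y : T -> R) (x : R) :
  measurable_fun setT Y -> measurable [set w | x <= `|Y w|].
Proof.
move=> mY; rewrite (_ : [set w | x <= `|Y w|] = (fun w => `|Y w|) @^-1` `[x, +oo[%classic).
  apply: measurable_preimageT; last exact: measurable_itv.
  exact: measurableT_comp.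
by apply/seteqP; split => w /=; rewrite in_itv/= andbT.
Qed.

Lemma chebyshev_L2norm (R : realType) d (T : measurableType d) (P : probability T R)
   (Y : T -> R) (e x : R) : 0 < x -> 0 <= e -> measurable_fun setT Y ->
  (L2norm P Y <= e%:E)%E -> (P [set w | x <= `|Y w|]%R <= (e ^+ 2 / x ^+ 2)%:E)%E.
Proof.
move=> x0 e0 mY; rewrite L2norm_leP// => h.
pose Y' : {RV P >-> R} := HB.pack Y (isMeasurableFun.Build _ _ _ _ _ mY).
have := @markov _ _ _ P Y' (fun r => r ^+ 2) x x0 _ _ _.
rewrite [X in (X -> _ -> _ -> _)](_ : _ = True); last first.
  by rewrite propeqE; split => // _; exact: (@measurable_funX _ _ _ setT id).
move=> /(_ I) h1.
have {}h1 := h1 (fun r _ => sqr_ge0 r).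
have {}h1 : ((x ^+ 2)%:E * P [set w | x%:E <= `|(Y w)%:E|] <= 'E_P[(fun w => (Y w) ^+ 2)%R])%E.
  apply: (le_trans (h1 _)).
    by move=> u v; rewrite !nnegrE => u0 v0; rewrite ler_sqr.
  rewrite le_eqVlt; apply/orP; left; apply/eqP; congr expectation.
  by apply/funext => w /=; rewrite real_normK ?num_real.
rewrite EFinM lee_pdivlMr ?exprn_gt0//.
rewrite muleC; apply: (le_trans h1); rewrite unlock; exact: h.
Qed.

(** Shift the threshold by [c]: up to events whose probability is small by the
   Chebyshev inequality, [Y > x + c] implies [Y' > x + c / 2], and [X' > x + c / 2]
   implies [X > x]. Then let [c] tend to 0. *)
Lemma L2_limit_law_le (R : realType) d (T : measurableType d) (P : probability T R)
  d' (T' : measurableType d') (Q : probability T' R) (Y : T -> R) (X : T' -> R) :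
  measurable_fun setT Y -> measurable_fun setT X ->
  (forall e : R, (0 < e)%R -> exists (Y' : T -> R) (X' : T' -> R), [/\ measurable_fun setT Y', measurable_fun setT X',
     L2norm P (Y' \- Y)%R <= e%:E, L2norm Q (X' \- X)%R <= e%:E &
     forall A : set R, measurable A -> P (Y' @^-1` A) = Q (X' @^-1` A)])%E ->
  forall x : R, (P [set w | x < Y w]%R <= Q [set w | x < X w]%R)%E.
Proof.
move=> mY mX h x.
have step c : 0 < c -> (P [set w | x + c < Y w]%R <= Q [set w | x < X w]%R)%E.
  move=> c0; apply/lee_addgt0Pr => r r0.
  (* the Chebyshev bound [e ^ 2 / (c / 2) ^ 2] is at most [r / 2] *)
  pose e := Num.min 1 (r / 2 * (c / 2) ^+ 2).
  have c2 : 0 < c / 2 by rewrite divr_gt0.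
  have q0 : 0 < r / 2 * (c / 2) ^+ 2 by rewrite mulr_gt0 ?divr_gt0 ?exprn_gt0.
  have e0 : 0 < e by rewrite lt_min ltr01.
  have [Y' [X' [mY' mX' nY nX YX]]] := h e e0.
  have er : e ^+ 2 / (c / 2) ^+ 2 <= r / 2.
    rewrite ler_pdivrMr ?exprn_gt0//; apply: (@le_trans _ _ (e * 1)).
      by rewrite expr2 ler_wpM2l ?(ltW e0)// ge_min lexx.
    by rewrite mulr1 ge_min lexx orbT.
  have cY := chebyshev_L2norm c2 (ltW e0) (measurable_funB mY' mY) nY.
  have cX := chebyshev_L2norm c2 (ltW e0) (measurable_funB mX' mX) nX.
  have i1 : (P [set w | x + c < Y w]%R <= P [set w | x + c / 2 < Y' w]%R + (r / 2)%:E)%E.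
    apply: (@le_trans _ _ (P ([set w | x + c / 2 < Y' w]%R `|` [set w | c / 2 <= `|(Y' \- Y) w|]%R))).
      apply: le_measure; rewrite ?inE.
      - exact: measurable_gt.
      - by apply: measurableU; [exact: measurable_gt|apply: measurable_norm_ge; exact: measurable_funB].
      - move=> w /= hw; have [h1|h1] := ltP (x + c / 2) (Y' w); [by left|right].
        by rewrite distrC; apply: le_trans (ler_norm _); lra.
    apply: (le_trans (measureU2 _ _ _)).
    - exact: measurable_gt.
    - by apply: measurable_norm_ge; exact: measurable_funB.
    apply: leeD => //; apply: (le_trans cY).
    by rewrite lee_fin.
  have i2 : (Q [set w | x + c / 2 < X' w]%R <= Q [set w | x < X w]%R + (r / 2)%:E)%E.
    apply: (@le_trans _ _ (Q ([set w | x < X w]%R `|` [set w | c / 2 <= `|(X' \- X) w|]%R))).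
      apply: le_measure; rewrite ?inE.
      - exact: measurable_gt.
      - by apply: measurableU; [exact: measurable_gt|apply: measurable_norm_ge; exact: measurable_funB].
      - move=> w /= hw; have [h1|h1] := ltP x (X w); [by left|right].
        by apply: le_trans (ler_norm _); lra.
    apply: (le_trans (measureU2 _ _ _)).
    - exact: measurable_gt.
    - by apply: measurable_norm_ge; exact: measurable_funB.
    apply: leeD => //; apply: (le_trans cX).
    by rewrite lee_fin.
  apply: (le_trans i1); have -> : r%:E = ((r / 2)%:E + (r / 2)%:E)%E by rewrite -EFinD -splitr.
  rewrite addeA leeD2r//.
  apply: le_trans i2; rewrite le_eqVlt; apply/orP; left; apply/eqP.
  have := YX `]x + c / 2, +oo[%classic (measurable_itv _).
  have iE (U : Type) (f : U -> R) y : f @^-1` `]y, +oo[%classic = [set w | y < f w].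
    by apply/seteqP; split => w /=; rewrite in_itv/= andbT.
  by rewrite !iE.
pose F n := [set w | x + n.+1%:R^-1 < Y w].
have FU : [set w | x < Y w] = \bigcup_n F n.
  apply/seteqP; split => w /=.
    move=> xY; have yx : 0 < Y w - x by lra.
    exists (Num.truncn (Y w - x)^-1) => //=.
    rewrite /F /= -ltrBrDl -[ltRHS]invrK ltf_pV2 ?posrE ?invr_gt0//.
    exact: truncnS_gt.
  move=> [n _]; rewrite /F/=; apply: lt_trans.
  by rewrite ltrDl invr_gt0.
have : P \o F @ \oo --> P (\bigcup_n F n).
  apply: nondecreasing_cvg_mu.
  - by move=> n; exact: measurable_gt.
  - by apply: bigcup_measurable => n _; exact: measurable_gt.
  - move=> m n mn; apply/subsetPset => w; rewrite /F/=; apply: le_lt_trans.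
    by rewrite lerD2l lef_pV2 ?posrE// ler_nat ltnS.
rewrite FU => hc; rewrite -(cvg_lim _ hc)//.
apply: lime_le; first by apply/cvg_ex; exists (P (\bigcup_n F n)).
by apply: nearW => n /=; apply: step; rewrite invr_gt0.
Qed.

(** Applied to two families with equal laws on possibly different spaces, this
   identifies the law of an L2 limit with that of a known variable. *)
Lemma L2_limit_law (R : realType) d (T : measurableType d) (P : probability T R)
  d' (T' : measurableType d') (Q : probability T' R) (Y : T -> R) (X : T' -> R) :
  measurable_fun setT Y -> measurable_fun setT X ->
  (forall e : R, (0 < e)%R -> exists (Y' : T -> R) (X' : T' -> R), [/\ measurable_fun setT Y', measurable_fun setT X',
     L2norm P (Y' \- Y)%R <= e%:E, L2norm Q (X' \- X)%R <= e%:E &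
     forall A : set R, measurable A -> P (Y' @^-1` A) = Q (X' @^-1` A)])%E ->
  forall A : set R, measurable A -> P (Y @^-1` A) = Q (X @^-1` A).
Proof.
move=> mY mX h A mA.
have := @measure_eq_rays R (@pushforward _ _ T (measurableTypeR R) R P Y) (@pushforward _ _ T' (measurableTypeR R) R Q X) _ _ A mA; apply.
  rewrite [X in (X < _)%E](_ : _ = P (Y @^-1` setT))//.
  by rewrite preimage_setT probability_setT ltry.
have iE (U : Type) (f : U -> R) y : f @^-1` `]y, +oo[%classic = [set w | y < f w].
  by apply/seteqP; split => w /=; rewrite in_itv/= andbT.
move=> x; rewrite /= /pushforward /= !iE.
apply/eqP; rewrite eq_le !L2_limit_law_le// => e /h[Y' [X' [m1 m2 n1 n2 e12]]].
by exists X', Y'; split => // B mB; rewrite e12.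
Qed.


Section wiener_gaussian.
Context (R : realType) d (T : measurableType d) (P : probability T R).
Variable B : R -> {RV P >-> R}.
Hypothesis hB : standard_wiener B.

Lemma wiener_increment_gaussian (s t : R) : 0 <= s -> s <= t ->
  centered_gaussian P (Num.sqrt (t - s)) (fun w => B t w - B s w).
Proof.
move=> s0; rewrite le_eqVlt => /predU1P[<-|st].
  rewrite subrr sqrtr0; apply/centered_gaussian0; first exact: measurable_funB.
  by apply: aeW => w; rewrite subrr.
split; [exact: measurable_funB|exact: sqrtr_ge0|move=> A mA].
have [_ _ _ h] := hB; rewrite h// /gaussian_law.
by rewrite gt_eqF// sqrtr_gt0 subr_gt0.
Qed.

(** [B] realizes all centered normal laws at once, as a curve that is continuous in L2;
   it serves as a reference for computations with these laws. *)
Lemma wiener_law (s : R) : 0 <= s ->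
  centered_gaussian P s (fun w => B (s ^+ 2) w - B 0 w).
Proof.
move=> s0; have := @wiener_increment_gaussian 0 (s ^+ 2) (lexx _) (sqr_ge0 _).
by rewrite subr0 sqrtr_sqr ger0_norm.
Qed.

(** Stability of normal laws under independent sums, read off [B]:
  [B (s^2 + t^2) - B 0] is the sum of the independent increments over
  [0, s^2] and [s^2, s^2 + t^2]. *)
Lemma independent_gaussian_sum d' (T' : measurableType d') (Q : probability T' R)
  (X Y : T' -> R) (s t : R) (F : set T') :
  centered_gaussian Q s X -> centered_gaussian Q t Y -> measurable F ->
  (forall A C : set R, measurable A -> measurable C ->
    Q (X @^-1` A `&` (Y @^-1` C `&` F)) = Q (X @^-1` A) * (Q (Y @^-1` C) * Q F))%E ->
  forall A : set R, measurable A ->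
    (Q ((fun w => X w + Y w)%R @^-1` A `&` F) =
       gaussian_law 0 (Num.sqrt (s ^+ 2 + t ^+ 2)) A * Q F)%E.
Proof.
move=> [mX s0 hX] [mY t0 hY] mF h A mA.
pose v := s ^+ 2; pose u := s ^+ 2 + t ^+ 2.
have v0 : 0 <= v by exact: sqr_ge0.
have vu : v <= u by rewrite lerDl sqr_ge0.
have [m1 _ g1] := wiener_increment_gaussian (lexx 0) v0.
have [m2 _ g2] := wiener_increment_gaussian v0 vu.
have [m3 _ g3] := wiener_increment_gaussian (lexx 0) (le_trans v0 vu).
rewrite subr0 in g3.
have uv : u - v = t ^+ 2 by rewrite /u /v; ring.
rewrite (@independent_sum_law _ _ _ Q _ _ P _ _ (fun w => B v w - B 0 w) (fun w => B u w - B v w) _ mX mY)//.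
- rewrite -/u -g3; last by [].
  by congr (P _ * _)%E; apply/funext => w; rewrite /preimage /=; congr (A _); ring.
- by move=> C mC; rewrite hX// g1// subr0 sqrtr_sqr ger0_norm.
- by move=> C mC; rewrite hY// g2// uv sqrtr_sqr ger0_norm.
- move=> C D mC mD; have [_ _ hind _] := hB.
  pose tt i : R := if i is 0%N then 0 else if i is 1%N then v else u.
  have := hind 2%N tt (lexx _); rewrite /tt => /(_ _)/=.
  have tn : forall i, tt i <= tt i.+1 by case=> [|[|i]] //=.
  move=> /(_ tn (fun i => if i == 0%N :> nat then C else D)) /=.
  rewrite !big_ord_recl big_ord0 /= mule1 => <-; last by move=> i; case: ifP.
  congr (P _); apply/seteqP; split => w /=.
    by move=> [hC hD] [[|[|//]] ? _].
  by move=> hh; split; [have := hh ord0 I|have := hh (lift ord0 ord0) I].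
Qed.

(** Merge the two variables at the head: their sum is again normal and, by the previous
   lemma with [F] an event of the tail, independent of the tail. *)
Lemma independent_gaussian_list_sum d' (T' : measurableType d') (Q : probability T' R)
  (X : T' -> R) (l : seq (T' -> R)) (s : R) :
  centered_gaussian Q s X -> all_gaussian Q l -> independent_seq Q (X :: l) ->
  exists s', centered_gaussian Q s' (fun w => X w + \sum_(Y <- l) Y w).
Proof.
elim: l X s => [|Y l IH] X s gX.
  by move=> _ _; exists s; under eq_fun do rewrite big_nil addr0.
move=> /= [[t gY] gl] hi.
have hl : independent_seq Q l by do 2 apply: independent_seq_behead; exact: hi.
have [mX s0 _] := gX; have [mY t0 _] := gY.
have key As : (forall n, measurable (As n)) -> forall A, measurable A ->
    (Q ((fun w => X w + Y w)%R @^-1` A `&` joint_event l As) =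
       gaussian_law 0 (Num.sqrt (s ^+ 2 + t ^+ 2)) A * Q (joint_event l As))%E.
  move=> mAs A mA; apply: (independent_gaussian_sum gX gY _ _ mA).
    by apply: (measurable_joint_event gl) => n; exact: mAs.
  move=> C D mC mD.
  have := hi (fun n => if n is n'.+1 then if n' is n''.+1 then As n'' else D else C).
  rewrite /= => ->; last by case=> [|[]].
  by congr (_ * (_ * _))%E; rewrite hl.
have gXY : centered_gaussian Q (Num.sqrt (s ^+ 2 + t ^+ 2)) (fun w => X w + Y w).
  split; [exact: measurable_funD|exact: sqrtr_ge0|move=> A mA].
  have := key (fun=> setT) (fun=> measurableT) A mA.
  have -> : joint_event l (fun=> setT) = setT.
    by elim: (l) => //= Z l' ->; rewrite preimage_setT setTI.
  by rewrite setIT probability_setT mule1.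
have [] := IH _ _ gXY gl.
  move=> As mAs /=; have mAs1 n : measurable ((As \o S) n) by exact: mAs.
  rewrite (key _ mAs1 _ (mAs 0%N)) (hl _ mAs1); congr (_ * _)%E.
  by have [_ _ g] := gXY; rewrite -(g _ (mAs 0%N)).
move=> s' gs'; exists s'; under eq_fun do rewrite big_cons addrA.
exact: gs'.
Qed.

(** The norms of the approximations converge to that of [Y], hence so do their standard
   deviations [s']; the variables [B (s' ^ 2) - B 0] with the same laws then
   converge in L2 to [B (s ^ 2) - B 0], and laws pass to L2 limits. *)
Lemma gaussian_L2_closed d' (T' : measurableType d') (Q : probability T' R) (Y : T' -> R) :
  measurable_fun setT Y ->
  (forall e : R, (0 < e)%R -> exists s (Y' : T' -> R), centered_gaussian Q s Y' /\
     (L2norm Q (Y' \- Y)%R <= e%:E)%E) ->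
  exists s, centered_gaussian Q s Y.
Proof.
move=> mY h.
have [s1 [Y1 [gY1 nY1]]] := h 1 ltr01.
have [mY1 s10 _] := gY1.
have fin : (L2norm Q Y <= (s1 + 1)%:E)%E.
  apply: le_trans (L2norm_le_sub Q mY mY1) _.
  by rewrite EFinD (centered_gaussian_norm gY1) leeD2l// L2normBC.
have fn : L2norm Q Y \is a fin_num.
  by rewrite ge0_fin_numE ?L2norm_ge0// (le_lt_trans fin) ?ltry.
pose s := fine (L2norm Q Y).
have sE : L2norm Q Y = s%:E by rewrite fineK.
have s0 : 0 <= s by rewrite -lee_fin -sE L2norm_ge0.
have gX := wiener_law s0; have [mX _ hX] := gX.
exists s; split => // A mA; rewrite -hX//.
apply: (L2_limit_law mY mX) => // e e0.
(* [eta] bounds [|s' ^ 2 - s ^ 2| = |s' - s| * (s' + s)] by [e ^ 2] *)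
pose eta := Num.min e (Num.min 1 (e ^+ 2 / (2 * s + 1))).
have s21 : 0 < 2 * s + 1 by lra.
have eta0 : 0 < eta by rewrite !lt_min e0 ltr01 /= divr_gt0// exprn_gt0.
have [s' [Y' [gY' nY']]] := h eta eta0.
have [mY' s'0 hY'] := gY'.
have gX' := wiener_law s'0; have [mX' _ hX'] := gX'.
exists Y', (fun w => B (s' ^+ 2) w - B 0 w); split => //.
- by apply: le_trans nY' _; rewrite lee_fin ge_min lexx.
- have h1 : s' <= s + eta.
    rewrite -lee_fin EFinD -(centered_gaussian_norm gY') -sE.
    by apply: le_trans (L2norm_le_sub Q mY' mY) _; rewrite leeD2l.
  have h2 : s <= s' + eta.
    rewrite -lee_fin EFinD -(centered_gaussian_norm gY') -sE.
    by apply: le_trans (L2norm_le_sub Q mY mY') _; rewrite leeD2l// L2normBC.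
  have eta1 : eta <= 1 by rewrite !ge_min lexx orbT.
  have etae : eta * (2 * s + 1) <= e ^+ 2.
    by rewrite -ler_pdivlMr// !ge_min lexx !orbT.
  have nn (p q : R) : 0 <= p -> 0 <= q -> `|p - q| <= e ^+ 2 ->
      (L2norm P ((fun w => B p w - B 0 w) \- (fun w => B q w - B 0 w))%R <= e%:E)%E.
    wlog pq : p q / p <= q.
      have [pq|qp] := leP p q; first exact.
      by move=> H p0 q0; rewrite distrC L2normBC; apply: H => //; exact: ltW.
    move=> p0 q0 pqe; rewrite L2normBC.
    have gi := wiener_increment_gaussian p0 pq.
    rewrite (@eq_L2norm _ _ _ _ _ (fun w => B q w - B p w)); last by move=> w /=; ring.
    rewrite (centered_gaussian_norm gi) lee_fin.
    rewrite -(ger0_norm (ltW e0)) -sqrtr_sqr ler_wsqrtr//.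
    by apply: le_trans pqe; rewrite distrC ler_norm.
  apply: nn; rewrite ?sqr_ge0//.
  apply: le_trans etae.
  have -> : s' ^+ 2 - s ^+ 2 = (s' - s) * (s' + s) by ring.
  rewrite normrM; apply: ler_pM => //.
    by rewrite ler_norml; apply/andP; split; lra.
  by rewrite ger0_norm; lra.
- by move=> C mC; rewrite hY'// hX'.
Qed.

End wiener_gaussian.


(** * Wiener integrals of deterministic functions *)

Lemma L2norm_approx_le (R : realType) d1 d2 (T1 : measurableType d1) (T2 : measurableType d2)
  (m1 : {measure set T1 -> \bar R}) (m2 : {measure set T2 -> \bar R}) (f : T1 -> R) (g : T2 -> R) :
  measurable_fun setT f -> measurable_fun setT g ->
  (forall e : R, 0 < e -> exists (f' : T1 -> R) (g' : T2 -> R),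
    [/\ measurable_fun setT f', measurable_fun setT g',
      (L2norm m1 (f' \- f)%R <= e%:E)%E, (L2norm m2 (g' \- g)%R <= e%:E)%E &
      L2norm m1 f' = L2norm m2 g']) -> (L2norm m1 f <= L2norm m2 g)%E.
Proof.
move=> mf mg h; apply/lee_addgt0Pr => e e0.
have e2 : 0 < e / 2 by rewrite divr_gt0.
have [f' [g' [mf' mg' nf ng fg]]] := h _ e2.
apply: (le_trans (L2norm_le_sub m1 mf mf')).
have -> : e%:E = ((e / 2)%:E + (e / 2)%:E)%E by rewrite -EFinD -splitr.
rewrite addeA; apply: leeD; last by rewrite L2normBC.
by rewrite fg; apply: (le_trans (L2norm_le_sub m2 mg' mg)); rewrite leeD2l.
Qed.

Lemma L2norm_approx_eq (R : realType) d1 d2 (T1 : measurableType d1) (T2 : measurableType d2)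
  (m1 : {measure set T1 -> \bar R}) (m2 : {measure set T2 -> \bar R}) (f : T1 -> R) (g : T2 -> R) :
  measurable_fun setT f -> measurable_fun setT g ->
  (forall e : R, 0 < e -> exists (f' : T1 -> R) (g' : T2 -> R),
    [/\ measurable_fun setT f', measurable_fun setT g',
      (L2norm m1 (f' \- f)%R <= e%:E)%E, (L2norm m2 (g' \- g)%R <= e%:E)%E &
      L2norm m1 f' = L2norm m2 g']) -> L2norm m1 f = L2norm m2 g.
Proof.
move=> mf mg h; apply/eqP; rewrite eq_le !L2norm_approx_le// => e /h[f' [g' [? ? ? ? ?]]].
by exists g', f'; split.
Qed.

Lemma L2norm0 d (T : measurableType d) (R : realType) (mu : {measure set T -> \bar R}) :
  L2norm mu (fun=> 0) = 0%E.
Proof.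
by rewrite L2norm_Lnorm (_ : EFin \o _ = cst 0%E)// Lnorm0.
Qed.

Section has_integral.
Context d (T : measurableType d) (R : realType) (mu : {measure set T -> \bar R}).

(** Integrability and value in one statement, closed under linear combinations. *)
Definition has_integral (f : T -> R) (r : R) :=
  mu.-integrable setT (EFin \o f) /\ (\int[mu]_x (f x)%:E = r%:E)%E.

Lemma has_integralD f g r s : has_integral f r -> has_integral g s ->
  has_integral (fun x => f x + g x) (r + s).
Proof.
move=> [fi fr] [gi gs]; split.
  by rewrite (_ : EFin \o _ = (EFin \o f) \+ (EFin \o g))%E//; exact: integrableD.
under eq_integral do rewrite EFinD.
by rewrite integralD// fr gs.
Qed.

Lemma has_integralZ f r c : has_integral f r -> has_integral (fun x => c * f x) (c * r).
Proof.
move=> [fi fr]; split.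
  by rewrite (_ : EFin \o _ = (fun x => c%:E * (f x)%:E)%E)//; exact: integrableZl.
under eq_integral do rewrite EFinM.
by rewrite integralZl// fr.
Qed.

Lemma has_integral_sum (I : eqType) (s : seq I) (f : I -> T -> R) (r : I -> R) :
  (forall i, i \in s -> has_integral (f i) (r i)) ->
  has_integral (fun x => \sum_(i <- s) f i x) (\sum_(i <- s) r i).
Proof.
elim: s => [|i s IH] h.
  split.
    rewrite (_ : EFin \o _ = cst 0%E); first exact: integrable0.
    by apply/funext => x /=; rewrite big_nil.
  by under eq_integral do rewrite big_nil; rewrite big_nil integral0.
under eq_fun do rewrite big_cons; rewrite big_cons.
apply: has_integralD; first by apply: h; rewrite mem_head.
by apply: IH => j js; apply: h; rewrite in_cons js orbT.
Qed.

Lemma ge0_has_integral (f : T -> R) r : measurable_fun setT f -> (forall x, 0 <= f x) ->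
  (\int[mu]_x (f x)%:E = r%:E)%E -> has_integral f r.
Proof.
move=> mf f0 fr; split => //; apply/integrableP; split; first exact/measurable_EFinP.
by under eq_integral do rewrite /= ger0_norm//; rewrite fr ltry.
Qed.

(** The squared norm of a combination of increments of a curve in L2 whose increments
   over [[s, t]] have squared norm [|t - s|], computed by polarization. That it does
   not depend on the curve is the isometry property: it will be applied to [B]
   in L2 of the probability, and to [t |-> 1_(]0, t])] in L2 of the line. *)
Definition increment_gram (s : seq (R * (R * R))) : R :=
  \sum_(p <- s) \sum_(q <- s) (p.1 * q.1 / 2) *
   ((`|p.2.2 - q.2.1| + `|p.2.1 - q.2.2|) + -1 * (`|p.2.2 - q.2.2| + `|p.2.1 - q.2.1|)).

Lemma increment_isometry (X : R -> T -> R) (s : seq (R * (R * R))) :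
  (forall t, measurable_fun setT (X t)) ->
  (forall u v, 0 <= u -> 0 <= v ->
     (\int[mu]_x ((X u x - X v x) ^+ 2)%:E = (`|u - v|)%:E)%E) ->
  (forall p, p \in s -> 0 <= p.2.1 <= p.2.2) ->
  (\int[mu]_x ((\sum_(p <- s) p.1 * (X p.2.2 x - X p.2.1 x)) ^+ 2)%:E =
   (increment_gram s)%:E)%E.
Proof.
move=> mX nX sP.
have hX u v : 0 <= u -> 0 <= v -> has_integral (fun x => (X u x - X v x) ^+ 2) (`|u - v|).
  move=> u0 v0; apply: ge0_has_integral; last exact: nX.
    by apply: measurable_funX; exact: measurable_funB.
  by move=> x; exact: sqr_ge0.
have [_ <-] : has_integral (fun x => \sum_(p <- s) \sum_(q <- s) (p.1 * q.1 / 2) *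
   (((X p.2.2 x - X q.2.1 x) ^+ 2 + (X p.2.1 x - X q.2.2 x) ^+ 2) + -1 *
     ((X p.2.2 x - X q.2.2 x) ^+ 2 + (X p.2.1 x - X q.2.1 x) ^+ 2))) (increment_gram s).
  apply: has_integral_sum => p /sP/andP[p0 p1]; apply: has_integral_sum => q /sP/andP[q0 q1].
  have p2 := le_trans p0 p1; have q2 := le_trans q0 q1.
  apply: has_integralZ; apply: has_integralD; [|apply: has_integralZ]; apply: has_integralD; exact: hX.
apply: eq_integral => x _; congr EFin.
rewrite expr2 big_distrlr /=; apply: eq_bigr => p _; apply: eq_bigr => q _.
by field.
Qed.

End has_integral.

Section wiener_space.
Context (R : realType) d (T : measurableType d) (P : probability T R).
Variable B : R -> {RV P >-> R}.
Hypothesis hB : standard_wiener B.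
Local Notation mu := (@lebesgue_measure R).
Local Notation steps := (seq (R * (R * R))).

Definition ordered_steps (s : steps) := forall p, p \in s -> 0 <= p.2.1 <= p.2.2.

Lemma measurable_step_fun (s : steps) : measurable_fun setT (step_fun s).
Proof.
rewrite /step_fun; apply: measurable_sum => p.
by apply: measurable_funM => //; apply: measurable_indic; exact: measurable_itv.
Qed.

Lemma measurable_step_integral (s : steps) : measurable_fun setT (step_integral B s).
Proof.
rewrite /step_integral; apply: measurable_sum => p.
by apply: measurable_funM => //; exact: measurable_funB.
Qed.

Lemma wiener_increment_sqr u v : 0 <= u -> 0 <= v ->
  (\int[P]_w ((B u w - B v w) ^+ 2)%:E = (`|u - v|)%:E)%E.
Proof.
wlog vu : u v / v <= u.
  have [vu|uv] := leP v u; first exact.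
  move=> h u0 v0; rewrite distrC -h ?(ltW uv)//; apply: eq_integral => w _.
  by rewrite -sqrrN opprB.
move=> u0 v0; have g := wiener_increment_gaussian hB v0 vu.
have [_ s0 _] := g.
have /L2norm_eqP -> := centered_gaussian_norm g; last exact: s0.
by rewrite sqr_sqrtr ?subr_ge0// ger0_norm ?subr_ge0.
Qed.

Lemma indic_increment (u v x : R) : 0 <= u -> u <= v ->
  \1_(`]u, v]%classic) x = \1_(`]0, v]%classic) x - \1_(`]0, u]%classic) x :> R.
Proof.
move=> u0 uv; rewrite !indicE !mem_setE !in_itv /=.
have [xu|ux] := leP x u.
  by rewrite (le_trans xu uv) !andbT subrr.
by rewrite (le_lt_trans u0 ux) /= subr0.
Qed.

Lemma indicator_increment_sqr (u v : R) : 0 <= u -> 0 <= v ->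
  (\int[mu]_x ((\1_(`]0, u]%classic) x - \1_(`]0, v]%classic) x) ^+ 2)%:E = (`|u - v|)%:E)%E.
Proof.
wlog vu : u v / v <= u.
  have [vu|uv] := leP v u; first exact.
  move=> h u0 v0; rewrite distrC -h ?(ltW uv)//; apply: eq_integral => w _.
  by rewrite -sqrrN opprB.
move=> u0 v0.
under eq_integral do rewrite -indic_increment//.
transitivity (\int[mu]_x (\1_(`]v, u]%classic) x)%:E)%E.
  apply: eq_integral => x _; rewrite indicE; case: (_ \in _); by rewrite ?expr1n ?expr0n.
rewrite integral_indic//= setIT lebesgue_measure_itv/= lte_fin.
rewrite ger0_norm ?subr_ge0//.
have [//|uv] := ltP v u; by rewrite (le_anti (introT andP (conj vu uv))) subrr.
Qed.

(** Both norms are given by [increment_gram]. *)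
Lemma step_isometry (s : steps) : ordered_steps s ->
  L2norm mu (step_fun s) = L2norm P (step_integral B s).
Proof.
move=> sP; congr sqrte.
rewrite (@increment_isometry _ _ _ P (fun t => B t)) //; last first.
  by move=> u v u0 v0; exact: wiener_increment_sqr.
rewrite -(@increment_isometry _ _ _ mu (fun t => \1_(`]0, t]%classic))) //; last first.
  by move=> u v u0 v0; exact: indicator_increment_sqr.
apply: eq_integral => x _; congr (_ ^+ 2)%:E.
rewrite /step_fun big_seq [RHS]big_seq; apply: eq_bigr => p /sP/andP[p0 p1].
by rewrite indic_increment.
Qed.

(** Sort all end points; an increment over an interval telescopes over the grid.
   The increments of [B] over the grid are independent, unlike those over
   overlapping intervals. Past the last point the grid is constant, and 0 is
   put in so that it is not empty. *)
Lemma common_grid (s : steps) : ordered_steps s ->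
  exists (n : nat) (t : nat -> R) (c : nat -> R),
  [/\ 0 <= t 0%N, forall i, t i <= t i.+1 &
   forall g : R -> R, \sum_(p <- s) p.1 * (g p.2.2 - g p.2.1) =
     \sum_(0 <= k < n.+1) c k * (g (t k.+1) - g (t k))].
Proof.
move=> sP.
pose G := sort <=%R (0 :: flatten [seq [:: p.2.1; p.2.2] | p <- s]).
have G0 x : x \in G -> 0 <= x.
  rewrite mem_sort in_cons => /predU1P[->//|/flatten_mapP[p /sP /andP[p0 p1]]].
  by rewrite !inE => /orP[] /eqP -> //; exact: le_trans p1.
have sG : sorted <=%R G by apply: sort_sorted; exact: le_total.
have GN : (0 < size G)%N by rewrite size_sort.
pose x0 := last 0 G.
pose t k := nth x0 G k.
have tG k : t k \in G.
  rewrite /t; have [kG|kG] := ltnP k (size G); first exact: mem_nth.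
  rewrite nth_default// /x0; case: (G) GN => //= y l _; exact: mem_last.
have tm i : t i <= t i.+1.
  have [iG|iG] := ltnP i.+1 (size G).
    by apply: (sorted_leq_nth le_trans le_refl) => //; rewrite inE// ltnW.
  have -> : t i.+1 = x0 by rewrite /t nth_default.
  rewrite /t; have [iG'|iG'] := ltnP i (size G); last by rewrite nth_default.
  rewrite [leRHS](_ : x0 = nth x0 G (size G).-1); last first.
    by rewrite (set_nth_default 0) ?prednK// nth_last.
  apply: (sorted_leq_nth le_trans le_refl) => //; rewrite ?inE ?prednK//.
  by rewrite -ltnS prednK.
exists (size G), t, (fun k => \sum_(p <- s) p.1 * ((k < index p.2.2 G)%N%:R - (k < index p.2.1 G)%N%:R)).
split => //; first exact: G0.
move=> g.
have tele y : y \in G -> g y = g (t 0%N) + \sum_(0 <= k < (size G).+1) (k < index y G)%N%:R * (g (t k.+1) - g (t k)).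
  move=> yG; have iG : (index y G < size G)%N by rewrite index_mem.
  rewrite (@big_cat_nat _ _ _ (index y G))//=; last exact: leq_trans (ltnW iG) _.
  rewrite [X in _ + (_ + X)]big_nat_cond [X in _ + (_ + X)]big1 ?addr0; last first.
    by move=> k /andP[/andP[k1 _] _]; rewrite ltnNge k1 mul0r.
  rewrite big_nat_cond (eq_bigr (fun k => g (t k.+1) - g (t k))); last first.
    by move=> k /andP[/andP[_ ->] _]; rewrite mul1r.
  rewrite -big_nat_cond telescope_sumr// addrC subrK.
  by rewrite /t nth_index.
under [RHS]eq_bigr do rewrite big_distrl /=.
rewrite exchange_big /= big_seq [RHS]big_seq; apply: eq_bigr => p ps.
have p1G : p.2.1 \in G.
  by rewrite mem_sort in_cons; apply/orP; right; apply/flatten_mapP; exists p; rewrite // !inE eqxx.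
have p2G : p.2.2 \in G.
  by rewrite mem_sort in_cons; apply/orP; right; apply/flatten_mapP; exists p; rewrite // !inE eqxx orbT.
rewrite (tele _ p1G) (tele _ p2G) opprD addrACA subrr add0r -sumrB big_distrr /=.
by apply: eq_bigr => k _; ring.
Qed.

Lemma joint_eventE d' (T' : measurableType d') (f : nat -> T' -> R) (As : nat -> set R) k n :
  joint_event [seq f i | i <- iota k n] As =
  \bigcap_(i in [set: 'I_n]) (f (k + i)%N @^-1` As i).
Proof.
elim: n k As => [|n IH] k As /=.
  by apply/seteqP; split => // w _ [].
rewrite IH; apply/seteqP; split => w /=.
  move=> [h0 h] i _; case: i => [[|i] iH] /=; first by rewrite addn0.
  have := h (Ordinal (iH : (i < n)%N)) I; by rewrite /= addSnnS.
move=> h; split; first by have := h ord0 I; rewrite /= addn0.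
move=> i _; have := h (lift ord0 i) I; by rewrite /= /bump /= add1n addSnnS.
Qed.

Lemma joint_probE d' (T' : measurableType d') (Q : probability T' R) (f : nat -> T' -> R) (As : nat -> set R) k n :
  joint_prob Q [seq f i | i <- iota k n] As =
  (\prod_(i < n) Q (f (k + i)%N @^-1` As i))%E.
Proof.
elim: n k As => [|n IH] k As /=; first by rewrite big_ord0.
rewrite IH big_ord_recl /= addn0; congr (_ * _)%E.
by apply: eq_bigr => i _; rewrite /bump /= add1n addSnnS.
Qed.

Lemma grid_gaussian (n : nat) (t : nat -> R) (c : nat -> R) :
  0 <= t 0%N -> (forall i, t i <= t i.+1) ->
  exists s, centered_gaussian P s (fun w => \sum_(0 <= k < n.+1) c k * (B (t k.+1) w - B (t k) w)).
Proof.
move=> t0 tm.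
have tge i : 0 <= t i by elim: i => // i /le_trans; apply.
pose f k w := c k * (B (t k.+1) w - B (t k) w).
have gf k : exists s, centered_gaussian P s (f k).
  by eexists; apply: centered_gaussianZ; exact: wiener_increment_gaussian.
have gl k m : all_gaussian P [seq f i | i <- iota k m].
  by elim: m k => //= m IH k; split.
have il : independent_seq P [seq f i | i <- iota 0 n.+1].
  move=> As mAs; rewrite joint_eventE joint_probE.
  have [_ _ hind _] := hB.
  have mc k : measurable_fun setT ( *%R (c k) : R -> R) by exact: mulrl_measurable.
  have := hind n.+1 t t0 tm (fun i => *%R (c i) @^-1` As i); apply.
  by move=> i; rewrite -[X in measurable X]setTI; exact: mc.
have [s0 gs0] := gf 0%N.
have [s gs] := independent_gaussian_list_sum hB gs0 (gl 1%N n) il.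
exists s; rewrite (_ : (fun w => _) = (fun w => f 0%N w + \sum_(Y <- [seq f i | i <- iota 1 n]) Y w))//.
apply/funext => w; rewrite big_map /index_iota subn0 /= big_cons.
by congr (_ + _).
Qed.

Lemma step_integral_gaussian (s : steps) : ordered_steps s ->
  exists r, centered_gaussian P r (step_integral B s).
Proof.
move=> /common_grid[n [t [c [t0 tm h]]]].
have [r gr] := @grid_gaussian n t c t0 tm; exists r.
rewrite (_ : step_integral B s = fun w => \sum_(0 <= k < n.+1) c k * (B (t k.+1) w - B (t k) w))//.
by apply/funext => w; rewrite /step_integral (h (fun u => B u w)).
Qed.

(** [Y] is the integral of [f] against [B] over the half-line. As a relation between
   functions and random variables it is closed under linear combinations and L2
   limits. *)
Definition wiener_rv (f : R -> R) (Y : T -> R) :=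
  [/\ measurable_fun setT f, measurable_fun setT Y &
    forall e : R, 0 < e -> exists s : steps, [/\ ordered_steps s,
      (L2norm mu (step_fun s \- f)%R <= e%:E)%E &
      (L2norm P (step_integral B s \- Y)%R <= e%:E)%E]].

Lemma wiener_rv_norm f Y : wiener_rv f Y -> L2norm mu f = L2norm P Y.
Proof.
move=> [mf mY h]; apply: L2norm_approx_eq => // e /h[s [sP nf nY]].
exists (step_fun s), (step_integral B s); split => //.
- exact: measurable_step_fun.
- exact: measurable_step_integral.
- exact: step_isometry.
Qed.

Lemma wiener_rv_gaussian f Y : wiener_rv f Y -> exists s, centered_gaussian P s Y.
Proof.
move=> [mf mY h]; apply: (gaussian_L2_closed hB) => // e /h[s [sP _ nY]].
by have [r gr] := step_integral_gaussian sP; exists r, (step_integral B s).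
Qed.

Lemma wiener_rv0 : wiener_rv (fun=> 0) (fun=> 0).
Proof.
split => // e e0; exists [::]; split => //.
- rewrite (_ : (_ \- _) = (fun=> 0)); last first.
    by apply/funext => x; rewrite /= /step_fun big_nil subr0.
  by rewrite L2norm0 lee_fin ltW.
- rewrite (_ : (_ \- _) = (fun=> 0)); last first.
    by apply/funext => x; rewrite /= /step_integral big_nil subr0.
  by rewrite L2norm0 lee_fin ltW.
Qed.

Lemma wiener_rvD f g X Y : wiener_rv f X -> wiener_rv g Y ->
  wiener_rv (fun x => f x + g x) (fun w => X w + Y w).
Proof.
move=> [mf mX hf] [mg mY hg]; split; [exact: measurable_funD|exact: measurable_funD|move=> e e0].
have e2 : 0 < e / 2 by rewrite divr_gt0.
have [s [sP sf sX]] := hf _ e2; have [r [rP rg rY]] := hg _ e2.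
have ee : e%:E = ((e / 2)%:E + (e / 2)%:E)%E by rewrite -EFinD -splitr.
have ms := measurable_step_fun; have mi := measurable_step_integral.
exists (s ++ r); split.
- by move=> p; rewrite mem_cat => /orP[/sP|/rP].
- rewrite (_ : _ \- _ = ((step_fun s \- f) \+ (step_fun r \- g)))%R; last first.
    by apply/funext => x /=; rewrite /step_fun big_cat /=; ring.
  apply: le_trans (L2normD mu (measurable_funB (ms s) mf) (measurable_funB (ms r) mg)) _.
  by rewrite ee; exact: leeD.
- rewrite (_ : _ \- _ = ((step_integral B s \- X) \+ (step_integral B r \- Y)))%R; last first.
    by apply/funext => x /=; rewrite /step_integral big_cat /=; ring.
  apply: le_trans (L2normD P (measurable_funB (mi s) mX) (measurable_funB (mi r) mY)) _.
  by rewrite ee; exact: leeD.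
Qed.

Lemma wiener_rvZ f X c : wiener_rv f X ->
  wiener_rv (fun x => c * f x) (fun w => c * X w).
Proof.
move=> [mf mX hf]; split; [exact: measurable_funM|exact: measurable_funM|move=> e e0].
have c1 : 0 < `|c| + 1 by rewrite ltr_wpDl.
have ec : 0 < e / (`|c| + 1) by rewrite divr_gt0.
have [s [sP sf sX]] := hf _ ec.
have ms := measurable_step_fun; have mi := measurable_step_integral.
have cb (x : \bar R) : (0 <= x)%E -> (x <= (e / (`|c| + 1))%:E)%E -> (`|c|%:E * x <= e%:E)%E.
  move=> x0 h; apply: (@le_trans _ _ (`|c|%:E * (e / (`|c| + 1))%:E)%E).
    by rewrite lee_wpmul2l ?lee_fin.
  rewrite -EFinM lee_fin mulrCA ger_pMr// ler_pdivrMr// mul1r; lra.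
exists [seq (c * p.1, p.2) | p <- s]; split.
- by move=> _ /mapP[p /sP ps ->].
- rewrite (_ : _ \- _ = (fun x => c * (step_fun s \- f) x))%R; last first.
    apply/funext => x /=; rewrite /step_fun big_map mulrBr big_distrr /=; congr (_ - _).
    by apply: eq_bigr => p _; rewrite mulrA.
  rewrite (L2normZ mu c (measurable_funB (ms s) mf)).
  by apply: cb => //; exact: L2norm_ge0.
- rewrite (_ : _ \- _ = (fun x => c * (step_integral B s \- X) x))%R; last first.
    apply/funext => x /=; rewrite /step_integral big_map mulrBr big_distrr /=; congr (_ - _).
    by apply: eq_bigr => p _; rewrite mulrA.
  rewrite (L2normZ P c (measurable_funB (mi s) mX)).
  by apply: cb => //; exact: L2norm_ge0.
Qed.

Lemma wiener_rvB f g X Y : wiener_rv f X -> wiener_rv g Y ->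
  wiener_rv (fun x => f x - g x) (fun w => X w - Y w).
Proof.
move=> hf hg; have := wiener_rvD hf (wiener_rvZ (-1) hg).
by under eq_fun do rewrite mulN1r; under [X in wiener_rv _ X]eq_fun do rewrite mulN1r.
Qed.

Lemma wiener_rv_sum n (f : nat -> R -> R) (X : nat -> T -> R) (c : nat -> R) :
  (forall k, (k < n)%N -> wiener_rv (f k) (X k)) ->
  wiener_rv (fun x => \sum_(k < n) c k * f k x) (fun w => \sum_(k < n) c k * X k w).
Proof.
elim: n => [|n IH] h.
  rewrite (_ : (fun x => \sum_(k < 0) c k * f k x) = fun=> 0); last first.
    by apply/funext => x; rewrite big_ord0.
  rewrite (_ : (fun w => \sum_(k < 0) c k * X k w) = fun=> 0); last first.
    by apply/funext => x; rewrite big_ord0.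
  exact: wiener_rv0.
under eq_fun do rewrite big_ord_recr /=; under [X in wiener_rv _ X]eq_fun do rewrite big_ord_recr /=.
apply: wiener_rvD; first by apply: IH => k kn; apply: h; rewrite ltnW.
by apply: wiener_rvZ; exact: h.
Qed.

Lemma wiener_rv_closed f Y : measurable_fun setT f -> measurable_fun setT Y ->
  (forall e : R, 0 < e -> exists g X, [/\ wiener_rv g X,
     (L2norm mu (g \- f)%R <= e%:E)%E & (L2norm P (X \- Y)%R <= e%:E)%E]) ->
  wiener_rv f Y.
Proof.
move=> mf mY h; split => // e e0.
have e2 : 0 < e / 2 by rewrite divr_gt0.
have [g [X [[mg mX hg] gf XY]]] := h _ e2.
have [s [sP sg sX]] := hg _ e2.
have ee : e%:E = ((e / 2)%:E + (e / 2)%:E)%E by rewrite -EFinD -splitr.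
have ms := measurable_step_fun; have mi := measurable_step_integral.
exists s; split => //; rewrite ee.
- by apply: le_trans (L2norm_le_mid mu (ms s) mg mf) _; exact: leeD.
- by apply: le_trans (L2norm_le_mid P (mi s) mX mY) _; exact: leeD.
Qed.

(** If the integrands converge in L2 and the Wiener integrals almost surely,
   the two limits correspond: by the isometry the integrals are Cauchy in L2,
   and Fatou's lemma identifies their L2 limit. *)
Lemma wiener_rv_ae_closed (f : nat -> R -> R) (Y : nat -> T -> R) (g : R -> R) (X : T -> R) :
  (forall n, wiener_rv (f n) (Y n)) ->
  measurable_fun setT g -> measurable_fun setT X ->
  (forall e : R, 0 < e -> \forall n \near \oo, (L2norm mu (f n \- g)%R <= e%:E)%E) ->
  {ae P, forall w, Y n w @[n --> \oo] --> X w} ->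
  wiener_rv g X.
Proof.
move=> hfY mg mX fg YX; apply: wiener_rv_closed => // e e0.
have e2 : 0 < e / 2 by rewrite divr_gt0.
have ee : e%:E = ((e / 2)%:E + (e / 2)%:E)%E by rewrite -EFinD -splitr.
have [N _ hN] := fg _ e2.
have mf n : measurable_fun setT (f n) by have [] := hfY n.
have mY n : measurable_fun setT (Y n) by have [] := hfY n.
exists (f N), (Y N); split => //.
  by apply: le_trans (hN N (leqnn _)) _; rewrite lee_fin; lra.
apply: (@L2norm_fatou _ _ _ P (fun m => Y N \- Y m)).
- exact: ltW.
- by move=> m; exact: measurable_funB.
- exact: measurable_funB.
- by apply: filterS YX => w hw; apply: cvgB => //; exact: cvg_cst.
- exists N => // m Nm /=.
  rewrite -(wiener_rv_norm (wiener_rvB (hfY N) (hfY m))).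
  apply: le_trans (L2norm_le_mid mu (mf N) mg (mf m)) _.
  by rewrite ee; apply: leeD; [exact: (hN N (leqnn N))|rewrite L2normBC; exact: (hN m Nm)].
Qed.

(** Restricting the integrand to [[0, t]] turns the integral up to time [t] into an
   integral over the half-line: the step functions live on [[0, t]] already. *)
Lemma wiener_rv_of_integral (f : R -> R) (t : R) (X : {RV P >-> R}) :
  measurable_fun setT (fun x => f x * \1_(`[0, t]%classic) x) ->
  wiener_integral B f t X -> wiener_rv (fun x => f x * \1_(`[0, t]%classic) x) X.
Proof.
move=> mf [s [sP sf sX]]; split => // e e0.
have sub n : step_fun (s n) \- (fun x => f x * \1_(`[0, t]%classic) x) =
    (fun x => (step_fun (s n) x - f x) * \1_(`[0, t]%classic) x).
  apply/funext => x /=; rewrite mulrBl; congr (_ - _).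
  rewrite /step_fun big_distrl /= big_seq [RHS]big_seq; apply: eq_bigr => p /sP [/andP[p0 p1] pt].
  rewrite -mulrA; congr (_ * _); rewrite !indicE !mem_setE !in_itv /=.
  have [px|] := ltP p.2.1 x; last by rewrite /= mul0r.
  have [xp|] := leP x p.2.2; last by rewrite /= mul0r.
  by rewrite (le_trans xp pt) (ltW (le_lt_trans p0 px)) mulr1.
have subi n : (\int[mu]_x (((step_fun (s n) x - f x) * \1_(`[0, t]%classic) x) ^+ 2)%:E =
    \int[mu]_(x in `[0%R, t]) ((step_fun (s n) x - f x) ^+ 2)%:E)%E.
  rewrite [RHS]integral_mkcond /=; apply: eq_integral => x _.
  rewrite patchE indicE; case: ifPn => xt; first by rewrite mulr1.
  by rewrite mulr0 expr0n.
have lim (u : nat -> \bar R) : (forall n, 0 <= u n)%E -> u n @[n --> \oo] --> 0%E ->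
    \forall n \near \oo, (u n <= (e ^+ 2)%:E)%E.
  move=> u0 ucv.
  move/fine_cvgP : ucv => [fu /cvgr0_norm_le /(_ _ (exprn_gt0 2 e0))].
  apply: filterS2 fu => n fn /=; rewrite ger0_norm ?fine_ge0// => h.
  by rewrite -(fineK fn) lee_fin.
have i0 n : (0 <= \int[mu]_(x in `[0%R, t]) ((step_fun (s n) x - f x) ^+ 2)%:E)%E.
  by apply: integral_ge0 => x _; rewrite lee_fin sqr_ge0.
have [N1 _ h1] := lim _ i0 sf.
have e0' n : (0 <= 'E_P[(fun w => ((step_integral B (s n) w - X w) ^+ 2)%R)])%E.
  by apply: expectation_ge0 => w; exact: sqr_ge0.
have [N2 _ h2] := lim _ e0' sX.
exists (s (maxn N1 N2)); split.
- by move=> p /sP [].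
- rewrite sub L2norm_leP ?(ltW e0)// subi; apply: h1 => /=; exact: leq_maxl.
- rewrite L2norm_leP ?(ltW e0)//.
  have := h2 (maxn N1 N2) (leq_maxr _ _); rewrite unlock; exact.
Qed.

End wiener_space.


(** * Continuous functions on a segment *)

Section segment.
Variables (R : realType) (a b : R).
Implicit Types f g : R -> R.
Local Notation mu := (@lebesgue_measure R).

Lemma within_continuousP f : {within `[a, b], continuous f} <->
  forall x, a <= x <= b -> f @ within `[a, b] (nbhs x) --> f x.
Proof.
split; first by move=> /subspace_continuousP h x ab; apply: h; rewrite /= in_itv.
by move=> h; apply/subspace_continuousP => x /=; rewrite in_itv/=; exact: h.
Qed.

Lemma within_continuousD f g : {within `[a, b], continuous f} ->
  {within `[a, b], continuous g} -> {within `[a, b], continuous (fun x => f x + g x)}.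
Proof.
move=> /within_continuousP cf /within_continuousP cg; apply/within_continuousP => x xab.
by apply: cvgD; [exact: cf|exact: cg].
Qed.

Lemma within_continuousM f g : {within `[a, b], continuous f} ->
  {within `[a, b], continuous g} -> {within `[a, b], continuous (fun x => f x * g x)}.
Proof.
move=> /within_continuousP cf /within_continuousP cg; apply/within_continuousP => x xab.
by apply: cvgM; [exact: cf|exact: cg].
Qed.

Lemma within_continuousZ c f : {within `[a, b], continuous f} ->
  {within `[a, b], continuous (fun x => c * f x)}.
Proof. by move=> cf; apply: within_continuousM => //; apply: continuous_subspaceT => x; exact: cvg_cst. Qed.

Lemma within_continuousB f g : {within `[a, b], continuous f} ->
  {within `[a, b], continuous g} -> {within `[a, b], continuous (fun x => f x - g x)}.
Proof.
move=> /within_continuousP cf /within_continuousP cg; apply/within_continuousP => x xab.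
by apply: cvgB; [exact: cf|exact: cg].
Qed.

Lemma within_continuousV f : (forall x, a <= x <= b -> f x != 0) ->
  {within `[a, b], continuous f} -> {within `[a, b], continuous (fun x => (f x)^-1)}.
Proof.
move=> f0 /within_continuousP cf; apply/within_continuousP => x xab.
by apply: cvgV; [exact: f0|exact: cf].
Qed.

Lemma within_continuous_sub f u v : a <= u -> v <= b ->
  {within `[a, b], continuous f} -> {within `[u, v], continuous f}.
Proof.
move=> au vb; apply: continuous_subspaceW => x /=; rewrite !in_itv/= => /andP[ux xv].
by rewrite (le_trans au ux) (le_trans xv vb).
Qed.

(** By compactness of the segment. *)
Lemma segment_uniform_continuous f (e : R) : {within `[a, b], continuous f} -> 0 < e ->
  exists2 d : R, 0 < d & forall x y, a <= x <= b -> a <= y <= b -> `|x - y| < d -> `|f x - f y| < e.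
Proof.
move=> /within_continuousP cf e0.
have /compact_near_coveringP := @segment_compact R a b.
move=> /(_ R (0^'+) (fun d x => a <= x <= b -> forall y, a <= y <= b -> `|x - y| < d -> `|f x - f y| < e)).
move=> /(_ _); case=> [|d /= d0 h].
- move=> x /=; rewrite in_itv/= => xab.
  have e2 : 0 < e / 2 by rewrite divr_gt0.
  have := cf x xab => /cvgrPdist_lt /(_ _ e2).
  rewrite near_withinE => -[r /= r0 hr].
  have r2 : 0 < r / 2 by rewrite divr_gt0.
  exists (ball x (r / 2), [set d | 0 < d < r / 2]).
    split => /=; first exact: nbhsx_ballx.
    by apply: filterS2 (nbhs_right_gt 0) (nbhs_right_lt r2) => d d0 dr /=; rewrite d0.
  move=> [y d] [/= xy /andP[d0 dr] yab z zab yz].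
  have hy : `|f x - f y| < e / 2.
    by apply: hr => //=; apply: lt_trans xy _; lra.
  have hz : `|f x - f z| < e / 2.
    apply: hr => //=.
    have : `|x - z| <= `|x - y| + `|y - z| by rewrite -[in X in X <= _](subrK y x) -addrA ler_normD.
    by move: xy; rewrite /ball/=; lra.
  have : `|f y - f z| <= `|f y - f x| + `|f x - f z|.
    by rewrite -[in X in X <= _](subrK (f x) (f y)) -addrA ler_normD.
  by rewrite (distrC (f y) (f x)); lra.
exists (d / 2); first by rewrite divr_gt0.
move=> x y xab yab xy.
have d2 : 0 < d / 2 by rewrite divr_gt0.
apply: (h (d / 2)) => //=.
by rewrite sub0r normrN gtr0_norm; lra.
Qed.

Lemma segment_bounded f : a <= b -> {within `[a, b], continuous f} ->
  exists2 C : R, 1 <= C & forall x, a <= x <= b -> `|f x| <= C.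
Proof.
move=> ab cf.
have cnf : {within `[a, b], continuous (fun x => `|f x|)}.
  move/within_continuousP in cf; apply/within_continuousP => x xab.
  by apply: cvg_norm; exact: cf.
have [c _ hc] := EVT_max ab cnf.
exists (1 + `|f c|); first by rewrite lerDl.
move=> x xab; have := hc x; rewrite in_itv/= => /(_ xab) h.
by rewrite (le_trans h)// lerDr.
Qed.

Lemma segment_measurable f u v : a <= u -> v <= b -> {within `[a, b], continuous f} ->
  measurable_fun setT (fun x => f x * \1_(`[u, v]%classic) x).
Proof.
move=> au vb cf; have := within_continuous_sub au vb cf.
move=> /(subspace_continuous_measurable_fun (measurable_itv `[u, v])) mf.
rewrite (_ : (fun x => _) = f \_ `[u, v]%classic).
  by apply/(measurable_restrictT _ (measurable_itv _)).
apply/funext => x; rewrite patchE indicE.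
by case: ifPn => _; rewrite ?mulr1 ?mulr0.
Qed.

Lemma segment_FTC1 f : a < b -> {within `[a, b], continuous f} ->
  {within `[a, b], continuous (fun x => \int[mu]_(y in `[a, x]) f y)} /\
  (forall x, a < x < b -> is_derive x 1 (fun x => \int[mu]_(y in `[a, x]) f y) (f x)).
Proof.
move=> ab cf.
have intf : mu.-integrable `[a, b] (EFin \o f).
  by apply: continuous_compact_integrable => //; exact: segment_compact.
split.
  exact: (parameterized_integral_continuous (ltW ab) intf).
move=> x /andP[ax xb].
have cfx : {for x, continuous f}.
  by apply: (within_continuous_continuous ab cf); rewrite in_itv/= ax.
have [dF F'] := @continuous_FTC1_closed R f a x b xb intf ax cfx.
apply: DeriveDef; first exact: dF.
rewrite -derive1E; exact: F'.
Qed.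

End segment.

(** * Variation of constants along a path *)

(** Here [I] is a path of the stochastic integral of [sigma], and the path [z] solves
   the integral equation driven by [I]. The integral of
   [1 / phi] against [I] is taken as a limit of Riemann sums. *)
Section pathwise_integral.
Variables (R : realType) (t : R) (phi dphi psi z I : R -> R) (xi : R).
Local Notation mu := (@lebesgue_measure R).
Hypothesis t0 : 0 < t.
Hypothesis cphi : {within `[0, t], continuous phi}.
Hypothesis cdphi : {within `[0, t], continuous dphi}.
Hypothesis cpsi : {within `[0, t], continuous psi}.
Hypothesis cz : {within `[0, t], continuous z}.
Hypothesis phi_gt0 : forall x, 0 <= x <= t -> 0 < phi x.
Hypothesis phi0 : phi 0 = 1.
Hypothesis z0 : z 0 = xi.
Hypothesis phiD : forall x, 0 < x < t -> is_derive x 1 phi (dphi x).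
Hypothesis zE : forall x, 0 <= x <= t ->
  z x = xi + \int[mu]_(u in `[0, x]) (dphi u / phi u * z u + psi u) + I x.

Definition grid (n k : nat) : R := t * k%:R / n.+1%:R.

Lemma grid_itv n k : (k <= n.+1)%N -> 0 <= grid n k <= t.
Proof.
move=> kn; rewrite /grid; apply/andP; split.
  by rewrite mulr_ge0 ?invr_ge0// mulr_ge0// ltW.
by rewrite ler_pdivrMr// ler_wpM2l ?ler_nat// ltW.
Qed.

Lemma gridS n k : grid n k.+1 - grid n k = t / n.+1%:R.
Proof. by rewrite /grid -mulrBl -mulrBr -natrB// subSnn mulr1. Qed.

Lemma grid0 n : grid n 0 = 0.
Proof. by rewrite /grid mulr0 mul0r. Qed.

Lemma grid_last n : grid n n.+1 = t.
Proof. by rewrite /grid mulfK. Qed.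

Lemma grid_mesh (d : R) : 0 < d -> \forall n \near \oo, t / n.+1%:R < d.
Proof.
move=> d0; near=> n.
rewrite ltr_pdivrMr// -ltr_pdivrMl//.
have -> : d^-1 * t = t / d by rewrite mulrC.
apply: (lt_le_trans (truncnS_gt _)); rewrite ler_nat ltnS.
by near: n; exists (Num.truncn (t / d)).
Unshelve. all: by end_near. Qed.

(** Let [N = z / phi - q], where [q] is the integral of [psi / phi]. Formally
   [d N = d I / phi]. On a mesh interval [[u, v]] the error
   [N v - N u - (I v - I u) / phi u] is an increment of the differentiable
   function [H] below, which no longer contains [I]; its derivative is small by
   uniform continuity, so the errors add up to a small quantity. *)
Lemma integrating_factor_sum_cvg :
  \sum_(k < n.+1) (phi (grid n k))^-1 * (I (grid n k.+1) - I (grid n k)) @[n --> \oo]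
    --> z t / phi t - xi - \int[mu]_(u in `[0, t]) (psi u / phi u).
Proof.
pose p x := (phi x)^-1.
have phiN0 x : 0 <= x <= t -> phi x != 0 by move=> /phi_gt0 h; rewrite gt_eqF.
have cp : {within `[0, t], continuous p} by exact: within_continuousV.
pose m x := dphi x * p x * z x + psi x.
have cm : {within `[0, t], continuous m}.
  by apply: within_continuousD => //; apply: within_continuousM => //; exact: within_continuousM.
pose r x := psi x * p x.
have cr : {within `[0, t], continuous r} by exact: within_continuousM.
pose A x := \int[mu]_(u in `[0, x]) m u; pose q x := \int[mu]_(u in `[0, x]) r u.
have [cA dA] := segment_FTC1 t0 cm; have [cq dq] := segment_FTC1 t0 cr.
have [C1 C11 hC1] := segment_bounded (ltW t0) cdphi.
have [C2 C21 hC2] := segment_bounded (ltW t0) cp.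
have [C3 C31 hC3] := segment_bounded (ltW t0) cz.
have [C4 C41 hC4] := segment_bounded (ltW t0) cpsi.
pose C := C1 * C2 * C3 + C1 * C2 * C2 + C4.
have [c1 c2 c3] : [/\ 0 <= C1, 0 <= C2 & 0 <= C3] by split; lra.
have C0 : 0 < C by rewrite /C ltr_wpDl ?addr_ge0 ?mulr_ge0//; lra.
pose N x := z x * p x - q x.
(* the error over one mesh interval is small compared with its length *)
have key (e : R) : 0 < e -> exists2 d : R, 0 < d & forall u v, 0 <= u -> u <= v -> v <= t -> v - u < d ->
    `|N v - N u - p u * (I v - I u)| <= e * (v - u).
  move=> e0; have eC : 0 < e / C by rewrite divr_gt0.
  have [d1 d10 hd1] := segment_uniform_continuous cp eC.
  have [d2 d20 hd2] := segment_uniform_continuous cz eC.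
  exists (Num.min d1 d2); first by rewrite lt_min d10.
  move=> u v u0 uv vt; rewrite lt_min => /andP[uvd1 uvd2].
  have uI : 0 <= u <= t by rewrite u0 (le_trans uv vt).
  have vI : 0 <= v <= t by rewrite vt (le_trans u0 uv).
  pose H x := z v * p x + p u * A x - q x.
  pose dH x := z v * (- dphi x * p x ^+ 2) + p u * m x - r x.
  have HE : N v - N u - p u * (I v - I u) = H v - H u.
    have Iv : I v = z v - xi - A v by rewrite [in RHS](zE vI) /A /m /p; ring.
    have Iu : I u = z u - xi - A u by rewrite [in RHS](zE uI) /A /m /p; ring.
    by rewrite Iv Iu /N /H; ring.
  have dHP x : x \in `]u, v[%R -> is_derive x 1 H (dH x).
    rewrite in_itv/= => /andP[ux xv].
    have x0 : 0 < x by exact: le_lt_trans ux.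
    have xt : x < t by exact: lt_le_trans vt.
    have xI : 0 < x < t by rewrite x0.
    have dph := phiD xI; have dAx := dA x xI; have dqx := dq x xI.
    have xN : phi x != 0 by apply: phiN0; rewrite !ltW.
    have dpx : is_derive x 1 p (- dphi x * p x ^+ 2).
      have := is_deriveV xN dph.
      by rewrite /GRing.scale/= /p mulNr exprVn mulrC mulNr => h; exact: h.
    have h1 := is_deriveZ (z v) dpx; have h2 := is_deriveZ (p u) dAx.
    exact: (is_deriveB (is_deriveD h1 h2) dqx).
  have cH : {within `[u, v], continuous H}.
    apply: (@within_continuous_sub R 0 t) => //; apply: within_continuousB => //.
    by apply: within_continuousD; exact: within_continuousZ.
  have [c] := MVT_segment uv dHP cH.
  rewrite in_itv/= => /andP[uc cv] hc.
  have cI : 0 <= c <= t by rewrite (le_trans u0 uc) (le_trans cv vt).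
  rewrite HE hc normrM (ger0_norm (_ : 0 <= v - u)) ?subr_ge0//.
  rewrite ler_wpM2r ?subr_ge0//.
  have dHE : dH c = (dphi c * p c * z c + psi c) * (p u - p c) + dphi c * p c * p c * (z c - z v).
    by rewrite /dH /m /r; ring.
  have e1 : `|p u - p c| <= e / C.
    apply: ltW; apply: (hd1 _ _ uI cI); rewrite distrC ger0_norm ?subr_ge0//.
    by apply: le_lt_trans uvd1; rewrite lerD2r.
  have e2 : `|z c - z v| <= e / C.
    apply: ltW; apply: (hd2 _ _ cI vI); rewrite distrC ger0_norm ?subr_ge0//.
    by apply: le_lt_trans uvd2; rewrite lerD2l lerN2.
  rewrite dHE; apply: (le_trans (ler_normD _ _)).
  have -> : e = (C1 * C2 * C3 + C4) * (e / C) + C1 * C2 * C2 * (e / C).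
    rewrite -mulrDl; have -> : C1 * C2 * C3 + C4 + C1 * C2 * C2 = C by rewrite /C addrAC.
    by rewrite mulrC divfK// gt_eqF.
  have hdp : `|dphi c| * `|p c| <= C1 * C2 by apply: ler_pM; [by []|by []|exact: hC1|exact: hC2].
  rewrite !normrM; apply: lerD.
    apply: ler_pM; [by []|by []| |exact: e1].
    apply: (le_trans (ler_normD _ _)); apply: lerD; last exact: hC4.
    rewrite !normrM; apply: ler_pM; [by rewrite mulr_ge0|by []|exact: hdp|exact: hC3].
  apply: ler_pM; [by rewrite !mulr_ge0|by []| |exact: e2].
  by apply: ler_pM; [by rewrite mulr_ge0|by []|exact: hdp|exact: hC2].
apply/cvgrPdist_le => e e0.
have et : 0 < e / t by rewrite divr_gt0.
have [d d0 hd] := key _ et.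
apply: filterS (grid_mesh d0) => n nd.
have N0 : N 0 = xi by rewrite /N /q set_itv1 Rintegral_set1 subr0 z0 /p phi0 invr1 mulr1.
have -> : z t / phi t - xi - \int[mu]_(u in `[0, t]) (psi u / phi u) = N t - N 0.
  by rewrite N0 /N /q /r /p; ring.
have -> : N t - N 0 = \sum_(k < n.+1) (N (grid n k.+1) - N (grid n k)).
  by rewrite -(big_mkord xpredT (fun k => N (grid n k.+1) - N (grid n k))) telescope_sumr// grid0 grid_last.
rewrite -sumrB; apply: (le_trans (ler_norm_sum _ _ _)).
apply: (@le_trans _ _ (\sum_(k < n.+1) e / t * (t / n.+1%:R))).
  apply: ler_sum => k _; rewrite -(gridS n k); apply: hd.
  - by have /andP[] := grid_itv (ltnW (ltn_ord k)).
  - by rewrite -subr_ge0 gridS divr_ge0// ltW.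
  - by have /andP[] := @grid_itv n k.+1 (ltn_ord k).
  - by rewrite gridS.
rewrite sumr_const card_ord -(mulr_natr (_ * _)) -[leLHS]mulrA (divfK _ t) ?pnatr_eq0//.
by rewrite divfK// gt_eqF.
Qed.

End pathwise_integral.

(** The Riemann sums of the previous lemma are Wiener integrals, of [sigma] times the
   step function that takes the value [p] at the left end of each mesh interval;
   by uniform continuity of [p] these integrands converge uniformly. *)
Lemma riemann_integrand_cvg (R : realType) (t : R) (p sigma : R -> R) (e : R) :
  0 < t -> {within `[0, t], continuous p} -> {within `[0, t], continuous sigma} ->
  0 < e -> \forall n \near \oo,
  (L2norm (@lebesgue_measure R)
    ((fun x => \sum_(k < n.+1) p (grid t n k) *
      (sigma x * \1_(`[0%R, grid t n k.+1]%classic) x - sigma x * \1_(`[0%R, grid t n k]%classic) x)) \-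
     (fun x => sigma x * p x * \1_(`]0%R, t]%classic) x))%R <= e%:E)%E.
Proof.
move=> t0 cp cs e0.
have mi (i : interval R) : measurable_fun setT (\1_([set` i]) : R -> R).
  by apply: measurable_indic; exact: measurable_itv.
have [C C1 hC] := segment_bounded (ltW t0) cs.
have C0 : 0 < C by exact: lt_le_trans C1.
pose eta := e / (C * (t + 1)).
have t1 : 0 < t + 1 by lra.
have eta0 : 0 < eta by rewrite divr_gt0// mulr_gt0.
have [d d0 hd] := segment_uniform_continuous cp eta0.
have [N0 _ hN0] := grid_mesh t d0; exists N0 => // n /hN0 /= nd.
have g0 := grid0 t n; have gl := grid_last t n.
have gi k : (k <= n.+1)%N -> 0 <= grid t n k <= t by exact: grid_itv.
have gS k : grid t n k <= grid t n k.+1 by rewrite -subr_ge0 gridS divr_ge0// ltW.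
pose J k x : R := \1_(`]grid t n k, grid t n k.+1]%classic) x.
have JE k x : (k <= n)%N -> \1_(`[0%R, grid t n k.+1]%classic) x - \1_(`[0%R, grid t n k]%classic) x = J k x.
  move=> kn; rewrite /J !indicE !mem_setE !in_itv /=.
  have /andP[k0 _] : 0 <= grid t n k <= t by apply: gi; rewrite ltnW.
  have [xu|ux] := leP x (grid t n k).
    by rewrite (le_trans xu (gS k)) !andbT subrr.
  by rewrite andbF (ltW (le_lt_trans k0 ux)) /= subr0.
have sumJ x : \sum_(k < n.+1) J k x = \1_(`]0%R, t]%classic) x.
  rewrite -(big_mkord xpredT (fun k => J k x)) big_nat_cond.
  rewrite (eq_bigr (fun k => \1_(`[0%R, grid t n k.+1]%classic) x - \1_(`[0%R, grid t n k]%classic) x)); last first.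
    by move=> k /andP[/andP[_ kn] _]; rewrite JE.
  rewrite -big_nat_cond telescope_sumr// g0 gl !indicE !mem_setE !in_itv /=.
  have [x0|x0] := ltP 0 x; last first.
    rewrite andFb; have [->|xN] := eqVneq x 0; first by rewrite lexx (ltW t0) subrr.
    by rewrite !(leNgt 0 x) lt_neqAle xN x0 subrr.
  by rewrite (ltW x0) /= subr0.
have bound x : `|(\sum_(k < n.+1) p (grid t n k) *
      (sigma x * \1_(`[0%R, grid t n k.+1]%classic) x - sigma x * \1_(`[0%R, grid t n k]%classic) x)) -
     sigma x * p x * \1_(`]0%R, t]%classic) x| <= C * eta * \1_(`]0%R, t]%classic) x.
  rewrite -sumJ !big_distrr -sumrB /=; apply: (le_trans (ler_norm_sum _ _ _)); apply: ler_sum => k _.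
  have kn : (k <= n)%N by rewrite -ltnS.
  rewrite -mulrBr JE//.
  have -> : p (grid t n k) * (sigma x * J k x) - sigma x * p x * J k x =
     sigma x * (p (grid t n k) - p x) * J k x by ring.
  rewrite /J indicE; have [|_] := boolP (x \in `]grid t n k, grid t n k.+1]%classic); last by rewrite !mulr0 normr0.
  rewrite mem_setE in_itv/= => /andP[x1 x2]; rewrite !mulr1 normrM.
  have /andP[k0 k0'] : 0 <= grid t n k <= t by apply: gi; rewrite ltnW.
  have /andP[k1 k1'] : 0 <= grid t n k.+1 <= t by exact: gi.
  have xt : 0 <= x <= t by rewrite (ltW (le_lt_trans k0 x1)) (le_trans x2 k1').
  apply: ler_pM; [by []|by []|exact: hC|apply: ltW; apply: hd => //; first by rewrite k0].
  rewrite distrC gtr0_norm ?subr_gt0//; apply: le_lt_trans nd; rewrite -(gridS t n k).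
  by rewrite lerD2r.
rewrite L2norm_leP ?(ltW e0)//.
apply: (@le_trans _ _ (\int[@lebesgue_measure R]_x ((C * eta) ^+ 2 * \1_(`]0%R, t]%classic) x)%:E)%E).
  apply: ge0_le_integral => //.
  - by move=> x _; rewrite lee_fin sqr_ge0.
  - apply/measurable_EFinP/measurable_funX/measurable_funB.
      apply: measurable_sum => k; apply: measurable_funM => //; apply: measurable_funB.
        by apply: (segment_measurable _ _ cs) => //; have /andP[] := gi k.+1 (ltn_ord k).
      by apply: (segment_measurable _ _ cs) => //; have /andP[] := gi k (ltnW (ltn_ord k)).
    rewrite (_ : (fun x => _) = (fun x => (sigma x * p x * \1_(`[0, t]%classic) x) * \1_(`]0, t]%classic) x)).
      by apply: measurable_funM => //; apply: (@segment_measurable R 0 t) => //; exact: within_continuousM.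
    apply/funext => x; rewrite -[in RHS]mulrA; congr (_ * _); rewrite !indicE !mem_setE !in_itv /=.
    have [x0|] := ltP 0 x; last by rewrite mulr0.
    by rewrite (ltW x0) /= -natrM mulnb andbb.
  - by apply/measurable_EFinP/measurable_funM.
  - move=> x _; rewrite lee_fin /= -real_normK ?num_real//.
    apply: (@le_trans _ _ ((C * eta * \1_(`]0%R, t]%classic) x) ^+ 2)).
      by rewrite ler_pXn2r ?nnegrE// ?bound// (le_trans _ (bound x)).
    by rewrite exprMn indicE; case: (_ \in _); rewrite ?expr1n ?expr0n.
under eq_integral do rewrite EFinM.
rewrite ge0_integralZl//; first last.
- by rewrite lee_fin sqr_ge0.
- exact/measurable_EFinP.
rewrite integral_indic//= setIT lebesgue_measure_itv/= lte_fin t0 oppr0 adde0 -EFinM lee_fin.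
rewrite /eta [X in X ^+ 2](_ : _ = e / (t + 1)); last by field; lra.
rewrite expr_div_n mulrAC ler_pdivrMr ?exprn_gt0// ler_wpM2l ?sqr_ge0//; nra.
Qed.


(** * Existence of a left limit by chaining *)

Section dyadic_chaining.
Variable R : realType.
Local Notation theta := (9 / 10 : R).

Definition dyadic (k j : nat) : R := j%:R / (2 ^ k)%:R.

Lemma pow2_gt0 k : 0 < (2 ^ k)%:R :> R.
Proof. by rewrite ltr0n expn_gt0. Qed.

Lemma dyadic_step k j : dyadic k j.+1 - dyadic k j = ((2 ^ k)%:R)^-1.
Proof. by rewrite /dyadic -mulrBl -natrB// subSnn mul1r. Qed.

Lemma dyadic_double k j : dyadic k.+1 j.*2 = dyadic k j.
Proof.
rewrite /dyadic expnS -mul2n !natrM; field.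
by rewrite gt_eqF ?pow2_gt0.
Qed.

(** Move from level to level; the factor 9 is [theta / (1 - theta)], from the
   geometric series of the bounds. *)
Lemma dyadic_chain (f : R -> R) (K n d j : nat) :
  (forall k i, (K <= k)%N -> (i.+1 < 2 ^ k)%N ->
     `|f (dyadic k i.+1) - f (dyadic k i)| <= theta ^+ k) ->
  (K <= n)%N -> (j < 2 ^ (n + d))%N ->
  `|f (dyadic (n + d) j) - f (dyadic n (j %/ 2 ^ d))| <= 9 * (theta ^+ n - theta ^+ (n + d)).
Proof.
move=> h Kn; elim: d j => [|d IH] j.
  by rewrite addn0 divn1 !subrr normr0 mulr0.
rewrite addnS => jlt.
have j2 : (j./2 < 2 ^ (n + d))%N.
  by rewrite -(ltn_pmul2l (ltn0Sn 1)) -expnS (leq_ltn_trans _ jlt)// -divn2 mulnC leq_divM.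
have step : `|f (dyadic (n + d).+1 j) - f (dyadic (n + d) j./2)| <= theta ^+ (n + d).+1.
  have jE : j = (odd j + j./2.*2)%N by rewrite odd_double_half.
  rewrite -(dyadic_double (n + d) j./2) {1}jE.
  have [oj|oj] := boolP (odd j); last by rewrite add0n subrr normr0 exprn_ge0//; lra.
  rewrite add1n; apply: h; first by rewrite (leq_trans Kn)// -addnS leq_addr.
  by move: jlt; rewrite -[in (j < _)%N](odd_double_half j) oj add1n.
have := IH _ j2; rewrite -divn2 -divnMA -expnS divn2 => IHj.
rewrite -(subrK (f (dyadic (n + d) j./2)) (f (dyadic (n + d).+1 j))) -addrA.
apply: (le_trans (ler_normD _ _)); apply: (le_trans (lerD step IHj)).
rewrite le_eqVlt; apply/orP; left; apply/eqP; rewrite exprS.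
set q := theta ^+ (n + d); set q' := theta ^+ n; lra.
Qed.

Lemma theta_cvg0 (e : R) : 0 < e -> exists n, forall m, (n <= m)%N -> theta ^+ m < e.
Proof.
move=> e0; have : (theta ^+ n : R) @[n --> \oo] --> (0 : R).
  by apply: cvg_expr; rewrite ger0_norm; lra.
move=> /cvgr0_norm_lt /(_ _ e0) [n _ hn]; exists n => m nm.
by have := hn m nm; rewrite /= ger0_norm// exprn_ge0//; lra.
Qed.

(** Near 1 the function stays within [9 * theta ^ n] of its value at [1 - 2 ^ - n]: this holds
   at dyadic points by chaining, and elsewhere by continuity. Hence it is Cauchy
   at 1. *)
Lemma dyadic_left_limit (f : R -> R) (K : nat) :
  (forall k i, (K <= k)%N -> (i.+1 < 2 ^ k)%N ->
     `|f (dyadic k i.+1) - f (dyadic k i)| <= theta ^+ k) ->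
  (forall s, 0 < s < 1 -> {for s, continuous f}) ->
  cvg (f x @[x --> 1^'-]).
Proof.
move=> h cf.
have near_end n s : (K <= n)%N -> (0 < n)%N -> 1 - ((2 ^ n)%:R)^-1 <= s -> s < 1 ->
    `|f s - f (1 - ((2 ^ n)%:R)^-1)| <= 9 * theta ^+ n.
  move=> Kn n0 s1 s2; apply/ler_addgt0Pr => e e0.
  have n2 : (1 < 2 ^ n)%N by rewrite -(expn0 2) ltn_exp2l.
  have s0 : 0 < s.
    apply: lt_le_trans s1; rewrite subr_gt0 invf_lt1 ?pow2_gt0//.
    by rewrite ltr1n.
  have /cvgrPdist_lt /(_ _ e0) [r /= r0 hr] : {for s, continuous f} by apply: cf; rewrite s0.
  (* a level [m] fine enough for [s] to be within [r] of a dyadic point *)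
  pose d := Num.truncn r^-1.
  pose m := (n + d)%N.
  pose j := Num.truncn (s * (2 ^ m)%:R).
  have sm0 : 0 <= s * (2 ^ m)%:R by rewrite mulr_ge0// ltW.
  have /andP[j1 j2] := truncn_itv sm0; rewrite -/j in j1 j2.
  have jm : (j < 2 ^ m)%N.
    rewrite -(ltr_nat R); apply: le_lt_trans j1 _.
    by rewrite gtr_pMl ?pow2_gt0.
  have mr : ((2 ^ m)%:R)^-1 < r.
    rewrite -[ltRHS]invrK ltf_pV2 ?posrE ?invr_gt0 ?pow2_gt0//.
    apply: (lt_le_trans (truncnS_gt _)); rewrite ler_nat -/d.
    by rewrite (leq_trans (ltn_expl d (ltnSn 1)))// leq_exp2l// leq_addl.
  have fj : `|f s - f (dyadic m j)| < e.
    apply: hr => /=; rewrite ger0_norm; last first.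
      by rewrite subr_ge0 /dyadic ler_pdivrMr ?pow2_gt0.
    apply: lt_trans mr; rewrite -(dyadic_step m j) ltrD2r /dyadic.
    by rewrite ltr_pdivlMr ?pow2_gt0.
  have jd : (j %/ 2 ^ d = (2 ^ n).-1)%N.
    apply/eqP; rewrite eqn_leq; apply/andP; split.
      by rewrite -ltnS prednK ?expn_gt0// ltn_divLR ?expn_gt0// -expnD.
    rewrite leq_divRL ?expn_gt0// -(ler_nat R).
    have : ((2 ^ n).-1 * 2 ^ d)%:R <= s * (2 ^ m)%:R :> R.
      rewrite /m expnD !natrM mulrA ler_wpM2r//.
      apply: (@le_trans _ _ ((1 - ((2 ^ n)%:R)^-1) * (2 ^ n)%:R)); last by rewrite ler_wpM2r.
      by rewrite mulrBl mul1r mulVf ?gt_eqF ?pow2_gt0// -subn1 natrB ?expn_gt0.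
    by move=> /le_lt_trans /(_ j2); rewrite ltr_nat ltnS ler_nat.
  have := dyadic_chain h Kn jm; rewrite jd.
  have -> : dyadic n (2 ^ n).-1 = 1 - ((2 ^ n)%:R)^-1.
    by rewrite /dyadic -subn1 natrB ?expn_gt0// mulrBl mul1r divff// gt_eqF ?pow2_gt0.
  move=> hc.
  rewrite -(subrK (f (dyadic m j)) (f s)) -addrA.
  apply: (le_trans (ler_normD _ _)); rewrite [leRHS]addrC; apply: lerD; first exact: ltW.
  apply: (le_trans hc); rewrite ler_pM2l// gerBl exprn_ge0//; lra.
apply: cauchy_cvg; apply: cauchy_exP => e e0.
have e9 : 0 < e / 9 by rewrite divr_gt0.
have [N hN] := theta_cvg0 e9.
pose n := (maxn N (maxn K 1)).
have Nn : (N <= n)%N by rewrite leq_maxl.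
have Kn : (K <= n)%N by rewrite /n !leq_max leqnn orbT.
have n1 : (0 < n)%N by rewrite /n !leq_max ltnSn !orbT.
exists (f (1 - ((2 ^ n)%:R)^-1)).
have lt1 : 1 - ((2 ^ n)%:R)^-1 < 1 :> R by rewrite ltrBlDr ltrDl invr_gt0 pow2_gt0.
change (\forall s \near 1^'-, ball (f (1 - ((2 ^ n)%:R)^-1)) e (f s)); near=> s.
rewrite /ball /= distrC; apply: le_lt_trans (near_end n s Kn n1 _ _) _.
- by apply: ltW; near: s; exact: nbhs_left_gt.
- by near: s; exact: nbhs_left_lt.
- by rewrite mulrC -ltr_pdivlMr// hN.
Unshelve. all: by end_near. Qed.

End dyadic_chaining.

Section kolmogorov.
Context (R : realType) d (T : measurableType d) (P : probability T R).
Local Notation theta := (9 / 10 : R).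

Lemma markov_moment4 (Y : T -> R) (x : R) : 0 < x -> measurable_fun setT Y ->
  (P [set w | x <= `|Y w|]%R <= (x ^+ 4)^-1%:E * \int[P]_w (Y w ^+ 4)%:E)%E.
Proof.
move=> x0 mY.
rewrite -lee_pdivrMl; last by rewrite invr_gt0 exprn_gt0.
rewrite invrK.
pose Y' : {RV P >-> R} := HB.pack Y (isMeasurableFun.Build _ _ _ _ _ mY).
have mX : measurable_fun setT (fun r : R => r ^+ 4) by exact: measurable_funX.
have h := @markov _ _ _ P Y' (fun r => r ^+ 4) x x0 mX (fun r _ => ltac:(exact: exprn_even_ge0)).
have mono : {in Num.nneg &, {homo (fun r : R => r ^+ 4) : a b / a <= b}}.
  by move=> a b; rewrite !nnegrE => a0 b0 ab; rewrite ler_pXn2r ?nnegrE.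
apply: (le_trans (h mono)); rewrite unlock le_eqVlt; apply/orP; left; apply/eqP.
by apply: eq_integral => w _ /=; rewrite -normrX ger0_norm// exprn_even_ge0.
Qed.

(** Kolmogorov's criterion at an end point. There are fewer than [2 ^ k] dyadic
   increments of level [k], and each exceeds [theta ^ k] with probability at most
   [C / (4 ^ k * theta ^ (4 k))]. As [1 / 2 < theta ^ 4], these probabilities are
   summable, and the Borel-Cantelli lemma leaves almost surely finitely many bad
   levels. *)
Lemma moment4_left_limit (X : R -> T -> R) (C : R) : 0 <= C ->
  (forall s, measurable_fun setT (X s)) ->
  (forall s r, 0 <= s < 1 -> 0 <= r < 1 ->
    (\int[P]_w ((X s w - X r w) ^+ 4)%:E <= (C * (s - r) ^+ 2)%:E)%E) ->
  {ae P, forall w, forall s, 0 < s < 1 -> {for s, continuous (X ^~ w)}} ->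
  {ae P, forall w, cvg (X s w @[s --> 1^'-])}.
Proof.
move=> C0 mX hX cX.
pose A k j := [set w | theta ^+ k <= `|X (dyadic R k j.+1) w - X (dyadic R k j) w|].
pose F k := \big[setU/set0]_(j < (2 ^ k).-1) A k j.
have mA k j : measurable (A k j).
  by apply: measurable_norm_ge; exact: measurable_funB.
have mF k : measurable (F k) by apply: bigsetU_measurable => j _; exact: mA.
pose rho : R := (2 * theta ^+ 4)^-1.
have rho0 : 0 < rho by rewrite /rho; lra.
have PA k j : (j < (2 ^ k).-1)%N ->
    (P (A k j) <= (C * rho ^+ k / (2 ^ k)%:R)%:E)%E.
  move=> jk.
  have j1 : (j.+1 < 2 ^ k)%N by rewrite -ltnS prednK ?expn_gt0 in jk.
  have th0 : 0 < theta ^+ k by apply: exprn_gt0; lra.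
  have range i : (i < 2 ^ k)%N -> 0 <= dyadic R k i < 1.
    move=> ik; rewrite /dyadic divr_ge0 ?ler0n//=.
    by rewrite ltr_pdivrMr ?pow2_gt0// mul1r ltr_nat.
  have mY : measurable_fun setT (fun w => X (dyadic R k j.+1) w - X (dyadic R k j) w).
    exact: measurable_funB.
  apply: (le_trans (markov_moment4 th0 mY)).
  have := hX _ _ (range _ j1) (range _ (ltnW j1)); rewrite dyadic_step => hj.
  apply: (@le_trans _ _ ((theta ^+ k ^+ 4)^-1%:E * (C * ((2 ^ k)%:R)^-1 ^+ 2)%:E)%E).
    by apply: lee_wpmul2l => //; rewrite lee_fin invr_ge0 exprn_ge0// ltW.
  rewrite -EFinM lee_fin le_eqVlt; apply/orP; left; apply/eqP.
  have rhoE (th : R) : (2 * th ^+ 4)^-1 ^+ k = (2 ^+ k * th ^+ k ^+ 4)^-1.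
    by rewrite exprVn exprMn -!exprM mulnC.
  rewrite /rho rhoE natrX.
  have t4 : theta ^+ k ^+ 4 != 0 by rewrite gt_eqF// exprn_gt0.
  have p2 : (2 : R) ^+ k != 0 by rewrite gt_eqF// exprn_gt0.
  move: t4 p2; move: (theta ^+ k ^+ 4) ((2 : R) ^+ k) => u v u0 v0.
  by field; rewrite ?u0 ?v0.
have PF k : (P (F k) <= (C * rho ^+ k)%:E)%E.
  apply: (le_trans (Boole_inequality P (fun j _ => mA k j))).
  apply: (@le_trans _ _ (\sum_(j < (2 ^ k).-1) (C * rho ^+ k / (2 ^ k)%:R)%:E)%E).
    by apply: lee_sum => j _; exact: PA.
  rewrite sumEFin lee_fin sumr_const card_ord -[(C * _ / _) *+ _]mulr_natl mulrCA ler_piMr//.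
    by rewrite mulr_ge0// exprn_ge0// ltW.
  by rewrite ler_pdivrMr ?pow2_gt0// mul1r ler_nat leq_pred.
have F0 : P (lim_sup_set F) = 0.
  apply: lim_sup_set_cvg0 => //.
  apply: (@le_lt_trans _ _ (C / (1 - rho))%:E); last exact: ltry.
  apply: lime_le; first by apply: is_cvg_nneseries => n _ _; exact: measure_ge0.
  apply: nearW => n; rewrite big_mkord.
  apply: (@le_trans _ _ (\sum_(k < n) (C * rho ^+ k)%:E)%E).
    by apply: lee_sum => k _; exact: PF.
  rewrite sumEFin lee_fin.
  have rho1 : `|rho| < 1 by rewrite gtr0_norm// /rho invf_lt1; lra.
  have := geometric_le_lim n C0 rho0 rho1.
  by rewrite /series /= big_mkord.
have mL : measurable (lim_sup_set F).
  by apply: bigcap_measurable => // k _; exact: bigcup_measurable.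
have aeF : {ae P, forall w, ~ lim_sup_set F w}.
  by exists (lim_sup_set F); split => // w /= /contrapT.
apply: filterS2 aeF cX => w nF cw.
have [K hK] : exists K, forall k, (K <= k)%N -> ~ F k w.
  apply: contrapT => /forallNP h; apply: nF => K _.
  by have /existsNP[k /not_implyP[Kk /contrapT Fk]] := h K; exists k.
apply: (dyadic_left_limit (K := K)) => [k i Kk ik|]; last exact: cw.
rewrite leNgt; apply/negP => /ltW hlt; apply: (hK k Kk).
have ik' : (i < (2 ^ k).-1)%N by rewrite -ltnS prednK ?expn_gt0.
by rewrite /F -bigcup_mkord; exists i.
Qed.

End kolmogorov.


(** * Brownian motions in a Gaussian space *)

Section gaussian_space.
Context (R : realType) d (T : measurableType d) (Q : probability T R).
Implicit Types (G : set (T -> R)) (X Y : T -> R) (N : R -> T -> R).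

Lemma has_integral_ae (f g : T -> R) r : measurable_fun setT g ->
  {ae Q, forall w, f w = g w} -> has_integral Q f r -> has_integral Q g r.
Proof.
move=> mg fg [fi fr]; have [mf fin] := integrableP _ _ _ fi.
have mg' : measurable_fun setT (EFin \o g) by exact/measurable_EFinP.
split; last first.
  rewrite -fr; apply: ae_eq_integral => //.
  by apply: filterS fg => w /= ->.
apply/integrableP; split => //; apply: le_lt_trans fin.
rewrite le_eqVlt; apply/orP; left; apply/eqP.
apply: ge0_ae_eq_integral => //.
- exact: measurableT_comp.
- exact: measurableT_comp.
- by apply: filterS fg => w /= ->.
Qed.

(** A vector space of centered Gaussian variables: membership makes all finite families
   in it jointly Gaussian, and reduces laws to norms. *)
Definition gaussian_space G :=
  [/\ G (fun=> 0), forall Y, G Y -> exists s, centered_gaussian Q s Y,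
    forall X Y, G X -> G Y -> G (fun w => X w + Y w) &
    forall c X, G X -> G (fun w => c * X w)].

Lemma gaussian_spaceB G X Y : gaussian_space G -> G X -> G Y -> G (fun w => X w - Y w).
Proof.
move=> [_ _ GD GZ] GX GY; have := GD _ _ GX (GZ (-1) _ GY).
by under eq_fun do rewrite mulN1r.
Qed.

Lemma gaussian_space_sum G (I : Type) (s : seq I) (X : I -> T -> R) :
  gaussian_space G -> (forall i, G (X i)) -> G (fun w => \sum_(i <- s) X i w).
Proof.
move=> [G0 _ GD GZ] GX; elim: s => [|i s IH].
  by under eq_fun do rewrite big_nil.
by under eq_fun do rewrite big_cons; exact: GD.
Qed.

Lemma gaussian_space_law G Y s : gaussian_space G -> G Y -> 0 <= s ->
  L2norm Q Y = s%:E -> centered_gaussian Q s Y.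
Proof.
move=> [_ GG _ _] GY s0 nY; have [r gY] := GG _ GY.
by have := centered_gaussian_norm gY; rewrite nY => -[->].
Qed.

Lemma centered_gaussian_sqr s Y : centered_gaussian Q s Y ->
  has_integral Q (fun w => Y w ^+ 2) (s ^+ 2).
Proof.
move=> gY; have [mY s0 _] := gY; apply: ge0_has_integral.
- exact: measurable_funX.
- by move=> w; exact: sqr_ge0.
- by apply/L2norm_eqP => //; exact: centered_gaussian_norm.
Qed.

(** The laws of the values and of the increments fix the covariance [min u v], and the
   Gaussian space [G] makes the finite dimensional laws Gaussian; together they
   determine the law of the process. *)
Definition brownian_on G (V : \bar R) N :=
  [/\ forall v, 0 < v -> (v%:E < V)%E -> G (N v),
    forall v, 0 < v -> (v%:E < V)%E -> centered_gaussian Q (Num.sqrt v) (N v),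
    forall u v, 0 < u -> u <= v -> (v%:E < V)%E ->
      centered_gaussian Q (Num.sqrt (v - u)) (fun w => N v w - N u w) &
    {ae Q, forall w, forall v, 0 < v -> (v%:E < V)%E -> {for v, continuous (N ^~ w)}}].

(** By polarization. *)
Lemma brownian_product G V N u v : brownian_on G V N -> 0 < u -> u <= v -> (v%:E < V)%E ->
  has_integral Q (fun w => N u w * N v w) u.
Proof.
move=> [_ N1 N2 _] u0 uv vV.
have uV : (u%:E < V)%E by rewrite (le_lt_trans _ vV)// lee_fin.
have v0 : 0 < v by exact: lt_le_trans uv.
have hu := centered_gaussian_sqr (N1 _ u0 uV).
have hv := centered_gaussian_sqr (N1 _ v0 vV).
have huv := centered_gaussian_sqr (N2 _ _ u0 uv vV).
have := has_integralZ 2^-1 (has_integralD (has_integralD hu hv) (has_integralZ (-1) huv)).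
rewrite !sqr_sqrtr ?subr_ge0 ?(ltW u0) ?(ltW v0)//.
rewrite (_ : 2^-1 * _ = u); last by lra.
by congr has_integral; apply/funext => w /=; field.
Qed.

(** For [s <= t] the covariance is [e^(- s / 2) * e^(- t / 2) * e^s]. The paths are replaced
   by zero on a null set to make all of them continuous. *)
Lemma OU_of_brownian G N : gaussian_space G -> brownian_on G +oo%E N ->
  exists2 U : R -> {RV Q >-> R}, stationary_OU U &
    {ae Q, forall w, forall u, U u w = expR (- (u / 2)) * N (expR u) w}.
Proof.
move=> gG bN; have [GN N1 N2 [A [mA A0 hA]]] := bN.
have cN w : ~ A w -> forall v, 0 < v -> {for v, continuous (N ^~ w)}.
  move=> nA v v0; apply: contrapT => nc; apply: nA; apply: hA => /= /(_ v v0).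
  by rewrite ltry => /(_ isT).
pose Uf u w := expR (- (u / 2)) * N (expR u) w * \1_(~` A) w.
have UE u w : ~ A w -> Uf u w = expR (- (u / 2)) * N (expR u) w.
  by move=> nA; rewrite /Uf indicE mem_set// mulr1.
have U0 u w : A w -> Uf u w = 0.
  by move=> nA; rewrite /Uf indicE memNset ?mulr0//; exact.
have mU u : measurable_fun setT (Uf u).
  have [mN _ _] := N1 _ (expR_gt0 u) (ltry _).
  apply: measurable_funM; first exact: measurable_funM.
  by apply: measurable_indic; exact: measurableC.
have aeA : {ae Q, forall w, ~ A w} by exists A; split => // w /= /contrapT.
pose U u : {RV Q >-> R} := HB.pack (Uf u) (isMeasurableFun.Build _ _ _ _ _ (mU u)).
have gU (n : nat) (c t : 'I_n -> R) : exists s, centered_gaussian Q s (fun w => \sum_(i < n) c i * Uf (t i) w).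
  have [_ GG _ GZ] := gG.
  have [s gs] : exists s, centered_gaussian Q s
      (fun w => \sum_(i < n) c i * (expR (- (t i / 2)) * N (expR (t i)) w)).
    apply: GG; apply: (gaussian_space_sum (X := fun i w => c i * (expR (- (t i / 2)) * N (expR (t i)) w)) _ gG) => i.
    by apply/GZ/GZ/GN; rewrite ?expR_gt0 ?ltry.
  exists s; apply: (centered_gaussian_ae _ _ gs).
    by apply: measurable_sum => i; exact: measurable_funM.
  apply: filterS aeA => w nA; apply: eq_bigr => i _; by rewrite UE.
have gU1 u : exists s, centered_gaussian Q s (Uf u).
  have [s] := gU 1%N (fun=> 1) (fun=> u).
  by under eq_fun do rewrite big_ord1 mul1r; exists s.
exists U; last by apply: filterS aeA => w nA u; exact: UE.
split.
- move=> n c t; have [s [_ s0 hs]] := gU n c t; exists 0, s; split => //.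
- by move=> t; have [s /centered_gaussian_mean] := gU1 t.
- move=> s t; wlog st : s t / s <= t.
    have [st|ts] := leP s t; first exact.
    by move=> h; rewrite covarianceC distrC; apply: h; exact: ltW.
  have est : has_integral Q (fun w => Uf s w * Uf t w) (expR (- `|t - s| / 2)).
    have mUU : measurable_fun setT (fun w => Uf s w * Uf t w) by exact: measurable_funM.
    have est : expR s <= expR t by rewrite ler_expR.
    have hN := brownian_product bN (expR_gt0 s) est (ltry _).
    have := has_integralZ (expR (- (s / 2)) * expR (- (t / 2))) hN.
    rewrite -!expRD (_ : - (s / 2) - t / 2 + s = - `|t - s| / 2); last first.
      by rewrite ger0_norm ?subr_ge0//; field.
    apply: has_integral_ae => //; apply: filterS aeA => w nA.
    by rewrite !UE//; rewrite expRD; ring.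
  have L1 u : (Uf u : T -> R) \in Lfun Q 1.
    have [r gr] := gU1 u; have [mr _ _] := gr.
    exact: (Lfun2_Lfun1 (L2norm_Lfun2 mr (centered_gaussian_norm gr))).
  rewrite covarianceE ?L1//; last by apply/Lfun1_integrable; have [] := est.
  have mean0 u : ('E_Q[U u] = 0)%E by have [r /centered_gaussian_mean] := gU1 u.
  rewrite !mean0 mule0 sube0 unlock; by have [] := est.
- move=> w t; have [Aw|nA] := pselect (A w).
    rewrite (_ : (fun t => U t w) = fun=> 0); first exact: cvg_cst.
    by apply/funext => u; exact: U0.
  rewrite (_ : (fun t => U t w) = fun t => expR (- (t / 2)) * N (expR t) w); last first.
    by apply/funext => u; exact: UE.
  have ce : continuous (fun x : R => expR (- (x / 2))).
    move=> x; apply: (@continuous_comp _ _ _ (fun x : R => - (x / 2)) (@expR R)); last exact: continuous_expR.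
    by apply: cvgN; apply: cvgMr_tmp; exact: cvg_id.
  have cNe : {for t, continuous (fun x => N (expR x) w)}.
    apply: (@continuous_comp _ _ _ (@expR R) (N ^~ w)); first exact: continuous_expR.
    by apply: cN => //; exact: expR_gt0.
  exact: (cvgM (ce t) cNe).
Qed.
End gaussian_space.


(** * Continuation of a Brownian motion past a finite time *)

Section L2_closure.
Context (R : realType) d (T : measurableType d) (Q : probability T R).
Implicit Types (G : set (T -> R)) (X Y : T -> R).

(** The value of the continued process at the end of the original time interval is only
   a limit of values of the original one. *)
Definition L2_closure G : set (T -> R) :=
  [set Y | measurable_fun setT Y /\ forall e : R, 0 < e ->
     exists X, G X /\ (L2norm Q (X \- Y)%R <= e%:E)%E].

Lemma gaussian_space_measurable G Y : gaussian_space Q G -> G Y -> measurable_fun setT Y.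
Proof. by move=> [_ GG _ _] /GG[s []]. Qed.

Lemma sub_L2_closure G Y : gaussian_space Q G -> G Y -> L2_closure G Y.
Proof.
move=> gG GY; split; first exact: gaussian_space_measurable gG GY.
move=> e e0; exists Y; split => //.
rewrite (_ : _ \- _ = fun=> 0)%R; first by rewrite L2norm0 lee_fin ltW.
by apply/funext => w /=; rewrite subrr.
Qed.

Lemma L2_closure_sub G G' : G `<=` G' -> L2_closure G `<=` L2_closure G'.
Proof.
by move=> GG' Y [mY h]; split => // e /h[X [/GG' GX nX]]; exists X.
Qed.

Lemma L2norm_limit (X : nat -> T -> R) Y (c : nat -> R) (x : R) :
  (forall n, measurable_fun setT (X n)) -> measurable_fun setT Y ->
  (forall e : R, 0 < e -> \forall n \near \oo, (L2norm Q (X n \- Y)%R <= e%:E)%E) ->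
  (\forall n \near \oo, L2norm Q (X n) = (c n)%:E) -> c @ \oo --> x ->
  L2norm Q Y = x%:E.
Proof.
move=> mX mY XY cE cx; apply/eqP; rewrite eq_le; apply/andP; split.
- apply/lee_addgt0Pr => e e0; have e2 : 0 < e / 2 by rewrite divr_gt0.
  have /cvgrPdist_le /(_ _ e2) cd := cx.
  near \oo => n.
  apply: (le_trans (L2norm_le_sub Q mY (mX n))).
  have -> : (x%:E + e%:E = (x + e / 2)%:E + (e / 2)%:E)%E by rewrite -!EFinD; congr EFin; lra.
  apply: leeD.
    rewrite (_ : L2norm Q (X n) = (c n)%:E); last by near: n.
    have : `|x - c n| <= e / 2 by near: n.
    by rewrite lee_fin ler_norml; lra.
  by rewrite L2normBC; near: n; exact: XY.
- apply/lee_addgt0Pr => e e0; have e2 : 0 < e / 2 by rewrite divr_gt0.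
  have /cvgrPdist_le /(_ _ e2) cd := cx.
  near \oo => n.
  have xc : (x%:E <= L2norm Q (X n) + (e / 2)%:E)%E.
    rewrite (_ : L2norm Q (X n) = (c n)%:E); last by near: n.
    have : `|x - c n| <= e / 2 by near: n.
    by rewrite -EFinD lee_fin ler_norml; lra.
  apply: (le_trans xc).
  have -> : (L2norm Q Y + e%:E = (L2norm Q Y + (e / 2)%:E) + (e / 2)%:E)%E.
    by rewrite -addeA -EFinD; congr (_ + EFin _)%E; lra.
  apply: leeD => //; apply: (le_trans (L2norm_le_sub Q (mX n) mY)).
  by apply: leeD => //; near: n; exact: XY.
Unshelve. all: by end_near. Qed.

Lemma L2_closure_seq G Y : L2_closure G Y -> exists X : nat -> T -> R,
  (forall n, G (X n)) /\
  (forall e : R, 0 < e -> \forall n \near \oo, (L2norm Q (X n \- Y)%R <= e%:E)%E).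
Proof.
move=> [mY h].
have /choice[X hX] : forall n : nat, exists X, G X /\ (L2norm Q (X \- Y)%R <= (n.+1%:R^-1)%:E)%E.
  by move=> n; apply: h.
exists X; split => [n|e e0]; first by have [] := hX n.
near=> n; have [_ /le_trans] := hX n; apply; rewrite lee_fin; apply: ltW.
by near: n; exact: near_infty_natSinv_lt (PosNum e0).
Unshelve. all: by end_near. Qed.

Context d0 (T0 : measurableType d0) (P0 : probability T0 R).
Variable B0 : R -> {RV P0 >-> R}.
Hypothesis hB0 : standard_wiener B0.

Lemma gaussian_space_closure G : gaussian_space Q G -> gaussian_space Q (L2_closure G).
Proof.
move=> gG; have [G0 GG GD GZ] := gG; split.
- exact: sub_L2_closure.
- move=> Y [mY h]; apply: (gaussian_L2_closed hB0) => // e e0.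
  by have [X [/GG[s gX] nX]] := h e e0; exists s, X.
- move=> X Y [mX hX] [mY hY]; split; first exact: measurable_funD.
  move=> e e0; have e2 : 0 < e / 2 by rewrite divr_gt0.
  have [X' [GX' nX]] := hX _ e2; have [Y' [GY' nY]] := hY _ e2.
  have mX' := gaussian_space_measurable gG GX'; have mY' := gaussian_space_measurable gG GY'.
  exists (fun w => X' w + Y' w); split; first exact: GD.
  rewrite (_ : _ \- _ = (X' \- X) \+ (Y' \- Y))%R; last by apply/funext => w /=; ring.
  have m1 : measurable_fun setT (X' \- X) by exact: measurable_funB.
  have m2 : measurable_fun setT (Y' \- Y) by exact: measurable_funB.
  apply: (le_trans (L2normD Q m1 m2)).
  by rewrite (splitr e) EFinD; exact: leeD.
- move=> c X [mX hX]; split; first exact: measurable_funM.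
  move=> e e0; have c1 : 0 < `|c| + 1 by rewrite ltr_wpDl.
  have ec : 0 < e / (`|c| + 1) by rewrite divr_gt0.
  have [X' [GX' nX]] := hX _ ec; exists (fun w => c * X' w); split; first exact: GZ.
  have mX' := gaussian_space_measurable gG GX'.
  rewrite (_ : _ \- _ = (fun w => c * (X' \- X) w))%R; last by apply/funext => w /=; ring.
  have m1 : measurable_fun setT (X' \- X) by exact: measurable_funB.
  rewrite (L2normZ Q c m1).
  apply: (@le_trans _ _ (`|c|%:E * (e / (`|c| + 1))%:E)%E); first exact: lee_wpmul2l.
  rewrite -EFinM lee_fin mulrA ler_pdivrMr// mulrC ler_wpM2l ?ltW//; lra.
Qed.

(** [M] is a Brownian motion before time [V], in [G1]; the increments of [B'] are orthogonal
   to [G1] and have the variances of Brownian increments, which [orthB] says in terms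
   of norms. *)
Section extension.
Variables (G G1 : set (T -> R)) (V : R) (M B' : R -> T -> R).
Hypothesis gG : gaussian_space Q G.
Hypothesis gG1 : gaussian_space Q G1.
Hypothesis G1G : G1 `<=` G.
Hypothesis V0 : 0 < V.
Hypothesis bM : brownian_on Q G1 V%:E M.
Hypothesis GB : forall s, G (B' s).
Hypothesis B'0 : forall s w, s <= 0 -> B' s w = 0.
Hypothesis orthB : forall Y s r x, G1 Y -> s <= r -> L2norm Q Y = x%:E ->
  L2norm Q (fun w => Y w + (B' r w - B' s w)) = (Num.sqrt (x ^+ 2 + (Num.max r 0 - Num.max s 0)))%:E.
Hypothesis cB' : {ae Q, forall w, continuous (B' ^~ w)}.

Let cG := gaussian_space_closure gG.
Let cG1 := gaussian_space_closure gG1.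

Lemma orth_closure Y s r x : L2_closure G1 Y -> s <= r -> L2norm Q Y = x%:E ->
  L2norm Q (fun w => Y w + (B' r w - B' s w)) = (Num.sqrt (x ^+ 2 + (Num.max r 0 - Num.max s 0)))%:E.
Proof.
move=> cY sr nY; have [mY _] := cY; have [X [GX XY]] := L2_closure_seq cY.
have mX n := gaussian_space_measurable gG1 (GX n).
have mB s' := gaussian_space_measurable gG (GB s').
pose c n := fine (L2norm Q (X n)).
have cE n : L2norm Q (X n) = (c n)%:E.
  by have [_ GG _ _] := gG1; have [t /centered_gaussian_norm nt] := GG _ (GX n); rewrite /c nt.
have cx : c @ \oo --> x.
  apply/cvgrPdist_le => e e0; near=> n.
  have h : (L2norm Q (X n \- Y)%R <= e%:E)%E by near: n; exact: XY.
  have := L2norm_le_sub Q mY (mX n); have := L2norm_le_sub Q (mX n) mY.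
  rewrite L2normBC in h; rewrite nY cE [L2norm _ (X n \- Y)]L2normBC => h1 h2.
  have := le_trans h1 (leeD2l _ h); have := le_trans h2 (leeD2l _ h).
  by rewrite -!EFinD !lee_fin ler_norml; lra.
apply: (@L2norm_limit (fun n w => X n w + (B' r w - B' s w)) _
  (fun n => Num.sqrt (c n ^+ 2 + (Num.max r 0 - Num.max s 0)))).
- by move=> n; apply: measurable_funD => //; exact: measurable_funB.
- by apply: measurable_funD => //; exact: measurable_funB.
- move=> e /XY; apply: filterS => n; congr (L2norm _ _ <= _)%E.
  by apply/funext => w /=; ring.
- by apply: nearW => n; exact: orthB.
- apply: (@continuous_cvg _ _ _ _ _ _ (@Num.sqrt R)); first exact: sqrt_continuous.
  apply: cvgD; last exact: cvg_cst.
  by rewrite expr2; under eq_fun do rewrite expr2; exact: cvgM.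
Unshelve. all: by end_near. Qed.

(* times increasing to [V] along which limits are taken *)
Let v_ (n : nat) : R := V - V / 2 / n.+1%:R.

Let v_gt0 n : 0 < v_ n.
Proof.
rewrite subr_gt0 ltr_pdivrMr// ltr_pdivrMr//.
rewrite -mulrA ltr_pMr// -natrM ltr1n muln2; exact: (@leq_trans n.+1.*2).
Qed.

Let v_lt n : v_ n < V.
Proof. by rewrite ltrBlDr ltrDl !divr_gt0. Qed.

Let v_le m n : (m <= n)%N -> v_ m <= v_ n.
Proof.
move=> mn; rewrite lerD2l lerN2 ler_wpM2l//; first by rewrite divr_ge0// ltW.
by rewrite lef_pV2 ?posrE// ler_nat.
Qed.

Let v_cvg : v_ @ \oo --> V.
Proof.
rewrite -[X in _ --> X]subr0; apply: cvgB; first exact: cvg_cst.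
rewrite -(mulr0 (V / 2)); apply: cvgMl_tmp.
exact: cvg_harmonic.
Qed.

(** The increments have fourth moments [3 * (v - u) ^ 2]. The second half
   [[V / 2, V)] of the time interval is rescaled to [[0, 1)]. *)
Let left_limit : {ae Q, forall w, cvg (M v w @[v --> V^'-])}.
Proof.
have [GM M1 M2 cM] := bM.
pose X s w := if 0 <= s < 1 then M (V * (1 + s) / 2) w else 0.
have XE s w : 0 <= s < 1 -> X s w = M (V * (1 + s) / 2) w by rewrite /X => ->.
have rng s : 0 <= s < 1 -> 0 < V * (1 + s) / 2 /\ V * (1 + s) / 2 < V.
  move=> /andP[s0 s1]; have h0 := V0.
  have h1 : 0 <= V * s by rewrite mulr_ge0// ltW.
  have h2 : V * s < V by rewrite gtr_pMr.
  by split; lra.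
have mX s : measurable_fun setT (X s).
  have [s01|s01] := boolP (0 <= s < 1).
    rewrite (_ : X s = M (V * (1 + s) / 2)); last by apply/funext => w; exact: XE.
    by have [r1 r2] := rng _ s01; have [] := M1 _ r1; rewrite ?lte_fin.
  rewrite (_ : X s = fun=> 0); first exact: measurable_cst.
  by apply/funext => w; rewrite /X (negbTE s01).
have C0 : 0 <= 3 * (V / 2) ^+ 2 by rewrite mulr_ge0// sqr_ge0.
have := @moment4_left_limit _ _ _ Q X (3 * (V / 2) ^+ 2) C0 mX.
have hX s r : 0 <= s < 1 -> 0 <= r < 1 ->
    (\int[Q]_w ((X s w - X r w) ^+ 4)%:E <= (3 * (V / 2) ^+ 2 * (s - r) ^+ 2)%:E)%E.
  wlog rs : s r / r <= s.
    move=> h s01 r01; have [rs|sr] := leP r s; first exact: h.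
    rewrite -[(s - r) ^+ 2]sqrrN opprB.
    apply: le_trans (h _ _ (ltW sr) r01 s01); rewrite le_eqVlt; apply/orP; left; apply/eqP.
    by apply: eq_integral => w _; congr EFin; ring.
  move=> s01 r01; have [s1 s2] := rng _ s01; have [r1 r2] := rng _ r01.
  have rs' : V * (1 + r) / 2 <= V * (1 + s) / 2.
    by rewrite ler_pM2r// ler_pM2l// lerD2l.
  have := centered_gaussian_moment4 (M2 _ _ r1 rs' s2).
  under eq_integral do rewrite -!XE//.
  move=> ->; rewrite lee_fin le_eqVlt; apply/orP; left; apply/eqP.
  rewrite -[4%N]/(2 * 2)%N exprM sqr_sqrtr ?subr_ge0//; by field.
move=> /(_ hX).
have cX : {ae Q, forall w, forall s, 0 < s < 1 -> {for s, continuous (X ^~ w)}}.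
  apply: filterS cM => w cw s /andP[s0 s1].
  have s01 : 0 <= s < 1 by rewrite ltW.
  have [r1 r2] := rng _ s01.
  rewrite /prop_for /continuous_at XE//.
  have hc : {for s, continuous (fun x : R => M (V * (1 + x) / 2) w)}.
    apply: (@continuous_comp _ _ _ (fun x : R => V * (1 + x) / 2) (M ^~ w)); last exact: cw.
    apply: cvgMr_tmp; apply: cvgMl_tmp; apply: cvgD; [exact: cvg_cst|exact: cvg_id].
  apply: cvg_trans hc; apply: near_eq_cvg; near=> x.
  rewrite XE//; apply/andP; split; first apply: ltW.
    by near: x; exact: lt_nbhsr.
  by near: x; exact: lt_nbhsl.
move=> /(_ cX); apply: filterS => w /cvg_ex[/= l hl]; apply/cvg_ex; exists l.
have hc : X (2 * v / V - 1) w @[v --> V^'-] --> l.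
  move=> A /hl[e /= e0 he]; exists (e * V / 2) => /=; first by rewrite divr_gt0// mulr_gt0.
  move=> v /= hv vV; apply: he => /=; last by rewrite ltrBlDr ltr_pdivrMr//; lra.
  have -> : 1 - (2 * v / V - 1) = (V - v) * (2 / V) by field; rewrite gt_eqF.
  rewrite normrM [`|2 / V|]gtr0_norm ?divr_gt0//.
  by rewrite mulrA ltr_pdivrMr//; lra.
apply: cvg_trans hc; apply: near_eq_cvg; near=> v.
rewrite XE.
  by congr (M _ w); field; rewrite gt_eqF.
have v1 : v < V by near: v; exact: nbhs_left_lt.
have v2 : V / 2 < v by near: v; apply: nbhs_left_gt; rewrite ltr_pdivrMr// ltr_pMr// ltr1n.
have h0 := V0.
apply/andP; split; first by rewrite subr_ge0 ler_pdivlMr//; lra.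
rewrite ltrBlDr ltr_pdivrMr//; lra.
Unshelve. all: by end_near. Qed.

(** The limit is set to zero on a null set, to be measurable. *)
Let left_limit_rv : exists L : T -> R, measurable_fun setT L /\
  {ae Q, forall w, M v w @[v --> V^'-] --> L w}.
Proof.
have [GM M1 M2 cM] := bM; have [A [mA A0 hA]] := left_limit.
pose h n w := M (v_ n) w * \1_(~` A) w.
have mh n : measurable_fun setT (h n).
  apply: measurable_funM; first by have [] := M1 _ (v_gt0 n); rewrite ?lte_fin ?v_lt.
  by apply: measurable_indic; exact: measurableC.
have nAc w : ~ A w -> M v w @[v --> V^'-] --> lim (M v w @[v --> V^'-]).
  by move=> nA; apply: contrapT => nc; apply: nA; apply: hA => /= h1; exact: nc.
pose L w := lim (M v w @[v --> V^'-]) * \1_(~` A) w.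
exists L; split.
  apply: (measurable_fun_cvg mh) => w _; have [Aw|nA] := pselect (A w).
    rewrite (_ : h ^~ w = fun=> 0).
      suff -> : L w = 0 by exact: cvg_cst.
      by rewrite /L indicE memNset ?mulr0//; exact.
    by apply/funext => n; rewrite /h indicE memNset ?mulr0//; exact.
  rewrite /L indicE mem_set// mulr1 (_ : h ^~ w = fun n => M (v_ n) w); last first.
    by apply/funext => n; rewrite /h indicE mem_set// mulr1.
  by move/cvg_at_leftP : (nAc w nA); apply; split.
exists A; split => // w /= nc; apply: contrapT => nA; apply: nc.
by rewrite /L indicE mem_set// mulr1; exact: nAc.
Qed.

(** By Fatou, the distance to the limit is at most the limit of the distances. *)
Let L2_left_limit (L : T -> R) : measurable_fun setT L ->
  {ae Q, forall w, M v w @[v --> V^'-] --> L w} ->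
  forall e : R, 0 < e -> \forall n \near \oo, (L2norm Q (M (v_ n) \- L)%R <= e%:E)%E.
Proof.
move=> mL cL e e0; have [GM M1 M2 cM] := bM.
have mM n : measurable_fun setT (M (v_ n)) by have [] := M1 _ (v_gt0 n); rewrite ?lte_fin ?v_lt.
have key n : (L2norm Q (M (v_ n) \- L)%R <= (Num.sqrt (V - v_ n))%:E)%E.
  rewrite L2normBC.
  apply: (@L2norm_fatou _ _ _ Q (fun k => (M (v_ k) \- M (v_ n))%R) (L \- M (v_ n))%R (Num.sqrt (V - v_ n))).
  - exact: sqrtr_ge0.
  - by move=> k; exact: measurable_funB.
  - exact: measurable_funB.
  - apply: filterS cL => w /cvg_at_leftP hw; apply: cvgB; last exact: cvg_cst.
    by apply: hw; split.
  - exists n => // k /= nk.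
    have := M2 _ _ (v_gt0 n) (v_le nk); rewrite lte_fin => /(_ (v_lt k)) /centered_gaussian_norm.
    rewrite /GRing.sub_fun /= => ->; rewrite lee_fin; apply: ler_wsqrtr.
    by rewrite lerD2r ltW.
near=> n; apply: (le_trans (key n)); rewrite lee_fin.
rewrite -(ger0_norm (ltW e0)) -sqrtr_sqr; apply/ler_wsqrtr/ltW.
rewrite -[ltLHS]ger0_norm ?subr_ge0 ?ltW//.
near: n; have e2 : 0 < e ^+ 2 by rewrite exprn_gt0.
by have /cvgrPdist_lt /(_ _ e2) := v_cvg.
Unshelve. all: by end_near. Qed.

(** The continued process is [M~ v + B' (v - V)], where [M~] is [M] stopped at its limit
   [L], and [B'] vanishes at negative times. The first term has variance
   [min v V], the second one [max (v - V) 0], and they are orthogonal. *)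
Lemma brownian_extension : exists N,
  brownian_on Q (L2_closure G) +oo%E N /\ forall v w, v < V -> N v w = M v w.
Proof.
have [L [mL cL]] := left_limit_rv; have nL := L2_left_limit mL cL.
have [GM M1 M2 cM] := bM.
have mM v : 0 < v -> v < V -> measurable_fun setT (M v).
  by move=> v0 vV; have [] := M1 _ v0; rewrite ?lte_fin.
have G1v n : G1 (M (v_ n)) by apply: GM; rewrite ?lte_fin ?v_lt ?v_gt0.
have GL : L2_closure G1 L.
  split => // e e0; have [n _ hn] := nL _ e0.
  by exists (M (v_ n)); split; last exact: hn (leqnn n).
(* [L] inherits the norms of the increments of [M] *)
have normL Y y : G1 Y -> (\forall n \near \oo, L2norm Q (fun w => M (v_ n) w - Y w) = (Num.sqrt (v_ n - y))%:E) ->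
    L2norm Q (fun w => L w - Y w) = (Num.sqrt (V - y))%:E.
  move=> GY nY; have mY := gaussian_space_measurable gG1 GY.
  apply: (@L2norm_limit (fun n w => M (v_ n) w - Y w) _ (fun n => Num.sqrt (v_ n - y))) => //.
  - by move=> n; apply: measurable_funB => //; exact: gaussian_space_measurable gG1 (G1v n).
  - exact: measurable_funB.
  - move=> e /nL; apply: filterS => n; congr (L2norm _ _ <= _)%E.
    by apply/funext => w /=; ring.
  - apply: (@continuous_cvg _ _ _ _ _ _ (@Num.sqrt R)); first exact: sqrt_continuous.
    by apply: cvgB; [exact: v_cvg|exact: cvg_cst].
pose Mt v := if v < V then M v else L.
have GMt v : 0 < v -> L2_closure G1 (Mt v).
  rewrite /Mt => v0; case: ifPn => vV //; apply: sub_L2_closure => //.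
  by apply: GM; rewrite ?lte_fin.
have nMt v : 0 < v -> L2norm Q (Mt v) = (Num.sqrt (Num.min v V))%:E.
  move=> v0; rewrite /Mt; case: ltP => vV.
    by apply: centered_gaussian_norm; apply: M1; rewrite ?lte_fin.
  have [G10 _ _ _] := gG1.
  have := normL (fun=> 0) 0 G10; rewrite subr0.
  under [L2norm Q _]eq_L2norm do rewrite subr0.
  move=> ->//; apply: nearW => n; rewrite subr0.
  under eq_L2norm do rewrite subr0.
  by apply: centered_gaussian_norm; apply: M1; rewrite ?lte_fin ?v_lt ?v_gt0.
have nMtB u v : 0 < u -> u <= v ->
    L2norm Q (fun w => Mt v w - Mt u w) = (Num.sqrt (Num.min v V - Num.min u V))%:E.
  move=> u0 uv; rewrite /Mt; case: (ltP v V) => vV.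
    have uV := le_lt_trans uv vV; rewrite uV.
    apply: centered_gaussian_norm.
    by rewrite (min_idPl (ltW uV)); apply: M2; rewrite ?lte_fin.
  case: (ltP u V) => uV; last first.
    rewrite subrr sqrtr0; under eq_L2norm do rewrite subrr; exact: L2norm0.
  apply: normL; first by apply: GM; rewrite ?lte_fin.
  have uV0 : 0 < V - u by rewrite subr_gt0.
  have /cvgrPdist_le /(_ _ uV0) := v_cvg; apply: filterS => n hn.
  apply: centered_gaussian_norm; apply: M2; rewrite ?lte_fin ?v_lt//.
  by move: hn; rewrite ger0_norm ?subr_ge0 ?(ltW (v_lt n))//; lra.
exists (fun v w => Mt v w + B' (v - V) w).
have cGB s : L2_closure G (B' s) by exact: sub_L2_closure.
have cGMt v : 0 < v -> L2_closure G (Mt v) by move=> /GMt; apply: L2_closure_sub.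
have [_ _ cGD _] := cG.
split; last first.
  by move=> v w vV; rewrite /Mt vV B'0 ?addr0// subr_le0 ltW.
split.
- by move=> v v0 _; apply: cGD; [exact: cGMt|exact: cGB].
- move=> v v0 _; apply: (gaussian_space_law cG) => //.
    by apply: cGD; [exact: cGMt|exact: cGB].
  have min1 : Num.min (v - V) 0 <= v - V by rewrite ge_min lexx.
  have min2 : Num.min (v - V) 0 <= 0 by rewrite ge_min lexx orbT.
  have := orth_closure (GMt v v0) min1 (nMt v v0).
  under eq_L2norm do rewrite (B'0 _ min2) subr0.
  have min3 : 0 <= Num.min v V by rewrite le_min ltW// ltW.
  move=> ->; rewrite sqr_sqrtr// [Num.max (Num.min _ _) _](max_idPr min2) subr0; congr (Num.sqrt _)%:E.
  case: (leP v V) => vV.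
    by rewrite (max_idPr _) ?addr0// subr_le0.
  by rewrite (max_idPl _) ?subr_ge0 ?(ltW vV)//; ring.
- move=> u v u0 uv _; have v0 := lt_le_trans u0 uv.
  apply: (gaussian_space_law cG) => //.
    by apply: (gaussian_spaceB cG); apply: cGD; by [exact: cGMt|exact: cGB].
  have GB1 : L2_closure G1 (fun w => Mt v w - Mt u w) by apply: (gaussian_spaceB cG1); exact: GMt.
  have uv' : u - V <= v - V by rewrite lerD2r.
  have := orth_closure GB1 uv' (nMtB u v u0 uv).
  rewrite sqr_sqrtr; last by rewrite subr_ge0 le_min !ge_min uv lexx orbT.
  have -> : Num.min v V - Num.min u V + (Num.max (v - V) 0 - Num.max (u - V) 0) = v - u.
    have minmax x : Num.min x V + Num.max (x - V) 0 = x.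
      case: (leP x V) => xV; first by rewrite (max_idPr _) ?addr0// subr_le0.
      by rewrite (max_idPl _) ?subr_ge0 ?(ltW xV)//; ring.
    by have := minmax v; have := minmax u; lra.
  by move=> <-; apply: eq_L2norm => w; ring.
- apply: filterS3 cM cL cB' => w cMw cLw cBw v v0 _.
  have cBv : {for v, continuous (fun v => B' (v - V) w)}.
    apply: (@continuous_comp _ _ _ (fun x : R => x - V) (B' ^~ w)); last exact: cBw.
    by apply: cvgB; [exact: cvg_id|exact: cvg_cst].
  suff cMt : {for v, continuous (Mt ^~ w)} by exact: (cvgD cMt cBv).
  have [vV|Vv|vV] := ltgtP v V.
  - have hc : {for v, continuous (M ^~ w)} by exact: cMw.
    have MtE : Mt v w = M v w by rewrite /Mt vV.
    rewrite /prop_for /continuous_at MtE; apply: cvg_trans hc.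
    apply: near_eq_cvg; near=> x; rewrite /Mt ifT//; near: x; exact: lt_nbhsl.
  - have MtE : Mt v w = L w by rewrite /Mt ltNge (ltW Vv).
    rewrite /prop_for /continuous_at MtE.
    have hc : L w @[_ --> v] --> L w by exact: cvg_cst.
    apply: cvg_trans hc; apply: near_eq_cvg; near=> x.
    rewrite /Mt ifF//; apply/negbTE; rewrite -leNgt ltW//; near: x; exact: lt_nbhsr.
  - rewrite vV; have MtE : Mt V w = L w by rewrite /Mt ltxx.
    apply/left_right_continuousP; split; rewrite MtE.
      apply: cvg_trans cLw; apply: near_eq_cvg; near=> x.
      rewrite /Mt ifT//; near: x; exact: nbhs_left_lt.
    have hc : L w @[_ --> V^'+] --> L w by exact: cvg_cst.
    apply: cvg_trans hc; apply: near_eq_cvg; near=> x.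
    rewrite /Mt ifF//; apply/negbTE; rewrite -leNgt ltW//; near: x; exact: nbhs_right_gt.
Unshelve. all: by end_near. Qed.
End extension.
End L2_closure.


(** * Functions on the time interval *)

Section horizon.
Context (R : realType) (T : \bar R).
Implicit Types (f df : R -> R) (t : R).

Lemma horizon_open t : open_horizon T t -> horizon T t.
Proof. by move=> [t0 tT]; split => //; exact: ltW. Qed.

Lemma horizon_le s t : 0 <= s -> s <= t -> horizon T t -> horizon T s.
Proof. by move=> s0 st [_ tT]; split => //; apply: le_lt_trans tT; rewrite lee_fin. Qed.

Lemma open_horizon_le s t : 0 < s -> s <= t -> open_horizon T t -> open_horizon T s.
Proof. by move=> s0 st [_ tT]; split => //; apply: le_lt_trans tT; rewrite lee_fin. Qed.

Lemma horizon_above t : (t%:E < T)%E -> exists2 t', t < t' & (t'%:E < T)%E.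
Proof.
case: T => [r|_|//]; last by exists (t + 1); rewrite ?ltrDl// ltry.
by rewrite lte_fin => tr; exists ((t + r) / 2); rewrite ?lte_fin; lra.
Qed.

Lemma horizon_within f t : horizon T t -> {within horizon T, continuous f} ->
  {within `[0, t], continuous f}.
Proof.
move=> hT; apply: continuous_subspaceW => x /=; rewrite in_itv/= => /andP[x0 xt].
exact: horizon_le hT.
Qed.

Lemma open_horizon_nbhs t : open_horizon T t -> \forall s \near t, open_horizon T s.
Proof.
move=> [t0 /horizon_above[t' tt' t'T]].
have ht' : open_horizon T t' by split => //; exact: lt_trans tt'.
near=> s; apply: (@open_horizon_le s t').
- by near: s; exact: lt_nbhsr.
- by apply: ltW; near: s; exact: lt_nbhsl.
- exact: ht'.
Unshelve. all: by end_near. Qed.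

Lemma horizon_continuous f t : open_horizon T t -> {within horizon T, continuous f} ->
  {for t, continuous f}.
Proof.
move=> [t0 /horizon_above[t' tt' t'T]] cf.
have t'0 : 0 < t' by exact: lt_trans tt'.
have ht' : horizon T t' by split => //; exact: ltW.
apply: (within_continuous_continuous t'0 (horizon_within ht' cf)).
by rewrite in_itv/= t0.
Qed.

Lemma C1_on_continuous (D : set R) f df : C1_on D f df -> {within D, continuous f}.
Proof.
move=> [hf _]; apply/subspace_continuousP => t Dt.
have h := hf t Dt.
have hid : s - t @[s --> within D t^'] --> (0 : R).
  rewrite -[X in _ --> X](subrr t); apply: cvgB; last exact: cvg_cst.
  by move=> A hA; apply: cvg_within; apply: cvg_within.
have FF : Filter (within D t^') by exact: within_filter.
have hm : (f s - f t) / (s - t) * (s - t) + f t @[s --> within D t^'] --> df t * 0 + f t.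
  by apply: cvgD; [exact: (cvgM h hid)|exact: cvg_cst].
rewrite mulr0 add0r in hm.
have cw : f s @[s --> within D t^'] --> f t.
  apply: cvg_trans hm; apply: near_eq_cvg.
  rewrite near_withinE; near=> s => Ds /=.
  rewrite divfK ?subrK// subr_eq0; near: s; exact: nbhs_dnbhs_neq.
move=> A hA; have hA1 := cw A hA.
move: hA1; rewrite /nbhs/= /within/= !nearE => -[e /= e0 he]; exists e => //= s hs Ds.
have [->|st] := eqVneq s t; first exact: nbhs_singleton.
exact: he.
Unshelve. all: by end_near. Qed.

Lemma C1_on_is_derive (D : set R) f df t : (\forall s \near t, D s) -> C1_on D f df ->
  is_derive t 1 f (df t).
Proof.
move=> Dt [hf _]; have h := hf t (nbhs_singleton Dt).
have h' : h^-1 *: (f (h *: 1 + t) - f t) @[h --> 0^'] --> df t.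
  move=> A /h; rewrite /nbhs /= /within /= !nearE.
  move: Dt => [r /= r0 hr] [e /= e0 he]; exists (Num.min r e) => /=; first by rewrite lt_min r0.
  move=> u /= hu u0; rewrite sub0r normrN lt_min in hu; move/andP : hu => [u1 u2].
  have E : t - (u + t) = - u by ring.
  have := he (u + t) _ _ _; rewrite /= E normrN => he'.
  rewrite -[u *: 1]/(u * 1) mulr1.
  have -> : u^-1 *: (f (u + t) - f t) = (f (u + t) - f t) / (u + t - t) by rewrite addrK mulrC.
  apply: he' => //; first by rewrite -subr_eq0 addrK.
  by apply: hr; rewrite /= E normrN.
apply: DeriveDef; first by apply/cvg_ex; exists (df t).
exact: (cvg_lim (@Rhausdorff R) h').
Qed.

Lemma C1_on_open_horizon f df t : open_horizon T t -> C1_on (open_horizon T) f df ->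
  is_derive t 1 f (df t).
Proof. by move=> /open_horizon_nbhs; exact: C1_on_is_derive. Qed.

Lemma C1_on_horizon f df t : open_horizon T t -> C1_on (horizon T) f df ->
  is_derive t 1 f (df t).
Proof.
move=> /open_horizon_nbhs hD; apply: C1_on_is_derive.
by apply: filterS hD => s; exact: horizon_open.
Qed.

End horizon.


(** * The noise of the equation *)

Section wiener_space.
Context (R : realType) d (Omega : measurableType d) (P : probability Omega R).
Variables (B : R -> {RV P >-> R}) (hB : standard_wiener B).
Local Notation mu := (@lebesgue_measure R).

(** Integrals against the path of [B] up to time [c]; those after [c] will be orthogonal
   to them. *)
Definition wiener_space (c : \bar R) : set (Omega -> R) :=
  [set Y | exists f, wiener_rv B f Y /\ forall x, (c < x%:E)%E -> f x = 0].

Lemma gaussian_wiener_space c : gaussian_space P (wiener_space c).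
Proof.
split.
- by exists (fun=> 0); split => //; exact: wiener_rv0.
- by move=> Y [f [hf _]]; exact: (wiener_rv_gaussian hB hf).
- move=> X Y [f [hf f0]] [g [hg g0]]; exists (fun x => f x + g x).
  by split; [exact: wiener_rvD|move=> x cx; rewrite f0// g0// addr0].
- move=> k X [f [hf f0]]; exists (fun x => k * f x).
  by split; [exact: wiener_rvZ|move=> x cx; rewrite f0// mulr0].
Qed.

Lemma wiener_rv_law f Y s : wiener_rv B f Y -> 0 <= s -> L2norm mu f = s%:E ->
  centered_gaussian P s Y.
Proof.
move=> hf s0; rewrite (wiener_rv_norm hB hf); apply: gaussian_space_law (gaussian_wiener_space +oo%E) _ s0.
by exists f; split => // x; rewrite ltNge leey.
Qed.

End wiener_space.

Section solution.
Context (d : measure_display) (Omega : measurableType d) (R : realType) (P : probability Omega R).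
Context (T : \bar R) (hT : (0 < T)%E) (a b : R -> R).
Hypothesis ha_pos : forall t, open_horizon T t -> 0 < a t.
Hypothesis hb_C1 : C1_on (open_horizon T) b (derive1 b).
Hypothesis hb_deriv : forall t, open_horizon T t -> 0 < derive1 b t.
Hypothesis hb_lim : b t @[t --> 0^'+] --> -oo.
Variable psi : R -> R.
Hypothesis hpsi : {within horizon T, continuous psi}.
Variables phi dphi : R -> R.
Hypothesis hphi : forall t, open_horizon T t -> phi t = a t / expR (b t / 2).
Hypothesis hphi0 : phi 0 = 1.
Hypothesis hphi_C1 : C1_on (horizon T) phi dphi.
Variable sigma : R -> R.
Hypothesis hsigma : forall t, open_horizon T t -> sigma t = Num.sqrt (derive1 b t * a t ^+ 2).
Hypothesis hsigma_cont : {within horizon T, continuous sigma}.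
Variables (B : R -> {RV P >-> R}) (hB : standard_wiener B) (xi : R) (Z : R -> {RV P >-> R}).
Hypothesis hZ : strong_solution B T (fun t z => dphi t / phi t * z + psi t) sigma xi Z.
Local Notation mu := (@lebesgue_measure R).

Let h x := sigma x * (phi x)^-1.

Let phi_gt0 t : horizon T t -> 0 < phi t.
Proof.
move=> [t0 tT]; have [->|tn0] := eqVneq t 0; first by rewrite hphi0.
have ot : open_horizon T t by split => //; rewrite lt_def tn0.
by rewrite hphi// divr_gt0 ?expR_gt0 ?ha_pos.
Qed.

Let phi_cont : {within horizon T, continuous phi}.
Proof. exact: C1_on_continuous hphi_C1. Qed.

Let dphi_cont : {within horizon T, continuous dphi}.
Proof. by case: hphi_C1. Qed.

Let segment_gt0 t : horizon T t -> forall x, 0 <= x <= t -> 0 < phi x.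
Proof. by move=> ht x /andP[x0 xt]; apply: phi_gt0; exact: horizon_le ht. Qed.

Let segmentV t : horizon T t -> {within `[0, t], continuous (fun x => (phi x)^-1)}.
Proof.
move=> ht; apply: within_continuousV; last exact: horizon_within ht phi_cont.
by move=> x /(segment_gt0 ht); rewrite lt0r => /andP[].
Qed.

Definition drift_integral (t : R) : R := \int[mu]_(u in `[0, t]) (psi u / phi u).

(** By variation of constants this is the integral of [h = sigma / phi] against [B]
   over [[0, t]]. *)
Definition noise (t : R) (w : Omega) : R := Z t w / phi t - (xi + drift_integral t).

Let measurable_noise t : measurable_fun setT (noise t).
Proof. by apply: measurable_funB => //; exact: measurable_funM. Qed.

(** Approximate [1 / phi] by step functions: the integrals converge along almost every
   path by [integrating_factor_sum_cvg], the integrands in L2. *)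
Lemma wiener_rv_noise t : open_horizon T t ->
  wiener_rv B (fun x => h x * \1_(`]0%R, t]%classic) x) (noise t).
Proof.
move=> ot; have ht := horizon_open ot; have [t0 _] := ot.
have cV := segmentV ht; have cs := horizon_within ht hsigma_cont.
have [_ cZ Z0 iZ [I [hI cI] ZE]] := hZ.
have seg := grid_itv t0.
apply: (@wiener_rv_ae_closed _ _ _ _ B hB
   (fun n x => \sum_(k < n.+1) (phi (grid t n k))^-1 *
      (sigma x * \1_(`[0%R, grid t n k.+1]%classic) x - sigma x * \1_(`[0%R, grid t n k]%classic) x))
   (fun n w => \sum_(k < n.+1) (phi (grid t n k))^-1 * (I (grid t n k.+1) w - I (grid t n k) w))).
- move=> n; apply: (@wiener_rv_sum _ _ _ _ B n.+1
    (fun k x => sigma x * \1_(`[0%R, grid t n k.+1]%classic) x - sigma x * \1_(`[0%R, grid t n k]%classic) x)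
    (fun k w => I (grid t n k.+1) w - I (grid t n k) w) (fun k => (phi (grid t n k))^-1)) => k kn.
  have piece j : (j <= n.+1)%N -> wiener_rv B (fun x => sigma x * \1_(`[0%R, grid t n j]%classic) x) (I (grid t n j)).
    move=> /seg /andP[g0 gt]; apply: wiener_rv_of_integral.
      exact: (segment_measurable (lexx 0) gt cs).
    by apply: hI; exact: horizon_le ht.
  by apply: wiener_rvB; apply: piece => //; exact: ltnW.
- rewrite (_ : (fun x => _) = fun x => (h x * \1_(`[0%R, t]%classic) x) * \1_(`]0%R, t]%classic) x).
    apply: measurable_funM.
      by apply: (segment_measurable (lexx 0) (lexx t)); exact: within_continuousM.
    by apply: measurable_indic; exact: measurable_itv.
  apply/funext => x; rewrite -mulrA; congr (_ * _); rewrite !indicE !mem_setE !in_itv/=.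
  by case: (ltP 0 x) => [x0|x0]; rewrite ?mulr0//= (ltW x0)/=; case: (x <= t); rewrite ?mulr0 ?mulr1.
- exact: measurable_noise.
- by move=> e e0; exact: riemann_integrand_cvg t0 cV cs e0.
- apply: filterS3 cZ Z0 ZE => w cZw Z0w ZEw.
  rewrite /noise opprD addrA.
  apply: (integrating_factor_sum_cvg (phi := phi) (dphi := dphi) (psi := psi) (z := Z ^~ w) (I := I ^~ w) t0).
  + exact: horizon_within ht phi_cont.
  + exact: horizon_within ht dphi_cont.
  + exact: horizon_within ht hpsi.
  + exact: horizon_within ht cZw.
  + exact: segment_gt0 ht.
  + exact: hphi0.
  + exact: Z0w.
  + move=> x /andP[x0 xt]; apply: (@C1_on_horizon _ T) => //.
    by apply: (open_horizon_le x0 (ltW xt) ot).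
  + by move=> x /andP[x0 xt]; apply: ZEw; exact: horizon_le ht.
Qed.

(** The variance of the noise, with its limit as value at 0. *)
Let E t := if 0 < t then expR (b t) else 0.

Let EE t : 0 < t -> E t = expR (b t).
Proof. by rewrite /E => ->. Qed.

Let b_deriv t : open_horizon T t -> is_derive t 1 b (derive1 b t).
Proof. by move=> ot; exact: C1_on_open_horizon hb_C1. Qed.

Let b_cont t : open_horizon T t -> {for t, continuous b}.
Proof.
move=> ot; apply/differentiable_continuous/derivable1_diffP.
by have [] := b_deriv ot.
Qed.

Let expb_cont t : open_horizon T t -> {for t, continuous (fun x => expR (b x))}.
Proof. by move=> ot; apply: continuous_comp; [exact: b_cont|exact: continuous_expR]. Qed.

Lemma expb_cvg0 : expR (b t) @[t --> 0^'+] --> (0 : R).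
Proof.
apply/cvgrPdist_lt => e e0; move/cvgrNyPlt : hb_lim => /(_ (ln e)).
apply: filterS => t ht; rewrite sub0r normrN gtr0_norm ?expR_gt0//.
by rewrite -[ltRHS]lnK ?posrE// ltr_expR.
Qed.

Lemma expb_lt s t : 0 < s -> s < t -> open_horizon T t -> expR (b s) < expR (b t).
Proof.
move=> s0 st ot; rewrite ltr_expR.
have sub x : s <= x <= t -> open_horizon T x.
  by move=> /andP[sx xt]; apply: open_horizon_le ot; rewrite ?(lt_le_trans s0).
apply: (@gtr0_derive1_lt_cc _ b s t) => //.
- by move=> x; rewrite in_itv/= => /andP[sx xt]; have [] := b_deriv (sub x _); rewrite ?(ltW sx) ?(ltW xt).
- by move=> x; rewrite in_itv/= => /andP[sx xt]; apply: hb_deriv; apply: sub; rewrite !ltW.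
- apply: continuous_in_subspaceT => x; rewrite inE/= in_itv/= => /sub; exact: b_cont.
- by rewrite in_itv/= lexx ltW.
- by rewrite in_itv/= lexx ltW.
Qed.

Let h_sqr t : open_horizon T t -> h t ^+ 2 = derive1 b t * expR (b t).
Proof.
move=> ot; rewrite /h hsigma// hphi// exprMn sqr_sqrtr; last first.
  by rewrite mulr_ge0 ?sqr_ge0// ltW// hb_deriv.
have a0 : a t != 0 by rewrite gt_eqF// ha_pos.
have -> : expR (b t) = expR (b t / 2) ^+ 2 by rewrite -expRM_natl; congr expR; field.
have e0 : expR (b t / 2) != 0 by rewrite gt_eqF// expR_gt0.
by field; rewrite a0 e0.
Qed.

(** [h ^ 2 = b' * expR b] is the derivative of [E]. *)
Lemma noise_variance s t : 0 <= s -> s < t -> open_horizon T t ->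
  L2norm mu (fun x => h x * \1_(`]s, t]%classic) x) = (Num.sqrt (E t - E s))%:E.
Proof.
move=> s0 st ot; have ht := horizon_open ot; have [t0 _] := ot.
have EsEt : E s <= E t.
  rewrite (EE t0) /E; case: ifPn => [s1|_]; last exact: expR_ge0.
  by apply: ltW; exact: expb_lt.
apply/L2norm_eqP; first exact: sqrtr_ge0.
rewrite sqr_sqrtr ?subr_ge0// EFinB.
have oi x : s < x -> x <= t -> open_horizon T x.
  by move=> sx xt; apply: open_horizon_le ot => //; exact: le_lt_trans sx.
have ch : {within `[s, t], continuous (fun x => h x ^+ 2)}.
  have ch1 : {within `[0, t], continuous h}.
    by apply: within_continuousM (segmentV ht); exact: horizon_within ht hsigma_cont.
  by have := within_continuous_sub s0 (lexx t) (within_continuousM ch1 ch1).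
have dE x : open_horizon T x -> is_derive x 1 E (h x ^+ 2).
  move=> ox; have [x0 _] := ox; rewrite h_sqr// mulrC.
  have hb := b_deriv ox.
  have hc : is_derive x 1 (expR \o b) (expR (b x) * derive1 b x) by exact: is_derive1_comp.
  apply: near_eq_is_derive hc.
  by near=> y; rewrite EE//; near: y; exact: lt_nbhsr.
have cE x : open_horizon T x -> {for x, continuous E}.
  by move=> /dE[dEx _]; apply/differentiable_continuous/derivable1_diffP.
rewrite -(@continuous_FTC2 R (fun x => h x ^+ 2) E s t) //.
- rewrite -integral_itv_obnd_cbnd; last first.
    apply/measurable_EFinP; apply: (@measurable_funS _ _ _ _ `[s, t]) => //.
      by apply: subset_itvr; rewrite bnd_simp.
    exact: (subspace_continuous_measurable_fun (measurable_itv `[s, t])).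
  rewrite [RHS]integral_mkcond; apply: eq_integral => x _.
  rewrite patchE indicE; case: (x \in _); rewrite /= ?mulr1 ?mulr0 ?expr0n//.
- split.
  + by move=> x; rewrite in_itv/= => /andP[sx xt]; have [] := dE x (oi x sx (ltW xt)).
  + have [s1|s1] := ltP 0 s.
      by apply: cvg_at_right_filter; apply: cE; exact: (open_horizon_le s1 (ltW st) ot).
    have -> : s = 0 by apply/eqP; rewrite eq_le s1 s0.
    rewrite {2}/E ltxx; apply: cvg_trans expb_cvg0; apply: near_eq_cvg; near=> x.
    by rewrite EE//; near: x; exact: nbhs_right_gt.
  + by apply: cvg_at_left_filter; exact: cE.
- move=> x; rewrite in_itv/= => /andP[sx xt].
  by rewrite derive1E; have [_ ] := dE x (oi x sx (ltW xt)).
Unshelve. all: by end_near. Qed.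

Let E0 : E 0 = 0. Proof. by rewrite /E ltxx. Qed.

Lemma noise_law t : open_horizon T t -> centered_gaussian P (Num.sqrt (expR (b t))) (noise t).
Proof.
move=> ot; have [t0 _] := ot.
apply: (wiener_rv_law hB (wiener_rv_noise ot) (sqrtr_ge0 _)).
by rewrite noise_variance// E0 subr0 EE.
Qed.

Lemma noise_increment_law s t : 0 < s -> s <= t -> open_horizon T t ->
  centered_gaussian P (Num.sqrt (expR (b t) - expR (b s))) (fun w => noise t w - noise s w).
Proof.
move=> s0; rewrite le_eqVlt => /predU1P[<-|st] ot.
  rewrite subrr sqrtr0; apply/centered_gaussian0; first exact: measurable_funB.
  by apply: nearW => w; rewrite subrr.
have os := open_horizon_le s0 (ltW st) ot.
apply: (wiener_rv_law hB (wiener_rvB (wiener_rv_noise ot) (wiener_rv_noise os)) (sqrtr_ge0 _)).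
rewrite -(EE s0) -(EE (lt_trans s0 st)) -(noise_variance (ltW s0) st ot).
by apply: eq_L2norm => x; rewrite (indic_increment x (ltW s0) (ltW st)); ring.
Qed.

Let drift_integral_continuous : {within horizon T, continuous drift_integral}.
Proof.
apply/subspace_continuousP => t [t0 tT].
have [t' tt' t'T] := horizon_above tT.
have t'0 : 0 < t' := le_lt_trans t0 tt'.
have ht' : horizon T t' by split => //; exact: ltW.
have cpp : {within `[0, t'], continuous (fun u => psi u / phi u)}.
  by apply: within_continuousM (segmentV ht'); exact: horizon_within ht' hpsi.
have [/within_continuousP/(_ t) h1 _] := segment_FTC1 t'0 cpp.
have /h1 {}h1 : 0 <= t <= t' by rewrite t0 ltW.
move=> A /h1; rewrite /nbhs /= /within /= !nearE => -[e /= e0 he].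
exists (Num.min e (t' - t)) => /=; first by rewrite lt_min e0 subr_gt0.
move=> s /=; rewrite lt_min => /andP[s1 s2] [s0 sT]; apply: he => //.
rewrite in_itv/= s0; move: s2; rewrite ltr_norml => /andP[s2 _]; lra.
Qed.

Let drift_integral0 : drift_integral 0 = 0.
Proof. by rewrite /drift_integral set_itv1 Rintegral_set1. Qed.

Lemma noise_continuous :
  {ae P, forall w, forall t, open_horizon T t -> {for t, continuous (noise ^~ w)}}.
Proof.
have [_ cZ _ _ _] := hZ; apply: filterS cZ => w cw t ot.
have cp := horizon_continuous ot phi_cont; have cz := horizon_continuous ot cw.
have cq := horizon_continuous ot drift_integral_continuous.
have p0 : phi t != 0 by rewrite gt_eqF// phi_gt0//; exact: horizon_open.
apply: cvgB; first by apply: cvgM => //; exact: cvgV.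
by apply: cvgD => //; exact: cvg_cst.
Qed.

Let phi_noise t w : horizon T t -> phi t * noise t w = Z t w - phi t * (xi + drift_integral t).
Proof.
move=> ht; rewrite /noise mulrBr mulrCA divff ?mulr1//.
by rewrite gt_eqF// phi_gt0.
Qed.

Let horizon0 : horizon T 0. Proof. by split. Qed.

Let horizon_right (f : R -> R) : {within horizon T, continuous f} -> f x @[x --> 0^'+] --> f 0.
Proof.
move=> /subspace_continuousP/(_ 0 horizon0) h0.
have [t' t'0 t'T] := horizon_above hT.
move=> A /h0; rewrite /nbhs /= /within /= !nearE => -[e /= e0 he].
exists (Num.min e t') => /=; first by rewrite lt_min e0.
move=> s /=; rewrite lt_min => /andP[s1 s2] s0; apply: he => //; split; first exact: ltW.
apply: lt_trans t'T; rewrite lte_fin; move: s2; rewrite sub0r normrN ltr_norml; lra.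
Qed.

Lemma noise_cvg0 : {ae P, forall w, phi t * noise t w @[t --> 0^'+] --> (0 : R)}.
Proof.
have [_ cZ Z0 _ _] := hZ; apply: filterS2 cZ Z0 => w cw Z0w.
have lim0 : Z t w - phi t * (xi + drift_integral t) @[t --> 0^'+] -->
    Z 0 w - phi 0 * (xi + drift_integral 0).
  apply: cvgB; first exact: (horizon_right cw).
  apply: cvgM; first exact: (horizon_right phi_cont).
  apply: cvgD; first exact: cvg_cst.
  exact: (horizon_right drift_integral_continuous).
rewrite Z0w hphi0 drift_integral0 addr0 mul1r subrr in lim0.
have [t' t'0 t'T] := horizon_above hT.
have ht' : open_horizon T t' by [].
apply: cvg_trans lim0; apply: near_eq_cvg; near=> t.
rewrite phi_noise//; apply: horizon_open.
apply: (open_horizon_le _ _ ht').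
- by near: t; exact: nbhs_right_gt.
- by near: t; exact: nbhs_right_ltW.
Unshelve. all: by end_near. Qed.

Lemma expectation_solution t : open_horizon T t ->
  ('E_P[Z t] = (phi t * (xi + drift_integral t))%:E)%E.
Proof.
move=> ot; have gN := centered_gaussianZ (phi t) (noise_law ot).
have [mN _ _] := gN; have iN := Lfun2_Lfun1 (L2norm_Lfun2 mN (centered_gaussian_norm gN)).
have -> : (Z t : Omega -> R) = (fun w => phi t * noise t w) \+ cst (phi t * (xi + drift_integral t)).
  by apply/funext => w /=; rewrite phi_noise ?subrK//; exact: horizon_open.
rewrite expectationD//; last exact: Lfun_cst.
by rewrite (centered_gaussian_mean gN) expectation_cst add0e.
Qed.

Lemma expectation_initial : ('E_P[Z 0] = xi%:E)%E.
Proof.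
have [_ _ Z0 _ _] := hZ; rewrite -(expectation_cst P xi) unlock.
apply: ae_eq_integral => //.
- exact/measurable_EFinP.
- exact/measurable_EFinP.
by apply: filterS Z0 => w /= ->.
Qed.

(** * Time change *)

(** The noise is a Brownian motion run with the clock [expR (b t)]: [noise_time] inverts the
   clock, which runs from 0 to [noise_horizon]. *)
Definition noise_horizon : \bar R := ereal_sup [set (expR (b t))%:E | t in open_horizon T].

Definition noise_time (v : R) : R := xget 0 [set t | open_horizon T t /\ expR (b t) = v].

Lemma expb_lt_inv s t : open_horizon T s -> open_horizon T t ->
  expR (b s) < expR (b t) -> s < t.
Proof.
move=> os ot st; rewrite ltNge; apply/negP; rewrite le_eqVlt => /predU1P[ts|ts].
  by move: st; rewrite ts ltxx.
have [t0 _] := ot; have := lt_trans st (expb_lt t0 ts os).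
by rewrite ltxx.
Qed.

Lemma expb_lt_horizon t : open_horizon T t -> ((expR (b t))%:E < noise_horizon)%E.
Proof.
move=> [t0 /horizon_above[t' tt' t'T]].
have ot' : open_horizon T t' by split => //; exact: lt_trans tt'.
apply: (@lt_le_trans _ _ (expR (b t'))%:E); first by rewrite lte_fin expb_lt.
by apply: ereal_sup_ubound; exists t'.
Qed.

Lemma noise_timeP v : 0 < v -> (v%:E < noise_horizon)%E ->
  open_horizon T (noise_time v) /\ expR (b (noise_time v)) = v.
Proof.
move=> v0 /ereal_sup_gt[_ [t1 ot1 <-]]; rewrite lte_fin => vt1.
suff hex : exists t, open_horizon T t /\ expR (b t) = v by exact: (xgetPex 0 hex).
have [t10 _] := ot1.
have [t0 [t00 t01 vt0]] : exists t0, [/\ 0 < t0, t0 < t1 & expR (b t0) < v].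
  have /cvgrPdist_lt /(_ _ v0) hv := expb_cvg0.
  have : \forall t \near 0^'+, [/\ 0 < t, t < t1 & expR (b t) < v].
    near=> t; split.
    - by near: t; exact: nbhs_right_gt.
    - by near: t; exact: nbhs_right_lt.
    - have : `|0 - expR (b t)| < v by near: t.
      by rewrite sub0r normrN gtr0_norm ?expR_gt0.
  by move=> /filter_ex[t ht]; exists t.
have sub x : x \in `[t0, t1] -> open_horizon T x.
  by rewrite in_itv/= => /andP[x0 x1]; apply: open_horizon_le x1 ot1; exact: lt_le_trans x0.
have cb : {within `[t0, t1], continuous (fun x => expR (b x))}.
  by apply: continuous_in_subspaceT => x /set_mem /= /sub; exact: expb_cont.
have [|c ct cv] := IVT (ltW t01) cb (v := v).
  have vv := lt_trans vt0 vt1.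
  by rewrite (min_idPl (ltW vv)) (max_idPr (ltW vv)) !ltW.
by exists c; split => //; exact: sub.
Unshelve. all: by end_near. Qed.

Lemma noise_timeK t : open_horizon T t -> noise_time (expR (b t)) = t.
Proof.
move=> ot; have [ot' E'] := noise_timeP (expR_gt0 _) (expb_lt_horizon ot).
have [t0 _] := ot; have [t'0 _] := ot'; move: E' t'0 ot'; set t' := noise_time _ => E' t'0 ot'.
have [tt'|tt'|//] := ltgtP t' t.
- by have := expb_lt t'0 tt' ot; rewrite E' ltxx.
- by have := expb_lt t0 tt' ot'; rewrite E' ltxx.
Qed.

Lemma noise_time_continuous v : 0 < v -> (v%:E < noise_horizon)%E ->
  {for v, continuous noise_time}.
Proof.
move=> v0 vV; have [ot tv] := noise_timeP v0 vV.
move: ot tv; set t := noise_time v => ot tv.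
have [t0 tT] := ot; have [t' tt' t'T] := horizon_above tT.
apply/cvgrPdist_lt => e e0; rewrite -/t.
pose t2 := Num.min t' (t + e / 2); pose t1 := Num.max (t / 2) (t - e / 2).
have ot' : open_horizon T t' by split => //; exact: lt_trans tt'.
have t2t : t < t2 by rewrite lt_min tt' ltrDl divr_gt0.
have t1t : t1 < t by rewrite gt_max ltrBlDr ltrDl divr_gt0// andbT ltr_pdivrMr// ltr_pMr// ltr1n.
have t10 : 0 < t1 by rewrite lt_max divr_gt0.
have o1 : open_horizon T t1 := open_horizon_le t10 (ltW t1t) ot.
have o2 : open_horizon T t2.
  by apply: open_horizon_le ot'; [exact: lt_trans t2t|rewrite ge_min lexx].
have l1 : expR (b t1) < v by rewrite -tv; exact: expb_lt.
have l2 : v < expR (b t2) by rewrite -tv; exact: expb_lt.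
near=> u.
have u1 : expR (b t1) < u by near: u; exact: lt_nbhsr.
have u2 : u < expR (b t2) by near: u; exact: lt_nbhsl.
have u0 : 0 < u := lt_trans (expR_gt0 _) u1.
have uV : (u%:E < noise_horizon)%E by apply: lt_trans (expb_lt_horizon o2); rewrite lte_fin.
have [ou bu] := noise_timeP u0 uV.
have s1 : t1 < noise_time u by apply: expb_lt_inv; rewrite ?bu.
have s2 : noise_time u < t2 by apply: expb_lt_inv; rewrite ?bu.
move: s1 s2; rewrite gt_max lt_min => /andP[_ s1] /andP[_ s2].
by rewrite ltr_norml; lra.
Unshelve. all: by end_near. Qed.

Lemma noise_brownian c : (T <= c)%E ->
  brownian_on P (wiener_space B c) noise_horizon (fun v => noise (noise_time v)).
Proof.
move=> Tc; split.
- move=> v v0 vV; have [ot _] := noise_timeP v0 vV.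
  exists (fun x => h x * \1_(`]0%R, noise_time v]%classic) x); split; first exact: wiener_rv_noise.
  move=> x cx; rewrite indicE mem_setE in_itv/= (_ : x <= _ = false) ?andbF ?mulr0//.
  apply/negbTE; rewrite -ltNge -lte_fin; have [_ tT] := ot.
  exact: lt_trans tT (le_lt_trans Tc cx).
- by move=> v v0 vV; have [ot bt] := noise_timeP v0 vV; rewrite -{1}bt; exact: noise_law.
- move=> u v u0 uv vV; have [ot bt] := noise_timeP (lt_le_trans u0 uv) vV.
  have uV : (u%:E < noise_horizon)%E by apply: le_lt_trans vV; rewrite lee_fin.
  have [os bs] := noise_timeP u0 uV.
  rewrite -{1}bt -{1}bs; apply: noise_increment_law => //; first by case: os.
  rewrite leNgt; apply/negP => /expb_lt /(_ os); have [t0 _] := ot => /(_ t0).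
  by rewrite bt bs ltNge uv.
- apply: filterS noise_continuous => w cw v v0 vV.
  have [ot _] := noise_timeP v0 vV.
  apply: (@continuous_comp _ _ _ noise_time (noise ^~ w)); first exact: noise_time_continuous.
  exact: cw.
Qed.

(** With [U u = expR (- u / 2) * N (expR u)] and [N (expR (b t)) = noise t],
   [a t * U (b t) = a t * expR (- b t / 2) * noise t = phi t * noise t], which is the
   centered solution; the limit at 0 is that of the right-hand side. The space
   of [N] may be larger than that of [Z]. *)
Lemma scaled_OU_of_brownian d' (Omega' : measurableType d') (P' : probability Omega' R)
    (proj : Omega' -> Omega) (G : set (Omega' -> R)) (N : R -> Omega' -> R) :
  space_extension P P' proj -> gaussian_space P' G -> brownian_on P' G +oo%E N ->
  (forall v w, (v%:E < noise_horizon)%E -> N v w = noise (noise_time v) (proj w)) ->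
  scaled_OU P' T a b (fun t w => Z t (proj w) - fine ('E_P[Z t])%E).
Proof.
move=> [mproj hproj] gG bN NE.
have lift (S : Omega -> Prop) : {ae P, forall w, S w} -> {ae P', forall w, S (proj w)}.
  move=> [A [mA A0 hA]]; exists (proj @^-1` A); split.
  - by rewrite -[X in measurable X]setTI; exact: mproj.
  - by rewrite hproj.
  - by move=> w /= nS; exact: hA.
have [U OU hU] := OU_of_brownian gG bN; exists U => //.
have [_ _ Z0 _ _] := hZ.
apply: filterS3 hU (lift _ noise_cvg0) (lift _ Z0) => w UE c0 Zw.
have key t : open_horizon T t -> a t * U (b t) w = phi t * noise t (proj w).
  move=> ot; rewrite UE NE ?expb_lt_horizon// noise_timeK// mulrA; congr (_ * _).
  by rewrite hphi// expRN.
split.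
- move=> t ot; rewrite key// expectation_solution//= phi_noise//; exact: horizon_open.
- rewrite expectation_initial /= Zw subrr; apply: cvg_trans c0; apply: near_eq_cvg.
  have [t' t'0 t'T] := horizon_above hT.
  have ot' : open_horizon T t' by [].
  near=> t; rewrite key//; apply: (open_horizon_le _ _ ot').
  + by near: t; exact: nbhs_right_gt.
  + by near: t; exact: nbhs_right_ltW.
Unshelve. all: by end_near. Qed.

End solution.


(** * Sources of further randomness *)

Section future.
Context (R : realType) d (Omega : measurableType d) (P : probability Omega R).
Variables (B : R -> {RV P >-> R}) (hB : standard_wiener B).
Local Notation mu := (@lebesgue_measure R).

(** [B] restarted at time [c], and constant before, so as to be continuous on the line. *)
Definition future (c s : R) (w : Omega) : R := B (c + Num.max s 0) w - B c w.

Lemma wiener_rv_increment u v : 0 <= u -> u <= v ->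
  wiener_rv B \1_(`]u, v]%classic) (fun w => B v w - B u w).
Proof.
move=> u0 uv; split.
- by apply: measurable_indic; exact: measurable_itv.
- exact: measurable_funB.
- move=> e e0; exists [:: (1, (u, v))]; split.
  + by move=> p; rewrite inE => /eqP -> /=; rewrite u0.
  + rewrite (_ : (_ \- _)%R = fun=> 0); first by rewrite L2norm0 lee_fin ltW.
    by apply/funext => x; rewrite /= /step_fun big_seq1 /= mul1r subrr.
  + rewrite (_ : (_ \- _)%R = fun=> 0); first by rewrite L2norm0 lee_fin ltW.
    by apply/funext => x; rewrite /= /step_integral big_seq1 /= mul1r subrr.
Qed.

Lemma future_increment c s r w :
  future c r w - future c s w = B (c + Num.max r 0) w - B (c + Num.max s 0) w.
Proof. by rewrite /future; ring. Qed.

Lemma max0_ge (s : R) : 0 <= Num.max s 0.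
Proof. by rewrite le_max lexx orbT. Qed.

Lemma max0_mono (s r : R) : s <= r -> Num.max s 0 <= Num.max r 0.
Proof. by move=> sr; rewrite ge_max !le_max sr lexx orbT. Qed.

Lemma wiener_rv_future c s r : 0 <= c -> s <= r ->
  wiener_rv B \1_(`]c + Num.max s 0, c + Num.max r 0]%classic)
    (fun w => future c r w - future c s w).
Proof.
move=> c0 sr; rewrite (_ : (fun w => _) = fun w => B (c + Num.max r 0) w - B (c + Num.max s 0) w); last first.
  by apply/funext => w; exact: future_increment.
by apply: wiener_rv_increment; rewrite ?addr_ge0 ?max0_ge// lerD2l max0_mono.
Qed.

Lemma future0 c s w : s <= 0 -> future c s w = 0.
Proof. by move=> s0; rewrite /future (max_idPr s0) addr0 subrr. Qed.

Lemma future_law c s r : 0 <= c -> s <= r ->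
  centered_gaussian P (Num.sqrt (Num.max r 0 - Num.max s 0)) (fun w => future c r w - future c s w).
Proof.
move=> c0 sr; rewrite (_ : (fun w => _) = fun w => B (c + Num.max r 0) w - B (c + Num.max s 0) w); last first.
  by apply/funext => w; exact: future_increment.
have := @wiener_increment_gaussian _ _ _ _ _ hB (c + Num.max s 0) (c + Num.max r 0).
rewrite (_ : c + Num.max r 0 - (c + Num.max s 0) = Num.max r 0 - Num.max s 0); last by ring.
by apply; rewrite ?addr_ge0 ?max0_ge// lerD2l max0_mono.
Qed.

Lemma wiener_space_future c s : 0 <= c -> wiener_space B +oo%E (future c s).
Proof.
move=> c0; have [s0|s0] := leP s 0.
  have [h _ _ _] := gaussian_wiener_space hB +oo%E.
  by rewrite (_ : future c s = fun=> 0)//; apply/funext => w; exact: future0.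
exists \1_(`]c + Num.max 0 0, c + Num.max s 0]%classic); split; last by move=> x; rewrite ltNge leey.
have := wiener_rv_future c0 (ltW s0).
by under [X in wiener_rv _ _ X -> _]eq_fun do rewrite (@future0 c 0)// subr0.
Qed.

(** [0 < c] keeps the times away from 0, where [B] is only continuous from the right. *)
Lemma future_continuous c : 0 < c -> {ae P, forall w, continuous (future c ^~ w)}.
Proof.
move=> c0; have [_ cB _ _] := hB; apply: filterS cB => w /subspace_continuousP cw s.
apply: cvgB; last exact: cvg_cst.
have cBx x : 0 < x -> {for x, continuous (fun t => B t w)}.
  move=> x0 A /(cw x (ltW x0)); rewrite /nbhs /= /within /= !nearE => -[e /= e0 he].
  exists (Num.min e x) => /=; first by rewrite lt_min e0.
  move=> y /=; rewrite lt_min => /andP[y1 y2]; apply: he => //=.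
  by move: y2; rewrite ltr_norml; lra.
apply: (@continuous_comp _ _ _ (fun s : R => c + Num.max s 0) (fun t => B t w)).
  apply: cvgD; first exact: cvg_cst.
  by apply: continuous_max; [exact: cvg_id|exact: cvg_cst].
by apply: cBx; rewrite ltr_pwDl ?max0_ge.
Unshelve. all: by end_near. Qed.

(** The integrands have disjoint supports, so their squares add up. *)
Lemma future_orthogonal c Y s r x : 0 <= c -> wiener_space B c%:E Y -> s <= r ->
  L2norm P Y = x%:E ->
  L2norm P (fun w => Y w + (future c r w - future c s w)) =
    (Num.sqrt (x ^+ 2 + (Num.max r 0 - Num.max s 0)))%:E.
Proof.
move=> c0 [f [hf f0]] sr nY; have hF := wiener_rv_future c0 sr.
have x0 : 0 <= x by rewrite -lee_fin -nY L2norm_ge0.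
have rs0 : 0 <= Num.max r 0 - Num.max s 0 by rewrite subr_ge0 max0_mono.
rewrite -(wiener_rv_norm hB (wiener_rvD hf hF)); apply/L2norm_eqP; first exact: sqrtr_ge0.
rewrite sqr_sqrtr; last by rewrite addr_ge0 ?sqr_ge0.
rewrite EFinD.
move: nY; rewrite -(wiener_rv_norm hB hf) => /(L2norm_eqP _ _ x0) <-.
have := wiener_rv_norm hB hF; rewrite (centered_gaussian_norm (future_law c0 sr)).
move=> /(L2norm_eqP _ _ (sqrtr_ge0 _)); rewrite sqr_sqrtr// => <-.
have [mf _ _] := hf; have [mF _ _] := hF.
rewrite -ge0_integralD//; first last.
- exact/measurable_EFinP/measurable_funX.
- exact/measurable_EFinP/measurable_funX.
- by move=> y _; rewrite lee_fin sqr_ge0.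
apply: eq_integral => y _; rewrite -EFinD indicE mem_setE in_itv/=.
have [/andP[cy _]|_] := boolP (_ < y <= _); last by rewrite expr0n !addr0.
rewrite f0 ?add0r ?expr0n ?add0r//.
by rewrite lte_fin; apply: le_lt_trans cy; rewrite lerDl max0_ge.
Qed.

End future.

Section extension.
Context (R : realType) d (Omega : measurableType d) (P : probability Omega R).
Context d' (Omega' : measurableType d') (P' : probability Omega' R) (proj : Omega' -> Omega).
Hypothesis hproj : space_extension P P' proj.

Definition lift_space (G : set (Omega -> R)) : set (Omega' -> R) :=
  [set Y | exists2 X, G X & Y = X \o proj].

Lemma space_extension_ae (S : Omega -> Prop) : {ae P, forall w, S w} ->
  {ae P', forall w, S (proj w)}.
Proof.
have [mproj Pproj] := hproj.
move=> [A [mA A0 hA]]; exists (proj @^-1` A); split.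
- by rewrite -[X in measurable X]setTI; exact: mproj.
- by rewrite Pproj.
- by move=> w /= nS; exact: hA.
Qed.

Lemma centered_gaussian_lift s Y : centered_gaussian P s Y ->
  centered_gaussian P' s (Y \o proj).
Proof.
have [mproj Pproj] := hproj; move=> [mY s0 hY]; split => //; first exact: measurableT_comp.
by move=> A mA; rewrite -hY// -Pproj//; exact: measurable_preimageT.
Qed.

Lemma gaussian_space_lift G : gaussian_space P G -> gaussian_space P' (lift_space G).
Proof.
move=> [G0 GG GD GZ]; split.
- by exists (fun=> 0).
- by move=> _ [X /GG[s gX] ->]; exists s; exact: centered_gaussian_lift.
- by move=> _ _ [X GX ->] [Y GY ->]; exists (fun w => X w + Y w) => //; exact: GD.
- by move=> c _ [X GX ->]; exists (fun w => c * X w) => //; exact: GZ.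
Qed.

Lemma brownian_on_lift G V N : brownian_on P G V N ->
  brownian_on P' (lift_space G) V (fun v => N v \o proj).
Proof.
move=> [N0 N1 N2 cN]; split.
- by move=> v v0 vV; exists (N v) => //; exact: N0.
- by move=> v v0 vV; apply: centered_gaussian_lift; exact: N1.
- by move=> u v u0 uv vV; exact: (centered_gaussian_lift (N2 u v u0 uv vV)).
- exact: space_extension_ae cN.
Qed.

End extension.

Section product.
Context (R : realType) d (Omega : measurableType d) (P : probability Omega R).
Variables (B : R -> {RV P >-> R}) (hB : standard_wiener B).
Local Notation PP := ((P \x P)%E : probability _ R).

Lemma space_extension_fst : space_extension P PP fst.
Proof.
split; first exact: measurable_fst.
move=> A mA; rewrite (_ : fst @^-1` A = A `*` setT); last by apply/seteqP; split => -[x y] //= [].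
transitivity (P A * P setT)%E; first exact: product_measure1E.
by rewrite [P setT]probability_setT mule1.
Qed.

Lemma space_extension_snd : space_extension P PP snd.
Proof.
split; first exact: measurable_snd.
move=> A mA; rewrite (_ : snd @^-1` A = setT `*` A); last by apply/seteqP; split => -[x y] //= [].
transitivity (P setT * P A)%E; first exact: product_measure1E.
by rewrite [P setT]probability_setT mul1e.
Qed.

(** The two coordinates are independent. *)
Lemma product_gaussian_sum s t X Y : centered_gaussian P s X -> centered_gaussian P t Y ->
  centered_gaussian PP (Num.sqrt (s ^+ 2 + t ^+ 2)) (fun z => X z.1 + Y z.2).
Proof.
move=> gX gY; have [mX _ _] := gX; have [mY _ _] := gY.
have gX' := centered_gaussian_lift space_extension_fst gX.
have gY' := centered_gaussian_lift space_extension_snd gY.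
have [mX' _ hX'] := gX'; have [mY' _ hY'] := gY'.
split; [exact: measurable_funD|exact: sqrtr_ge0|].
have := @independent_gaussian_sum _ _ _ _ _ hB _ _ PP _ _ s t setT gX' gY' measurableT.
move=> h A mA; have := h _ A mA.
rewrite setIT [PP setT]probability_setT mule1; apply => C D mC mD.
rewrite setIT mule1 hX'// hY'//.
have [_ _ hX] := gX; have [_ _ hY] := gY.
rewrite -(hX C mC) -(hY D mD) -product_measure1E//; exact: measurable_preimageT.
Qed.

Definition product_space (G : set (Omega -> R)) : set (Omega * Omega -> R) :=
  [set Z | exists X Y, [/\ G X, G Y & Z = fun z => X z.1 + Y z.2]].

Lemma gaussian_product_space G : gaussian_space P G -> gaussian_space PP (product_space G).
Proof.
move=> [G0 GG GD GZ]; split.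
- by exists (fun=> 0), (fun=> 0); split => //; apply/funext => z; rewrite addr0.
- move=> _ [X [Y [/GG[s gX] /GG[t gY] ->]]].
  by exists (Num.sqrt (s ^+ 2 + t ^+ 2)); exact: product_gaussian_sum.
- move=> _ _ [X [Y [GX GY ->]]] [X' [Y' [GX' GY' ->]]].
  exists (fun w => X w + X' w), (fun w => Y w + Y' w); split; [exact: GD|exact: GD|].
  by apply/funext => z; ring.
- move=> c _ [X [Y [GX GY ->]]]; exists (fun w => c * X w), (fun w => c * Y w).
  by split; [exact: GZ|exact: GZ|apply/funext => z; rewrite mulrDr].
Qed.

(** If no time is left on the original space, continue [M], seen as a function of the first
   coordinate, by the restarted [B] of the second coordinate. *)
Lemma product_extension G V M c : gaussian_space P G -> (forall s, G (future B c s)) ->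
  0 < V -> 0 < c -> brownian_on P G V%:E M ->
  exists G' N, [/\ gaussian_space PP G', brownian_on PP G' +oo%E N &
    forall v z, v < V -> N v z = M v z.1].
Proof.
move=> gG GF V0 c0 bM.
have gG' := gaussian_product_space gG.
have gG1 := gaussian_space_lift space_extension_fst gG.
have bM1 := brownian_on_lift space_extension_fst bM.
have [G0 _ _ _] := gG.
have G1G : lift_space fst G `<=` product_space G.
  move=> _ [X GX ->]; exists X, (fun=> 0); split => //.
  by apply/funext => z /=; rewrite addr0.
have GB s : product_space G (fun z => future B c s z.2).
  by exists (fun=> 0), (future B c s); split => //; apply/funext => z; rewrite add0r.
have [|||N [bN NM]] := @brownian_extension _ _ _ PP _ _ _ _ hB _ _ V (fun v z => M v z.1)
    (fun s z => future B c s z.2) gG' gG1 G1G V0 bM1 GB.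
- by move=> s z; exact: future0.
- move=> _ s r x [X GX ->] sr nX.
  have x0 : 0 <= x by rewrite -lee_fin -nX L2norm_ge0.
  have [_ GG _ _] := gG; have [t gX] := GG _ GX.
  have tx : t = x.
    have := centered_gaussian_norm (centered_gaussian_lift space_extension_fst gX).
    by rewrite nX => -[].
  have gF := future_law hB (ltW c0) sr.
  have := centered_gaussian_norm (product_gaussian_sum gX gF).
  by rewrite sqr_sqrtr ?subr_ge0 ?max0_mono// tx.
- exact: (space_extension_ae space_extension_snd (future_continuous hB c0)).
by exists (L2_closure PP (product_space G)), N; split => //; exact: gaussian_space_closure hB _ gG'.
Qed.

(** If [M] only uses [B] up to time [c], the later increments of [B] continue it. *)
Lemma wiener_extension c V M : 0 < c -> 0 < V -> brownian_on P (wiener_space B c%:E) V%:E M ->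
  exists G' N, [/\ gaussian_space P G', brownian_on P G' +oo%E N &
    forall v w, v < V -> N v w = M v w].
Proof.
move=> c0 V0 bM.
have gG := gaussian_wiener_space hB +oo%E.
have G1G : wiener_space B c%:E `<=` wiener_space B +oo%E.
  by move=> Y [f [hf _]]; exists f; split => // x; rewrite ltNge leey.
have [|||N [bN NM]] := @brownian_extension _ _ _ P _ _ _ _ hB _ _ V M
    (future B c) gG (gaussian_wiener_space hB c%:E) G1G V0 bM
    (fun s => wiener_space_future hB s (ltW c0)).
- by move=> s z; exact: future0.
- by move=> Y s r x GY sr nY; exact: future_orthogonal (ltW c0) GY sr nY.
- exact: future_continuous.
by exists (L2_closure P (wiener_space B +oo%E)), N; split => //; exact: gaussian_space_closure hB _ gG.
Qed.

End product.


(** * The representation *)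

Theorem proposition2p3 (d : measure_display) (Omega : measurableType d)
    (R : realType) (P : probability Omega R)
    (T : \bar R) (hT : (0 < T)%E)
    (a b : R -> R)
    (ha_pos : forall t, open_horizon T t -> 0 < a t)
    (ha_C1 : C1_on (open_horizon T) a (derive1 a))
    (hb_C1 : C1_on (open_horizon T) b (derive1 b))
    (hb_deriv : forall t, open_horizon T t -> 0 < derive1 b t)
    (hb_lim : b t @[t --> 0^'+] --> -oo)
    (psi : R -> R) (hpsi : {within horizon T, continuous psi})
    (phi dphi : R -> R)
    (hphi : forall t, open_horizon T t -> phi t = a t / expR (b t / 2))
    (hphi0 : phi 0 = 1)
    (hphi_C1 : C1_on (horizon T) phi dphi)
    (sigma : R -> R)
    (hsigma : forall t, open_horizon T t ->
                sigma t = Num.sqrt (derive1 b t * a t ^+ 2))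
    (hsigma_cont : {within horizon T, continuous sigma})
    (B : R -> {RV P >-> R}) (hB : standard_wiener B)
    (xi : R) (Z : R -> {RV P >-> R})
    (hZ : strong_solution B T (fun t z => dphi t / phi t * z + psi t)
            sigma xi Z) :
  scaled_OU_representation P T a b (fun t w => Z t w - fine ('E_P[Z t])%E).
Proof.
have nb c := noise_brownian ha_pos hb_C1 hb_deriv hb_lim hpsi hphi hphi0 hphi_C1
  hsigma hsigma_cont hB hZ (c := c).
have ou := @scaled_OU_of_brownian _ _ _ _ _ hT _ _ ha_pos hb_C1 hb_deriv hb_lim _ hpsi
  _ _ hphi hphi0 hphi_C1 _ hsigma hsigma_cont _ hB _ _ hZ.
have lt_V t := @expb_lt_horizon _ _ _ hb_C1 hb_deriv t.
set V := noise_horizon T b in nb ou lt_V.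
have idP : space_extension P P idfun by split; first exact: measurable_id.
have [t0 t00 t0T] := horizon_above hT.
have V0 : (0 < V)%E.
  by apply: lt_trans (lt_V t0 _); rewrite ?lte_fin ?expR_gt0.
have [Vy|[v vE]] : V = +oo%E \/ exists v, V = v%:E.
  by move: V0; case: V {nb ou lt_V} => [v _|_|//]; [right; exists v|left].
(* an unbounded clock: the noise already is a Brownian motion for all times *)
- have ouP : scaled_OU P T a b (fun t w => Z t w - fine ('E_P[Z t])%E).
    move: (nb _ (leey T)); rewrite Vy => bN.
    exact: ou idP (gaussian_wiener_space hB +oo%E) bN _.
  by split => [_ //|]; exists d, Omega, P, idfun; split; [exact: idP|exact: ouP].
have v0 : 0 < v by rewrite -lte_fin -vE.
split.
(* a bounded clock forces [T] to be finite here: continue with [B] after [T] *)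
- move=> hTb; have [r rE] : exists r, T = r%:E.
    case: hTb => [|unb]; last first.
      exfalso; apply: unb; exists (ln v) => t ot; rewrite -[b t]expRK ler_ln ?posrE ?expR_gt0//.
      by apply: ltW; rewrite -lte_fin -vE; exact: lt_V.
    by move: hT; case: (T) => // r _ _; exists r.
  have r0 : 0 < r by rewrite -lte_fin -rE.
  have rT : (T <= r%:E)%E by rewrite rE.
  move: (nb _ rT); rewrite vE => bN.
  have [G [N [gG bN' NE]]] := wiener_extension hB r0 v0 bN.
  by apply: (ou _ _ P idfun G N idP gG bN') => u w; rewrite vE lte_fin; exact: NE.
(* in any case: continue with an independent copy of [B] *)
- move: (nb _ (leey T)); rewrite vE => bN.
  have gG := gaussian_wiener_space hB +oo%E.
  have hF s := wiener_space_future hB s ler01.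
  have [G [N [gG' bN' NE]]] := product_extension hB gG hF v0 ltr01 bN.
  exists _, _, (P \x P)%E, fst; split; first exact: space_extension_fst.
  by apply: (ou _ _ _ fst G N _ gG' bN') => [|u w]; [exact: space_extension_fst|rewrite vE lte_fin; exact: NE].
Qed.
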